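(* Let $\mathcal C=V(f)\subset\mathbb{C}^2$ be a generic curve through the origin defined by a polynomial $f$ with real coefficients. For every squarefree positive integer $d$, there exists at least one real $(d,d)$-interpolant of $\mathcal C$.
   Context: A $(d,d)$-interpolant of $V(f)$ is a curve which is the image of a generically one-to-one polynomial map $t\mapsto(x_1(t),x_2(t))$ with $\deg x_1=\deg x_2=d$, $x_1(0)=x_2(0)=0$, and $f(x_1(t),x_2(t))\equiv0\pmod{t^{2d}}$. It is real if it is the image of such a map with $x_1,x_2\in\mathbb{R}[t]$. ''Generic'' means the real coefficient vector of $f$ (on monomials of total degree at most $2d$) lies outside a proper Zariski closed subset. *)

(* Defs.v *)
From HB Require Import structures.
From mathcomp Require Import all_boot all_order all_algebra.
From mathcomp Require Import reals.
From mathcomp Require Import mpoly.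
From mathcomp.real_closed Require Import complex.
Set Implicit Arguments. Unset Strict Implicit. Unset Printing Implicit Defensive.
Import Order.TTheory GRing.Theory Num.Theory.
Local Open Scope ring_scope.

(* Bivariate real polynomials f(x_1,x_2) are elements of {mpoly R[2]};
   variable 'X_0 is x_1 and 'X_1 is x_2. *)

(* Index set of the coefficient space used for genericity of curves through
   the origin: monomials of total degree d' with 1 <= d' <= 2d (the constant
   term is 0 for a curve through the origin). *)
Definition coef_index (d : nat) : finType :=
  {m : 'X_{1.. 2 < (2 * d)%N.+1} | (0 < mdeg m)%N}.

Definition ncoef (d : nat) : nat := #|{: coef_index d}|.

Definition coefvec (R : realType) (d : nat) (f : {mpoly R[2]}) : 'I_(ncoef d) -> R :=
  fun i => f@_(val (val (enum_val i))).

(* A property Q of real bivariate polynomials through the origin holds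
   generically (w.r.t. coefficients of degree <= 2d) if it holds for all f
   whose coefficient vector lies outside a proper Zariski closed subset
   Z = V(S) of R^(ncoef d). *)
Definition generic_origin (R : realType) (d : nat) (Q : {mpoly R[2]} -> Prop) : Prop :=
  exists S : {mpoly R[ncoef d]} -> Prop,
    (exists v : 'I_(ncoef d) -> R, exists p, S p /\ p.@[v] != 0) /\
    forall f : {mpoly R[2]}, f@_0 = 0 ->
      ~ (forall p, S p -> p.@[@coefvec R d f] = 0) -> Q f.

Definition comp_curve (R : realType) (f : {mpoly R[2]}) (x1 x2 : {poly R}) : {poly R} :=
  (map_mpoly (@polyC R) f).@[fun i : 'I_2 => if val i == 0%N then x1 else x2].

Definition cpoly (R : realType) (p : {poly R}) : {poly R[i]} :=
  map_poly (fun r : R => Complex r 0) p.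

Definition generically_injective (R : realType) (x1 x2 : {poly R}) : Prop :=
  exists s : seq R[i], forall t u : R[i], t \notin s -> u \notin s ->
    (cpoly x1).[t] = (cpoly x1).[u] -> (cpoly x2).[t] = (cpoly x2).[u] -> t = u.

Definition real_dd_interpolant_param (R : realType) (d : nat) (f : {mpoly R[2]})
    (x1 x2 : {poly R}) : Prop :=
  [/\ size x1 = d.+1, size x2 = d.+1, x1.[0] = 0, x2.[0] = 0 &
      generically_injective x1 x2 /\ ('X^(2 * d)%N %| comp_curve f x1 x2)].

Definition has_real_dd_interpolant (R : realType) (d : nat) (f : {mpoly R[2]}) : Prop :=
  exists x1 x2 : {poly R}, real_dd_interpolant_param d f x1 x2.

Definition squarefree_nat (n : nat) : Prop :=
  forall p : nat, prime p -> ~~ (p * p %| n)%N.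

(* Main.v *)
Require Import Defs.
From HB Require Import structures.
From mathcomp Require Import all_boot all_order all_algebra.
From mathcomp Require Import reals.
From mathcomp Require Import mpoly.
From mathcomp.real_closed Require Import complex.
From mathcomp Require Import boolp.
From mathcomp Require Import ssrcomplements.
From mathcomp Require Import cyclic all_field.
From mathcomp Require Import ring zify.
Set Implicit Arguments.
Unset Strict Implicit.
Unset Printing Implicit Defensive.
Import Order.TTheory GRing.Theory Num.Theory.
Local Open Scope ring_scope.

(** Write [x(t) = u_1 t + ... + u_d t^d] and [y(t) = w_1 t + ... + w_d t^d] and let
    [Phi_i], for [1 <= i <= 2d], be the coefficient of [t^i] in [f(x(t), y(t))]. It is
    homogeneous of weight [i] when [u_i] and [w_i] have weight [i]. A real interpolant
    is a real zero of [Phi_1, ..., Phi_(2d-1)] with [u_d, w_d <> 0] that is generically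
    injective.

    For the hyperbola [(1 + x)(1 + y) = 1] the [Phi_i] are the coefficients of the
    product of the two polynomials [1 + x(t)] and [1 + y(t)]. The polynomial ring in
    the [u_i, w_i] is then free over [R[Phi_1, ..., Phi_2d]], a basis being given by
    the monomials of degree at most [d] in the [u_i], i.e. by the partitions in a
    [d x d] box. By a determinant argument and a count of monomials this remains true
    for generic [f]. Specializing [Phi_i] to [0] for [i < 2d] and [Phi_2d] to [-1] gives
    a finite-dimensional algebra graded by [Z/2d]. Its degree 1 part has a dimension
    which depends only on [d], and which is odd when [d] is squarefree: modulo 2 the
    Gaussian binomial [2d choose d] is the product of the [1 + s^k], [k < 2d] odd. The
    degree 0 part therefore has a real eigenvector on the dual of the degree 1 part,
    hence a real character [chi]. If [M] has degree 1 and [chi(M^2d) <> 0], then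
    [chi(u_i M^((2d-1)i))] and [chi(w_i M^((2d-1)i))] are the coordinates of a real
    zero of [Phi_1, ..., Phi_(2d-1)].

    That a suitable [M] exists, and that the zero has [u_d, w_d <> 0] and defines a
    generically injective map, is a generic condition as well. It holds for the
    hyperbola, whose complex zeros correspond to the sets of [d] among the [2d]-th
    roots of unity: the degree 1 part only sees the sets with trivial stabilizer under
    rotation, and two parameters with the same image differ by a [2d]-th root of unity. *)


(** * Partitions in a box and class sums of polynomials *)

(* The partitions with at most [l] parts, all at most [k]; each is the list of its
   parts. *)
Fixpoint box (k l : nat) : seq (seq nat) :=
  match k with
  | 0 => [:: [::]]
  | k'.+1 =>
      (fix boxl l := match l with
         | 0 => [:: [::]]
         | l'.+1 => box k' l'.+1 ++ map (cons k) (boxl l')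
         end) l
  end.

Lemma boxl0 k : box k 0 = [:: [::]]. Proof. by case: k. Qed.
Lemma boxS k l : box k.+1 l.+1 = box k l.+1 ++ map (cons k.+1) (box k.+1 l).
Proof. by []. Qed.

Lemma size_box k l : size (box k l) = 'C(k + l, k).
Proof.
elim: k l => [|k IHk] l; first by rewrite bin0.
elim: l => [|l IHl]; first by rewrite addn0 binn.
by rewrite boxS size_cat size_map IHk IHl addnC [in RHS]addSn binS addSnnS.
Qed.

Lemma box_parts k l b : b \in box k l -> all (fun i => 0 < i <= k)%N b.
Proof.
elim: k l b => [|k IHk] l b; first by rewrite inE => /eqP->.
elim: l b => [|l IHl] b; first by rewrite inE => /eqP->.
rewrite boxS mem_cat => /orP[/IHk|/mapP[b' /IHl hb' ->]] /=.
  by apply: sub_all => i; lia.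
by rewrite leqnn.
Qed.

Lemma nil_in_box k l : [::] \in box k l.
Proof.
elim: k l => [|k IHk] [|l] //.
by rewrite boxS mem_cat IHk.
Qed.

Section GaussianBinomial.
Variable A : comNzRingType.

Definition boxpoly k l : {poly A} := \sum_(b <- box k l) 'X^(sumn b).
Definition qpoch n : {poly A} := \prod_(i < n) (1 - 'X^(i.+1)).

(** The product formula for the Gaussian binomial, cleared of denominators; the recursion defining
    [box] is the q-Pascal rule. *)
Lemma boxpolyE k l : boxpoly k l * qpoch k * qpoch l = qpoch (k + l).
Proof.
elim: k l => [|k IHk] l.
  by rewrite /boxpoly /qpoch big_seq1 big_ord0 mulr1 mul1r.
elim: l => [|l IHl].
  by rewrite /boxpoly boxl0 /qpoch big_seq1 big_ord0 mulr1 mul1r addn0.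
have -> : boxpoly k.+1 l.+1 = boxpoly k l.+1 + 'X^(k.+1) * boxpoly k.+1 l.
  rewrite /boxpoly boxS big_cat big_map mulr_sumr /=; congr (_ + _).
  by apply: eq_bigr => b _; rewrite exprD.
have qS n : qpoch n.+1 = qpoch n * (1 - 'X^(n.+1)).
  by rewrite /qpoch big_ord_recr.
transitivity (boxpoly k l.+1 * qpoch k * qpoch l.+1 * (1 - 'X^(k.+1))
   + 'X^(k.+1) * (1 - 'X^(l.+1)) * (boxpoly k.+1 l * qpoch k.+1 * qpoch l)).
  by rewrite !qS; ring.
rewrite IHk IHl !addSn !addnS [in RHS]qS.
have -> : 'X^((k + l).+2) = 'X^(k.+1) * 'X^(l.+1) :> {poly A}.
  by rewrite -exprD addnS addSn.
by ring.
Qed.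
End GaussianBinomial.

Section ClassSums.
Variable F : fieldType.
Implicit Types p q : {poly F}.

(** The sum of the coefficients of [p] in exponents congruent to [c] modulo [m], read off the
    remainder modulo [X^m - 1]. *)
Definition csum m c p : F := (p %% ('X^m - 1))`_(c %% m).

Lemma size_XmB1 m : (0 < m)%N -> size ('X^m - 1 : {poly F}) = m.+1.
Proof. by move=> m0; rewrite size_XnsubC. Qed.

Lemma Xn_mod m j : (0 < m)%N -> 'X^j %% ('X^m - 1) = 'X^(j %% m) :> {poly F}.
Proof.
move=> m0; have : ('X^m - 1 : {poly F}) %| 'X^j - 'X^(j %% m).
  rewrite {1}(divn_eq j m) exprD -{2}['X^(j %% m)]mul1r -mulrBl dvdp_mulr //.
  by rewrite mulnC exprM -{2}[1](expr1n _ (j %/ m)) subrXX dvdp_mulr.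
move=> /modp_eq0; rewrite modpD modpN => /eqP; rewrite subr_eq0 => /eqP ->.
by rewrite modp_small // size_XmB1 // size_polyXn ltnS ltn_mod.
Qed.

Lemma csumX m c j : (0 < m)%N -> csum m c 'X^j = (j == c %[mod m])%:R.
Proof. by move=> m0; rewrite /csum Xn_mod // coefXn eq_sym. Qed.

Lemma csumD m c p q : csum m c (p + q) = csum m c p + csum m c q.
Proof. by rewrite /csum modpD coefD. Qed.
Lemma csumZ m c a p : csum m c (a *: p) = a * csum m c p.
Proof. by rewrite /csum modpZl coefZ. Qed.
Lemma csum_sum m c I (r : seq I) P (f : I -> {poly F}) :
  csum m c (\sum_(i <- r | P i) f i) = \sum_(i <- r | P i) csum m c (f i).
Proof.
apply: (big_morph (csum m c)); first exact: csumD.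
by rewrite /csum mod0p coef0.
Qed.

Lemma csumE m c p : (0 < m)%N ->
  csum m c p = \sum_(j < size p) p`_j * (j == c %[mod m])%:R.
Proof.
move=> m0; rewrite -{1}[p]coefK poly_def csum_sum.
by apply: eq_bigr => j _; rewrite csumZ csumX.
Qed.

Lemma csum_eqmod m c p q : 'X^m - 1 %| p - q -> csum m c p = csum m c q.
Proof.
move=> /modp_eq0; rewrite modpD modpN => /eqP; rewrite subr_eq0 => /eqP e.
by rewrite /csum e.
Qed.

(** Both sides are linear in [p], so identities between class sums need checking on monomials
    only. *)
Lemma csum_lin m c m' c' (f : {poly F} -> {poly F}) : (0 < m)%N -> (0 < m')%N ->
  {morph f : p q / p + q} -> (forall a p, f (a *: p) = a *: f p) ->
  (forall j, csum m c (f 'X^j) = csum m' c' 'X^j) ->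
  forall p, csum m c (f p) = csum m' c' p.
Proof.
move=> m0 m'0 fD fZ fX p; rewrite -{1}[p]coefK poly_def.
have f0 : f 0 = 0 by have := fZ 0 0; rewrite !scale0r.
rewrite (big_morph f fD f0) csum_sum (csumE _ _ m'0); apply: eq_bigr => j _.
by rewrite fZ csumZ fX csumX.
Qed.

Lemma csum_mulXn m c k p : (0 < m)%N ->
  csum m (c + k) ('X^k * p) = csum m c p.
Proof.
move=> m0; apply: (csum_lin (f := fun p => 'X^k * p)) => //.
- by move=> *; rewrite mulrDr.
- by move=> *; rewrite scalerAr.
by move=> j; rewrite -exprD !csumX // addnC eqn_modDr.
Qed.

Lemma csum_comp m c u p : (0 < m)%N -> (0 < u)%N ->
  csum (u * m) (u * c) (p \Po 'X^u) = csum m c p.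
Proof.
move=> m0 u0; apply: (csum_lin (f := fun p => p \Po 'X^u)) => //; rewrite ?muln_gt0 ?u0 //.
- by move=> *; rewrite comp_polyD.
- by move=> *; rewrite comp_polyZ.
move=> j; rewrite comp_Xn_poly -exprM !csumX ?muln_gt0 ?u0 //.
by rewrite -!muln_modr eqn_mul2l; case: u u0.
Qed.

Lemma csum_unit m c u p : (0 < m)%N -> coprime u m ->
  csum m (u * c) (p \Po 'X^u) = csum m c p.
Proof.
move=> m0 um; apply: (csum_lin (f := fun p => p \Po 'X^u)) => //.
- by move=> *; rewrite comp_polyD.
- by move=> *; rewrite comp_polyZ.
move=> j; rewrite comp_Xn_poly -exprM !csumX //; congr (_%:R).
wlog le_cj : c j / (c <= j)%N => [H|].
  case/orP: (leq_total c j) => h; first exact: H.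
  by rewrite eq_sym H // eq_sym.
rewrite !eqn_mod_dvd ?leq_mul2l ?le_cj ?orbT // -mulnBr.
by rewrite mulnC Gauss_dvdl // coprime_sym.
Qed.
End ClassSums.

Section ProductsModulo.
Variables (F : fieldType) (q : {poly F}).
Lemma dvdp_sub_prod I (r : seq I) (P : pred I) (f g : I -> {poly F}) :
  (forall i, P i -> q %| f i - g i) ->
  q %| \prod_(i <- r | P i) f i - \prod_(i <- r | P i) g i.
Proof.
move=> h; elim/big_rec2: _ => [|i x y Pi hxy]; first by rewrite subrr dvdp0.
have -> : f i * y - g i * x = (f i - g i) * y + g i * (y - x) by ring.
by apply: dvdp_add; [apply: dvdp_mulr; exact: h | exact: dvdp_mull].
Qed.
End ProductsModulo.

(** * Parity of the number of box partitions of weight 1 modulo 2d *)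

Section Char2Identities.
Variable A : comNzRingType.
Implicit Types a b c e x : A.
Lemma sqr_onePx x : x + x = 0 -> (1 + x) * (1 + x) = 1 + x * x.
Proof. by move=> h; rewrite mulrDl mul1r mulrDr mulr1 addrA -(addrA 1 x x) h addr0. Qed.
Lemma mul_rearrange a b c e : c * (a * a) * b * (e * e) = c * b * (a * e * (a * e)).
Proof. by ring. Qed.
Lemma geom_rearrange a b x : a * b * (x - 1) = a * ((x - 1) * b).
Proof. by ring. Qed.
Lemma addr_subD_cancel a x : a + x - (1 + a) = x - 1.
Proof. by ring. Qed.
End Char2Identities.

Section Parity.
Local Notation P2 := {poly 'F_2}.

Lemma pchar2_P2 : 2 \in [pchar P2].
Proof. by rewrite pchar_poly pchar_Fp. Qed.

Lemma natr_F2 n : n%:R = (odd n)%:R :> 'F_2.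
Proof.
rewrite -{1}[n]odd_double_half natrD -mul2n natrM.
by rewrite (_ : 2%:R = 0 :> 'F_2) ?mul0r ?addr0 //; apply/val_inj.
Qed.

Lemma F2_neq0 (x : 'F_2) : x != 0 -> x = 1.
Proof. by case: x => [[|[|]]] //= h; move=> // _; apply/val_inj. Qed.

Definition odd_prod d : P2 := \prod_(i < d) (1 + 'X^(i.*2.+1)).
Definition res_prod d : P2 := \prod_(k < d | k != 0 :> nat) (1 + 'X^k).

(** Modulo 2, [1 - X^(2k)] is the square of [1 - X^k]: the even-indexed factors in the numerator of
    the Gaussian binomial cancel the whole denominator. *)
Lemma boxpoly_F2 d : boxpoly 'F_2 d d = odd_prod d.
Proof.
have Qd : qpoch 'F_2 (d + d) = odd_prod d * (qpoch 'F_2 d * qpoch 'F_2 d).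
  elim: d => [|d IHd]; first by rewrite /qpoch /odd_prod !big_ord0 !mulr1.
  have qS n : qpoch 'F_2 n.+1 = qpoch 'F_2 n * (1 - 'X^(n.+1)).
    by rewrite /qpoch big_ord_recr.
  have oS : odd_prod d.+1 = odd_prod d * (1 + 'X^(d.*2.+1)).
    by rewrite /odd_prod big_ord_recr.
  rewrite addSn addnS !qS IHd oS !(oppr_pchar2 pchar2_P2) addnn.
  have -> : 1 + 'X^(d.*2.+2) = (1 + 'X^(d.+1)) * (1 + 'X^(d.+1)) :> P2.
    by rewrite sqr_onePx ?(addrr_pchar2 pchar2_P2) // -exprD addnS addSn addnn.
  exact: mul_rearrange.
have Q0 n : qpoch 'F_2 n != 0.
  apply/prodf_neq0 => i _; rewrite -opprB oppr_eq0 -size_poly_eq0.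
  by rewrite size_XmB1.
have := boxpolyE 'F_2 d d; rewrite Qd -mulrA.
by apply: mulIf; rewrite mulf_neq0.
Qed.

(** A class modulo [d] splits into two classes modulo [2 * d], exchanged by the shift by [d]; the
    factor [1 + X^d] adds up their contributions. *)
Lemma csum_half d c (p : P2) : (0 < d)%N ->
  csum (2 * d) c ((1 + 'X^d) * p) = csum d c p.
Proof.
move=> d0; apply: (csum_lin (f := fun p => (1 + 'X^d) * p)); rewrite ?muln_gt0 //.
- by move=> *; rewrite mulrDr.
- by move=> *; rewrite scalerAr.
move=> j; rewrite mulrDl mul1r -exprD csumD !csumX ?muln_gt0 //.
have md : (0 < 2 * d)%N by rewrite muln_gt0.
have m_dvd : (d %| 2 * d)%N by rewrite dvdn_mull.
have ej : (j %% d)%N = (j %% (2 * d) %% d)%N by rewrite modn_dvdm.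
have ec : (c %% d)%N = (c %% (2 * d) %% d)%N by rewrite modn_dvdm.
have ed : ((d + j) %% (2 * d) = (d + j %% (2 * d)) %% (2 * d))%N by rewrite modnDmr.
rewrite ej ec ed {ej ec ed m_dvd}.
have := ltn_pmod j md; have := ltn_pmod c md.
move: (j %% (2 * d))%N (c %% (2 * d))%N => x y hy hx.
have mm z : (z < 2 * d)%N -> (z %% d = if z < d then z else z - d)%N.
  move=> hz; case: ltnP => h; first by rewrite modn_small.
  by rewrite -{1}(subnK h) modnDr modn_small //; lia.
rewrite !mm //.
have -> : ((d + x) %% (2 * d) = if x < d then d + x else x - d)%N.
  case: ltnP => h; first by rewrite modn_small //; lia.
  have -> : (d + x = (x - d) + 2 * d)%N by lia.
  by rewrite modnDr modn_small //; lia.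
case: (ltnP x d) => h1; case: (ltnP y d) => h2; rewrite -natrD;
  congr (_%:R); lia.
Qed.

Lemma onePXn_mod d j : (0 < d)%N ->
  ('X^d - 1 : P2) %| (1 + 'X^j) - (1 + 'X^(j %% d)).
Proof.
move=> d0; rewrite opprD addrACA subrr add0r.
by rewrite /dvdp modpD modpN !Xn_mod // modn_mod subrr.
Qed.

(** Exponents matter only modulo [d], and [f] permutes the residues; [k0] is the index sent to the
    residue 0, which [res_prod] omits. *)
Lemma res_prod_reindex d (f : nat -> nat) : (0 < d)%N ->
  {in gtn d &, injective (fun k => f k %% d)%N} ->
  forall k0, (k0 < d)%N -> (d %| f k0)%N ->
  ('X^d - 1 : P2) %| \prod_(k < d | k != k0 :> nat) (1 + 'X^(f k)) - res_prod d.
Proof.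
move=> d0 finj k0 hk0 dk0.
pose h (k : 'I_d) := Ordinal (ltn_pmod (f k) d0).
have hinj : injective h.
  move=> x y /(congr1 val) /= e; apply/val_inj/finj; rewrite ?inE //; exact: ltn_ord.
have -> : res_prod d = \prod_(k < d | k != k0 :> nat) (1 + 'X^(f k %% d)).
  rewrite /res_prod (reindex_inj hinj) /=; apply: eq_bigl => k.
  congr (~~ _); apply/eqP/eqP => [e|->]; last exact/eqP.
  by apply: finj; rewrite ?inE ?ltn_ord //= e; apply/esym/eqP.
by apply: dvdp_sub_prod => k _; exact: onePXn_mod.
Qed.

(** For odd [d] the numbers [2i + 1], [i < d], represent all residues modulo [d]. The one equal to
    [d] yields the factor that lowers the modulus to [d]. *)
Lemma csum_odd_prod d c : odd d -> csum (2 * d) c (odd_prod d) = csum d c (res_prod d).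
Proof.
move=> od; have d0 : (0 < d)%N by case: d od.
have hd : (d./2 < d)%N by lia.
rewrite /odd_prod (bigD1 (Ordinal hd)) //=.
have -> : (d./2).*2.+1 = d by lia.
rewrite csum_half //; apply: csum_eqmod.
apply: (@res_prod_reindex d (fun i => i.*2.+1)) => //; last first.
  by rewrite (_ : (d./2).*2.+1 = d) //; lia.
move=> x y; rewrite !inE => hx hy /=.
have mm z : (z < d)%N -> (z.*2.+1 %% d = if z.*2.+1 < d then z.*2.+1 else z.*2.+1 - d)%N.
  move=> hz; case: ltnP => h; first by rewrite modn_small.
  rewrite -{1}(subnK h) modnDr; case: (ltnP (z.*2.+1 - d) d) => h'; last by lia.
  by rewrite modn_small.
by rewrite !mm //; case: ltnP => ?; case: ltnP => ?; lia.
Qed.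

Lemma csum_res_prod_unit d c u : (0 < d)%N -> coprime u d ->
  csum d (u * c) (res_prod d) = csum d c (res_prod d).
Proof.
move=> d0 ud; rewrite -[RHS](@csum_unit _ d c u) //; apply/esym/csum_eqmod.
rewrite rmorph_prod /=.
under eq_bigr do rewrite rmorphD rmorph1 rmorphXn /= comp_polyX -exprM.
apply: (@res_prod_reindex d (fun k => u * k)%N) => //; last by rewrite muln0.
move=> x y; rewrite !inE => hx hy /eqP.
wlog le_yx : x y hx hy / (y <= x)%N => [H|].
  case/orP: (leq_total y x) => h; first exact: H.
  by rewrite eq_sym => /H -> //.
rewrite eqn_mod_dvd ?leq_mul2l ?le_yx ?orbT // -mulnBr mulnC Gauss_dvdl 1?coprime_sym //.
by move=> /dvdnP [[|q]] e; lia.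
Qed.

Lemma csum_mod m c c' (p : P2) : c = c' %[mod m] -> csum m c p = csum m c' p.
Proof. by rewrite /csum => ->. Qed.

Lemma csum_eq0 m c (p : P2) : 'X^m - 1 %| p -> csum m c p = 0.
Proof. by move=> /modp_eq0 e; rewrite /csum e coef0. Qed.

(** With [q = d / p], the product contains [1 + X^q = X^q - 1], which turns
    [1 + X^q + ... + X^((p-1)q)] into [X^d - 1]. *)
Lemma sum_csum_res_prod d p c : (0 < d)%N -> prime p -> (p %| d)%N ->
  \sum_(j < p) csum d (c + j * (d %/ p)) (res_prod d) = 0.
Proof.
move=> d0 pp /dvdnP [q dq]; have p0 := prime_gt0 pp; have p1 := prime_gt1 pp.
rewrite dq mulnK // -dq.
have q0 : (0 < q)%N by move: d0; rewrite dq muln_gt0 => /andP[].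
have hq : (q < d)%N by rewrite dq; nia.
transitivity (csum d (c + d) ((\sum_(j < p) 'X^((p - j) * q)) * res_prod d)).
  rewrite mulr_suml csum_sum; apply: eq_bigr => j _.
  rewrite -(@csum_mulXn _ d _ ((p - j) * q)) //; congr csum.
  by rewrite -addnA -mulnDl subnKC ?(ltnW (ltn_ord j)) // mulnC -dq.
have -> : res_prod d = (1 + 'X^q) * \prod_(k < d | (k != 0 :> nat) && (k != q :> nat)) (1 + 'X^k).
  by rewrite /res_prod (bigD1 (Ordinal hq)) //= -lt0n.
rewrite mulrA; apply/csum_eq0/dvdp_mulr.
have -> : (\sum_(j < p) 'X^((p - j) * q)) = 'X^q * \sum_(j < p) ('X^q) ^+ j :> P2.
  rewrite mulr_sumr (reindex_inj rev_ord_inj) /=; apply: eq_bigr => j _.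
  by rewrite -exprM -exprD; congr ('X^ _); have := ltn_ord j; nia.
have -> : 'X^q * (\sum_(j < p) 'X^q ^+ j) * (1 + 'X^q) = 'X^q * ('X^d - 1) :> P2.
  have -> : 1 + 'X^q = 'X^q - 1 :> P2 by rewrite addrC (oppr_pchar2 pchar2_P2).
  by rewrite geom_rearrange -subrX1 -exprM -dq.
exact: dvdp_mull.
Qed.

(** Let a prime [p] divide [c] and [d], and put [q = d / p]. Among the classes [c + j q], those with
    [0 < j < p] are related by units, so their sums agree, and their number [p - 1] is even. The
    vanishing total thus reduces to the term at [c]. *)
Lemma csum_res_prod_eq0 d c : odd d -> (forall p, prime p -> ~~ (p * p %| d)%N) ->
  ~~ coprime c d -> csum d c (res_prod d) = 0.
Proof.
move=> od sq ncd; have d0 : (0 < d)%N by case: d od {sq ncd}.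
have g1 : (1 < gcdn c d)%N.
  by rewrite ltn_neqAle eq_sym ncd gcdn_gt0 d0 orbT.
pose p := pdiv (gcdn c d); have pp : prime p := pdiv_prime g1.
have pg : (p %| gcdn c d)%N := pdiv_dvd _.
have pc : (p %| c)%N := dvdn_trans pg (dvdn_gcdl _ _).
have pd : (p %| d)%N := dvdn_trans pg (dvdn_gcdr _ _).
have p0 := prime_gt0 pp.
have := sum_csum_res_prod c d0 pp pd; set q := (d %/ p)%N.
have dE : (d = p * q)%N by rewrite mulnC divnK.
have pq : coprime p q.
  rewrite prime_coprime //; apply/negP => pq.
  by have /negP := sq _ pp; apply; rewrite dE dvdn_pmul2l.
have odp : odd p by move: od; rewrite dE oddM => /andP[].
rewrite (bigD1 (Ordinal p0)) //= mul0n addn0.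
rewrite (eq_bigr (fun=> csum d (c + q) (res_prod d))) => [|j j0].
  rewrite sumr_const cardC1 card_ord -mulr_natr natr_F2.
  by rewrite (_ : odd p.-1 = false) ?mulr0 ?addr0 //; lia.
have {j0} j0 : (0 < j)%N by move: j0; rewrite -val_eqE lt0n.
(* As [p] divides [c], this unit carries [c + q] to [c + j * q] modulo [d]. *)
pose u := chinese p q j 1.
have up : (u = j %[mod p])%N := chinese_modl pq _ _.
have uq : (u = 1 %[mod q])%N := chinese_modr pq _ _.
have ud : coprime u d.
  rewrite dE coprimeMr -(coprime_modl u p) up coprime_modl -(coprime_modl u q) uq coprime_modl coprime1n andbT.
  by rewrite coprime_sym prime_coprime // gtnNdvd.
rewrite -(csum_res_prod_unit (c + q) d0 ud); apply: csum_mod.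
apply/eqP; rewrite dE chinese_remainder //; apply/andP; split; apply/eqP.
  rewrite -[RHS]modnMml up modnMml mulnDr -modnDml (eqP pc) add0n.
  by rewrite -[RHS]modnDml (eqP (dvdn_mull j pc)) add0n.
by rewrite -[RHS]modnMml uq modnMml mul1n modnDr addnC modnMDl.
Qed.

(** At a primitive [d]-th root of unity [z] over F_2, which exists as [d] is odd, each factor
    [1 + z^k = z^k - 1] with [0 < k < d] is nonzero. *)
Lemma res_prod_neq0_mod d : odd d -> ~~ (('X^d - 1 : P2) %| res_prod d).
Proof.
move=> od; have d0 : (0 < d)%N by case: d od.
have q0 : 'X^d - 1 != 0 :> P2 by rewrite -size_poly_eq0 size_XmB1.
have [L [rs]] := FinSplittingFieldFor q0.
rewrite rmorphB rmorph1 rmorphXn /= map_polyX => eqp _.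
have dL : d%:R = 1 :> L.
  by rewrite -(rmorph_nat (in_alg L)) natr_F2 od rmorph1.
have urs : uniq rs.
  rewrite -separable_prod_XsubC -(eqp_separable eqp).
  by apply: separable_Xn_sub_1; rewrite dL oner_neq0.
have srs : size rs = d.
  by have := eqp_size eqp; rewrite size_prod_XsubC size_XmB1 // => -[].
have rrs : all d.-unity_root rs.
  apply/allP => z zrs; rewrite /root_of_unity (eqp_root eqp).
  by rewrite root_prod_XsubC.
have /hasP [z _ zprim] := has_prim_root d0 rrs urs (eq_leq (esym srs)).
rewrite -(dvdp_map (in_alg L)) rmorphB rmorph1 rmorphXn /= map_polyX; apply/negP.
case/dvdpP => w /(congr1 (horner^~ z)).
rewrite hornerM !hornerE (prim_expr_order zprim) subrr mulr0.
rewrite /res_prod rmorph_prod /= horner_prod => /eqP/prodf_eq0 [k k0].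
rewrite rmorphD rmorph1 rmorphXn /= map_polyX !hornerE => /eqP e.
have c2 : 2 \in [pchar L] by rewrite pchar_lalg pchar_Fp.
have : z ^+ k = 1.
  by apply/eqP; rewrite -subr_eq0 (oppr_pchar2 c2) addrC e.
move=> /eqP; rewrite -(prim_order_dvd zprim) => /dvdn_leq.
by rewrite lt0n k0 leqNgt ltn_ord => /(_ isT).
Qed.

(** The classes prime to [d] share one value and the others give 0; if that value were 0 too,
    [X^d - 1] would divide [res_prod d]. *)
Lemma csum_res_prod_coprime d c : odd d -> (forall p, prime p -> ~~ (p * p %| d)%N) ->
  coprime c d -> csum d c (res_prod d) = 1.
Proof.
move=> od sq cd; have d0 : (0 < d)%N by case: d od {sq cd}.
rewrite -[c]muln1 csum_res_prod_unit //; apply: F2_neq0.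
apply: contra (res_prod_neq0_mod od) => /eqP n1.
apply/modp_eq0P/polyP => j; rewrite coef0.
have [jd|dj] := ltnP j d; last first.
  apply: nth_default; apply: leq_trans dj.
  by rewrite -ltnS -[d.+1](size_XmB1 'F_2 d0) ltn_modp -size_poly_eq0 size_XmB1.
have -> : (res_prod d %% ('X^d - 1))`_j = csum d j (res_prod d).
  by rewrite /csum modn_small.
have [jc|jc] := boolP (coprime j d); last exact: csum_res_prod_eq0.
by rewrite -[j]muln1 csum_res_prod_unit.
Qed.

(** Pair the exponents [2i + 1] and [4e - (2i + 1)]. Multiplying by [X^(2i+1)] turns the two
    factors, modulo [X^(4e) - 1], into the square of [1 + X^(2i+1)]; the product becomes
    [odd_prod e] at [X^2]. *)
Lemma csum_odd_prod_double e : odd e ->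
  csum (2 * (2 * e)) 1 (odd_prod (2 * e)) = csum (2 * e) (1 + e * e)./2 (odd_prod e).
Proof.
move=> oe; have e0 : (0 < e)%N by case: e oe.
have m0 : (0 < 2 * (2 * e))%N by rewrite !muln_gt0.
(* The shift [e * e] is the sum of the first [e] odd numbers. *)
rewrite -(csum_mulXn 1 (e * e) _ m0) -[RHS](@csum_comp _ _ _ 2) ?muln_gt0 //.
have -> : (2 * (1 + e * e)./2 = 1 + e * e)%N.
  by rewrite mul2n; have : odd (e * e) by [rewrite oddM oe]; lia.
apply: csum_eqmod.
have -> : 'X^(e * e) = \prod_(i < e) 'X^(i.*2.+1) :> P2.
  elim: (e) => [|n IHn]; first by rewrite big_ord0.
  by rewrite big_ord_recr /= -IHn -exprD; congr ('X^ _); rewrite mulSn mulnS; lia.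
have -> : odd_prod (2 * e) = odd_prod e * \prod_(i < e) (1 + 'X^(2 * (2 * e) - i.*2.+1)).
  rewrite /odd_prod mul2n -addnn big_split_ord /=; congr (_ * _).
  rewrite [RHS](reindex_inj rev_ord_inj) /=; apply: eq_bigr => i _.
  by congr (1 + 'X^ _); have := ltn_ord i; lia.
rewrite mulrCA -big_split /= /odd_prod rmorph_prod -big_split /=.
apply: dvdp_sub_prod => i _.
have hi : (i.*2.+1 <= 2 * (2 * e))%N by have := ltn_ord i; lia.
rewrite rmorphD rmorph1 rmorphXn /= comp_polyX -exprM mulrDr mulr1 -exprD subnKC //.
have -> : 1 + 'X^(2 * i.*2.+1) = (1 + 'X^(i.*2.+1)) * (1 + 'X^(i.*2.+1)) :> P2.
  by rewrite sqr_onePx ?(addrr_pchar2 pchar2_P2) // -exprD addnn mul2n.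
by rewrite -mulrBr addr_subD_cancel dvdp_mull.
Qed.

Lemma odd_count_box d : (0 < d)%N -> (forall p, prime p -> ~~ (p * p %| d)%N) ->
  odd (count (fun b => sumn b == 1 %[mod 2 * d]) (box d d)).
Proof.
move=> d0 sq.
suff : (count (fun b => sumn b == 1 %[mod 2 * d]) (box d d))%:R = 1 :> 'F_2.
  by rewrite natr_F2; case: odd.
transitivity (csum (2 * d) 1 (boxpoly 'F_2 d d)).
  rewrite /boxpoly csum_sum -sum1_count natr_sum big_mkcond /=.
  by apply: eq_bigr => b _; rewrite csumX ?muln_gt0 //; case: eqP.
(* A squarefree number is odd or twice an odd number. *)
rewrite boxpoly_F2; case od: (odd d).
  by rewrite csum_odd_prod // csum_res_prod_coprime // coprime1n.
have [e dE] : exists e, d = (2 * e)%N by exists d./2; lia.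
have oe : odd e.
  by apply/negPn/negP => /negbTE ne; have /negP := sq 2 isT; apply; rewrite dE; lia.
rewrite dE csum_odd_prod_double // csum_odd_prod // csum_res_prod_coprime //.
  move=> p pp; apply: contra (sq p pp) => h; rewrite dE; exact: dvdn_mull.
have : coprime (2 * (1 + e * e)./2) e.
  have -> : (2 * (1 + e * e)./2 = 1 + e * e)%N.
    by rewrite mul2n; have : odd (e * e) by [rewrite oddM oe]; lia.
  by rewrite addnC /coprime gcdnC gcdnMDl gcdn1.
by rewrite coprimeMl => /andP[].
Qed.
End Parity.

(** * Counting monomials *)

Section CountingMonomials.
Variable n : nat.

Definition ewt N (w : 'I_N -> nat) (f : {ffun 'I_N -> 'I_n.+1}) : nat :=
  \sum_i w i * f i.

(** The power series of [1 / (1 - X^w)], truncated so that for [w > 0] it is exact up to degree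
    [n]. *)
Definition geo (w : nat) : {poly rat} := \sum_(k < n.+1) 'X^(w * k).

Lemma prod_geo N (w : 'I_N -> nat) :
  \prod_i geo (w i) = \sum_(f : {ffun 'I_N -> 'I_n.+1}) 'X^(ewt w f).
Proof.
rewrite /geo bigA_distr_bigA /=; apply: eq_bigr => f _.
by rewrite /ewt expr_sum.
Qed.

Lemma coef_sumX (T : finType) (g : T -> nat) :
  (\sum_x 'X^(g x) : {poly rat})`_n = #|[set x | g x == n]|%:R.
Proof.
rewrite coef_sum -sum1dep_card natr_sum [RHS]big_mkcond /=.
by apply: eq_bigr => x _; rewrite coefXn eq_sym; case: eqP.
Qed.

Lemma geo_inv w : (0 < w)%N -> ('X^(n.+1) : {poly rat}) %| (1 - 'X^w) * geo w - 1.
Proof.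
move=> w0; have -> : (1 - 'X^w) * geo w = 1 - 'X^(w * n.+1).
  rewrite -opprB mulNr /geo.
  under eq_bigr do rewrite exprM.
  by rewrite -subrX1 opprB exprM.
by rewrite addrC addKr dvdpNr dvdp_exp2l // leq_pmull.
Qed.

Lemma dvdp_sub_prod1 (I : finType) (q : {poly rat}) (f : I -> {poly rat}) :
  (forall i, q %| f i - 1) -> q %| \prod_i f i - 1.
Proof.
move=> h; have := @dvdp_sub_prod _ q _ (index_enum I) xpredT f (fun=> 1).
by rewrite big1_eq; apply.
Qed.

Lemma truncated_gauss (A : comNzRingType) (a b g p q u v : A) :
  g * (p * p) = q ->
  a * q = 1 + u -> b * p = 1 + v ->
  a * g - b * b = b * b * u - a * g * ((1 + v) * (1 + v) - 1).
Proof. by move=> gE aE bE; have -> : u = a * q - 1 by [rewrite aE addrC addKr]; rewrite -bE -gE; ring. Qed.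

(** Equality of Hilbert series up to degree [n]: the product of [1 / (1 - X^i)] over [i <= 2d],
    times the Gaussian binomial, is the square of the product over [i <= d]. This is the monomial
    count behind freeness. *)
Lemma card_exponents d :
  #|[set x : {ffun 'I_(d + d) -> 'I_n.+1} * 'I_(size (box d d)) |
      ewt (fun i => i.+1) x.1 + sumn (nth [::] (box d d) x.2) == n]|
  = #|[set f : {ffun 'I_(d + d) -> 'I_n.+1} |
      ewt (fun i => match split i with inl j => j.+1 | inr j => j.+1 end) f == n]|.
Proof.
apply/eqP; rewrite -(eqr_nat rat) -!coef_sumX -prod_geo.
pose b := \prod_(i < d) geo i.+1.
have -> : \prod_(i < d + d) geo (match split i with inl j => j.+1 | inr j => j.+1 end) = b * b.
  rewrite big_split_ord /=; congr (_ * _); apply: eq_bigr => i _.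
    by rewrite (unsplitK (inl _ i)).
  by rewrite (unsplitK (inr _ i)).
have -> : \sum_(x : {ffun 'I_(d + d) -> 'I_n.+1} * 'I_(size (box d d)))
     'X^(ewt (fun i => i.+1) x.1 + sumn (nth [::] (box d d) x.2))
   = (\prod_(i < d + d) geo i.+1) * boxpoly rat d d.
  rewrite prod_geo /boxpoly (big_nth [::]) big_mkord big_distrlr /= pair_bigA /=.
  by apply: eq_bigr => x _; rewrite exprD.
set a := \prod_(i < d + d) _.
have [u uE] : exists u, a * qpoch rat (d + d) = 1 + u * 'X^(n.+1).
  have : ('X^(n.+1) : {poly rat}) %| \prod_(i < d + d) ((1 - 'X^(i.+1)) * geo i.+1) - 1.
    by apply: dvdp_sub_prod1 => i; exact: geo_inv.
  by case/dvdpP => u e; exists u; rewrite -e addrC subrK big_split mulrC.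
have [v vE] : exists v, b * qpoch rat d = 1 + v * 'X^(n.+1).
  have : ('X^(n.+1) : {poly rat}) %| \prod_(i < d) ((1 - 'X^(i.+1)) * geo i.+1) - 1.
    by apply: dvdp_sub_prod1 => i; exact: geo_inv.
  by case/dvdpP => v e; exists v; rewrite -e addrC subrK big_split mulrC.
have gE := boxpolyE rat d d; rewrite -mulrA in gE.
rewrite -subr_eq0 -coefB (truncated_gauss gE uE vE).
have -> : (1 + v * 'X^(n.+1)) * (1 + v * 'X^(n.+1)) - 1 = (v + v + v * v * 'X^(n.+1)) * 'X^(n.+1).
  by ring.
by rewrite !mulrA -mulrBl coefMXn ltnSn.
Qed.
End CountingMonomials.

(** * Factorizations of a polynomial into two factors *)

Section FactorizationSpan.
Variables (F : fieldType) (S : comAlgType F) (u w : nat -> S).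
Implicit Types z : S.

Definition trunc (s : nat -> S) k j : S :=
  if j == 0%N then 1 else if (j <= k)%N then s j else 0.

(* Coefficient of [t^m] in
   [(1 + u_1 t + ... + u_k t^k) (1 + w_1 t + ... + w_l t^l)]. *)
Definition cprod k l m : S := \sum_(j < m.+1) trunc u k j * trunc w l (m - j)%N.

Definition bmon (b : seq nat) : S := \prod_(i <- b) u i.

(* Weight [n] homogeneous elements of the algebra generated by [u_1, ..., u_k] and
   [w_1, ..., w_l]; the next predicate is the cspan of [B] over the algebra generated
   by the [cprod k l m]. *)
Inductive hom k l : nat -> S -> Prop :=
| hom0 n : hom k l n 0
| hom1 : hom k l 0 1
| homD n z z' : hom k l n z -> hom k l n z' -> hom k l n (z + z')
| homZ n a z : hom k l n z -> hom k l n (a *: z)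
| homu i n z : (0 < i <= k)%N -> hom k l n z -> hom k l (i + n) (u i * z)
| homw i n z : (0 < i <= l)%N -> hom k l n z -> hom k l (i + n) (w i * z).

Inductive cspan (B : seq (seq nat)) k l : nat -> S -> Prop :=
| cspan0 n : cspan B k l n 0
| cspanD n z z' : cspan B k l n z -> cspan B k l n z' -> cspan B k l n (z + z')
| cspanZ n a z : cspan B k l n z -> cspan B k l n (a *: z)
| cspanb b : b \in B -> cspan B k l (sumn b) (bmon b)
| cspanE m n z : (0 < m <= k + l)%N -> cspan B k l n z ->
    cspan B k l (m + n) (cprod k l m * z).

Lemma hom_truncu k' k l j n z : (k' <= k)%N -> hom k l n z ->
  hom k l (j + n) (trunc u k' j * z).
Proof.
rewrite /trunc => hk; case: eqP => [->|/eqP j0] h; first by rewrite mul1r.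
case: ifP => jk; last by rewrite mul0r; exact: hom0.
by apply: homu => //; lia.
Qed.

Lemma hom_truncw l' k l j n z : (l' <= l)%N -> hom k l n z ->
  hom k l (j + n) (trunc w l' j * z).
Proof.
rewrite /trunc => hl; case: eqP => [->|/eqP j0] h; first by rewrite mul1r.
case: ifP => jk; last by rewrite mul0r; exact: hom0.
by apply: homw => //; lia.
Qed.

Lemma hom_cprod k' l' k l m n z : (k' <= k)%N -> (l' <= l)%N -> hom k l n z ->
  hom k l (m + n) (cprod k' l' m * z).
Proof.
move=> hk hl h; rewrite /cprod mulr_suml.
apply: (big_ind (hom k l (m + n))); [exact: hom0 | by move=> *; exact: homD |].
move=> [j hj] _ /=; have -> : (m + n = j + ((m - j) + n))%N by lia.
by rewrite -mulrA; apply: hom_truncu => //; apply: hom_truncw.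
Qed.

Lemma hom_le k l k' l' n z : (k <= k')%N -> (l <= l')%N -> hom k l n z -> hom k' l' n z.
Proof.
move=> hk hl; elim=> {n z} [n||n z z' _ h _ h'|n a z _ h|i n z hi _ h|i n z hi _ h].
- exact: hom0.
- exact: hom1.
- exact: homD.
- exact: homZ.
- by apply: homu => //; lia.
- by apply: homw => //; lia.
Qed.

Definition hom_sub k l n j z := if (j <= n)%N then hom k l (n - j) z else z = 0.

Lemma hom_sub0 k l n j : hom_sub k l n j 0.
Proof. by rewrite /hom_sub; case: ifP => // _; exact: hom0. Qed.

Lemma hom_subD k l n j z z' : hom_sub k l n j z -> hom_sub k l n j z' ->
  hom_sub k l n j (z + z').
Proof.
by rewrite /hom_sub; case: ifP => _; [exact: homD | move=> -> ->; rewrite addr0].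
Qed.

Lemma hom_subZ k l n j a z : hom_sub k l n j z -> hom_sub k l n j (a *: z).
Proof.
by rewrite /hom_sub; case: ifP => _; [exact: homZ | move=> ->; rewrite scaler0].
Qed.

Lemma hom_subM k l n j i x z :
  (forall n z, hom k l n z -> hom k l (i + n) (x * z)) ->
  hom_sub k l n j z -> hom_sub k l (i + n) j (x * z).
Proof.
move=> H; rewrite /hom_sub; case: leqP => hj; last first.
  move=> ->; rewrite mulr0; case: ifP => // _; exact: hom0.
by rewrite (leq_trans hj (leq_addl _ _)) -addnBA //; exact: H.
Qed.

Lemma hom_subI k l n j z : hom k l n z -> hom_sub k l (j + n) j z.
Proof. by rewrite /hom_sub leq_addr addKn. Qed.

Lemma hom_splitu k l n z : hom k.+1 l n z -> exists z0 z1,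
  [/\ z = z0 + u k.+1 * z1, hom k l n z0 & hom_sub k.+1 l n k.+1 z1].
Proof.
elim=> {n z} [n||n z z' _ [x [y [-> hx hy]]] _ [x' [y' [-> hx' hy']]]
  |n a z _ [x [y [-> hx hy]]]|i n z hi hz [x [y [-> hx hy]]]|i n z hi _ [x [y [-> hx hy]]]].
- by exists 0, 0; split; rewrite ?mulr0 ?addr0 //; [exact: hom0 | exact: hom_sub0].
- by exists 1, 0; split; rewrite ?mulr0 ?addr0 //; exact: hom1.
- exists (x + x'), (y + y'); split; first (by rewrite mulrDr addrACA); by [exact: homD | exact: hom_subD].
- exists (a *: x), (a *: y); split; first (by rewrite scalerDr scalerAr); by [exact: homZ | exact: hom_subZ].
- have [ik|ik] := leqP i k.
    exists (u i * x), (u i * y); split; first by rewrite mulrDr mulrCA.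
      by apply: homu => //; lia.
    by apply: hom_subM => // *; apply: homu => //; lia.
  have -> : i = k.+1 by lia.
  exists 0, (x + u k.+1 * y); split; [by rewrite add0r | exact: hom0 |].
  apply: hom_subI; apply: homD; first exact: hom_le hx.
  move: hy; rewrite /hom_sub; case: ifP => [kn hy | _ ->]; last by rewrite mulr0; exact: hom0.
  by rewrite -(subnKC kn); apply: homu => //; lia.
- exists (w i * x), (w i * y); split; first by rewrite mulrDr mulrCA.
    exact: homw.
  by apply: hom_subM => // *; apply: homw.
Qed.

Lemma hom_splitw k l n z : hom k l.+1 n z -> exists z0 z1,
  [/\ z = z0 + w l.+1 * z1, hom k l n z0 & hom_sub k l.+1 n l.+1 z1].
Proof.
elim=> {n z} [n||n z z' _ [x [y [-> hx hy]]] _ [x' [y' [-> hx' hy']]]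
  |n a z _ [x [y [-> hx hy]]]|i n z hi _ [x [y [-> hx hy]]]|i n z hi hz [x [y [-> hx hy]]]].
- by exists 0, 0; split; rewrite ?mulr0 ?addr0 //; [exact: hom0 | exact: hom_sub0].
- by exists 1, 0; split; rewrite ?mulr0 ?addr0 //; exact: hom1.
- exists (x + x'), (y + y'); split; first (by rewrite mulrDr addrACA); by [exact: homD | exact: hom_subD].
- exists (a *: x), (a *: y); split; first (by rewrite scalerDr scalerAr); by [exact: homZ | exact: hom_subZ].
- exists (u i * x), (u i * y); split; first by rewrite mulrDr mulrCA.
    exact: homu.
  by apply: hom_subM => // *; apply: homu.
- have [ik|ik] := leqP i l.
    exists (w i * x), (w i * y); split; first by rewrite mulrDr mulrCA.
      by apply: homw => //; lia.
    by apply: hom_subM => // *; apply: homw => //; lia.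
  have -> : i = l.+1 by lia.
  exists 0, (x + w l.+1 * y); split; [by rewrite add0r | exact: hom0 |].
  apply: hom_subI; apply: homD; first exact: hom_le hx.
  move: hy; rewrite /hom_sub; case: ifP => [kn hy | _ ->]; last by rewrite mulr0; exact: hom0.
  by rewrite -(subnKC kn); apply: homw => //; lia.
Qed.

Lemma truncS s k j : trunc s k.+1 j = trunc s k j + (if j == k.+1 then s k.+1 else 0).
Proof.
rewrite /trunc; case: (eqVneq j 0%N) => [->|j0]; first by rewrite /= addr0.
case: (eqVneq j k.+1) => [->|jk]; first by rewrite leqnn ltnn add0r.
by rewrite addr0 [(j <= k.+1)%N]leq_eqVlt (negbTE jk).
Qed.

Lemma cprodSu k l m : cprod k.+1 l m =
  cprod k l m + u k.+1 * (if (k < m)%N then trunc w l (m - k.+1)%N else 0).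
Proof.
rewrite /cprod; under eq_bigr do rewrite truncS mulrDl.
rewrite big_split /=; congr (_ + _); case: ifP => km; last first.
  rewrite mulr0 big1 // => j _; case: eqP => [jk|]; rewrite ?mul0r //.
  by have := ltn_ord j; rewrite jk ltnS km.
rewrite (bigD1 (Ordinal (km : k.+1 < m.+1)%N)) //= eqxx big1 ?addr0 // => j.
by rewrite -val_eqE /= => /negbTE ->; rewrite mul0r.
Qed.

Lemma cprodSw k l m : cprod k l.+1 m =
  cprod k l m + w l.+1 * (if (l < m)%N then trunc u k (m - l.+1)%N else 0).
Proof.
rewrite /cprod; under eq_bigr do rewrite truncS mulrDr.
rewrite big_split /=; congr (_ + _); case: ifP => km; last first.
  rewrite mulr0 big1 // => j _; case: eqP => [jk|]; rewrite ?mulr0 //.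
  by have := leq_subr j m; rewrite jk km.
have hj : (m - l.+1 < m.+1)%N by lia.
rewrite (bigD1 (Ordinal hj)) //= subKn // eqxx mulrC big1 ?addr0 // => j.
rewrite -val_eqE /= => jl; case: eqP => [e|]; rewrite ?mulr0 //.
by have := ltn_ord j; lia.
Qed.

Lemma cprod_top k l : (0 < k)%N -> (0 < l)%N -> cprod k l (k + l) = u k * w l.
Proof.
move=> k0 l0; have hk : (k < (k + l).+1)%N by lia.
rewrite /cprod (bigD1 (Ordinal hk)) //= addKn {1 2}/trunc !leqnn.
rewrite (gtn_eqF k0) (gtn_eqF l0) big1 ?addr0 // => j; rewrite -val_eqE /= => jk.
rewrite /trunc; have := ltn_ord j; case: (ltnP k j) => h1 h2.
  by rewrite (_ : (j == 0%N :> nat) = false) ?mul0r //; lia.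
rewrite (_ : (k + l - j == 0)%N = false) 1?(_ : (k + l - j <= l)%N = false) ?mulr0 //; lia.
Qed.

Definition inparts k (B : seq (seq nat)) := {in B, forall b, all (fun i => 0 < i <= k)%N b}.

Lemma hom_bmon k l B b : inparts k B -> b \in B -> hom k l (sumn b) (bmon b).
Proof.
move=> hB /hB; rewrite /bmon; elim: b => [|i b IHb] /=; first by move=> _; rewrite big_nil; exact: hom1.
by move=> /andP[hi hb]; rewrite big_cons; apply: homu => //; exact: IHb.
Qed.

Lemma cspan_hom B k l n z : inparts k B -> cspan B k l n z -> hom k l n z.
Proof.
move=> hB; elim=> {n z} [n|n z z' _ h _ h'|n a z _ h|b bB|m n z _ _ h].
- exact: hom0.
- exact: homD.
- exact: homZ.
- by apply: hom_bmon bB; exact: hB.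
- exact: hom_cprod.
Qed.

(** [cprod k l m] and [cprod k.+1 l m] agree modulo [u k.+1], so an expression in the former lifts
    to one in the latter up to a multiple of [u k.+1]. *)
Lemma cspan_splitu B k l n z : inparts k B -> cspan B k l n z -> exists z0 z1,
  [/\ z = z0 + u k.+1 * z1, cspan B k.+1 l n z0 & hom_sub k.+1 l n k.+1 z1].
Proof.
move=> hB; have hB' : inparts k.+1 B by move=> b /hB; apply: sub_all => i; lia.
elim=> {n z} [n|n z z' _ [x [y [-> hx hy]]] _ [x' [y' [-> hx' hy']]]
  |n a z _ [x [y [-> hx hy]]]|b bB|m n z hm hz [x [y [-> hx hy]]]].
- by exists 0, 0; split; rewrite ?mulr0 ?addr0 //; [exact: cspan0 | exact: hom_sub0].
- exists (x + x'), (y + y'); split; first (by rewrite mulrDr addrACA); by [exact: cspanD | exact: hom_subD].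
- exists (a *: x), (a *: y); split; first (by rewrite scalerDr scalerAr); by [exact: cspanZ | exact: hom_subZ].
- exists (bmon b), 0; split; rewrite ?mulr0 ?addr0 //; [exact: cspanb | exact: hom_sub0].
pose t := if (k < m)%N then trunc w l (m - k.+1)%N else 0.
exists (cprod k.+1 l m * x), (cprod k l m * y + (- (1)) *: (t * x)); split.
- by rewrite cprodSu -/t scaleN1r; ring.
- by apply: cspanE => //; lia.
apply: hom_subD; first by apply: hom_subM => // *; exact: hom_cprod.
apply: hom_subZ; rewrite /t; case: ltnP => km; last by rewrite mul0r; exact: hom_sub0.
rewrite /hom_sub (leq_trans km (leq_addr _ _)) -addnBAC //; apply: hom_truncw => //.
exact: cspan_hom hx.
Qed.

Lemma cspan_splitw B k l n z : inparts k B -> cspan B k l n z -> exists z0 z1,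
  [/\ z = z0 + w l.+1 * z1, cspan B k l.+1 n z0 & hom_sub k l.+1 n l.+1 z1].
Proof.
move=> hB.
elim=> {n z} [n|n z z' _ [x [y [-> hx hy]]] _ [x' [y' [-> hx' hy']]]
  |n a z _ [x [y [-> hx hy]]]|b bB|m n z hm hz [x [y [-> hx hy]]]].
- by exists 0, 0; split; rewrite ?mulr0 ?addr0 //; [exact: cspan0 | exact: hom_sub0].
- exists (x + x'), (y + y'); split; first (by rewrite mulrDr addrACA); by [exact: cspanD | exact: hom_subD].
- exists (a *: x), (a *: y); split; first (by rewrite scalerDr scalerAr); by [exact: cspanZ | exact: hom_subZ].
- exists (bmon b), 0; split; rewrite ?mulr0 ?addr0 //; [exact: cspanb | exact: hom_sub0].
pose t := if (l < m)%N then trunc u k (m - l.+1)%N else 0.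
exists (cprod k l.+1 m * x), (cprod k l m * y + (- (1)) *: (t * x)); split.
- by rewrite cprodSw -/t scaleN1r; ring.
- by apply: cspanE => //; lia.
apply: hom_subD; first by apply: hom_subM => // *; exact: hom_cprod.
apply: hom_subZ; rewrite /t; case: ltnP => km; last by rewrite mul0r; exact: hom_sub0.
rewrite /hom_sub (leq_trans km (leq_addr _ _)) -addnBAC //; apply: hom_truncu => //.
exact: cspan_hom hx.
Qed.

Lemma cspan_subset (B B' : seq (seq nat)) k l n z : {subset B <= B'} ->
  cspan B k l n z -> cspan B' k l n z.
Proof.
move=> sB; elim=> {n z} [n|n z z' _ h _ h'|n a z _ h|b bB|m n z hm _ h].
- exact: cspan0.
- exact: cspanD.
- exact: cspanZ.
- exact/cspanb/sB.
- exact: cspanE.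
Qed.

Lemma cspan_mulu (B B' : seq (seq nat)) k l i n z : {in B, forall b, i :: b \in B'} ->
  cspan B k l n z -> cspan B' k l (i + n) (u i * z).
Proof.
move=> sB; elim=> {n z} [n|n z z' _ h _ h'|n a z _ h|b bB|m n z hm _ h].
- by rewrite mulr0; exact: cspan0.
- by rewrite mulrDr; exact: cspanD.
- by rewrite -scalerAr; exact: cspanZ.
- by have := cspanb k l (sB _ bB); rewrite /bmon big_cons.
- by rewrite mulrCA addnCA; exact: cspanE.
Qed.

(* Graded Nakayama: modulo [u_k] one is in the case [(k-1, l)], modulo [w_l] in
   the case [(k, l-1)], and [u_k w_l] is the top coefficient of the product. *)
Lemma hom_span_box k l n z : hom k l n z -> cspan (box k l) k l n z.
Proof.
elim: k l n z => [|k IHk] l n z.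
  elim=> {n z} [n||n z z' _ h _ h'|n a z _ h|i n z|i n z hi _ h].
  - exact: cspan0.
  - by have := @cspanb [:: [::]] 0 l [::] isT; rewrite /bmon big_nil.
  - exact: cspanD.
  - exact: cspanZ.
  - by lia.
  suff <- : cprod 0 l i = w i by apply: cspanE.
  rewrite /cprod big_ord_recl big1 ?addr0 => [|j _].
    rewrite /trunc /= mul1r subn0 ifF ?(andP hi).2 //; lia.
  by rewrite /trunc /= mul0r.
elim: l n z => [|l IHl] n z.
  elim=> {n z} [n||n z z' _ h _ h'|n a z _ h|i n z hi _ h|i n z].
  - exact: cspan0.
  - by have := @cspanb [:: [::]] k.+1 0 [::] isT; rewrite /bmon big_nil.
  - exact: cspanD.
  - exact: cspanZ.
  - suff <- : cprod k.+1 0 i = u i by apply: cspanE; rewrite ?addn0.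
    rewrite /cprod big_ord_recr big1 => [|[j hj] _] /=.
      case/andP: hi => i0 ik. by rewrite add0r /trunc subnn eqxx mulr1 (gtn_eqF i0) ik.
    have e0 : (i - j == 0)%N = false by lia.
    by rewrite {2}/trunc e0 leqn0 e0 mulr0.
  - by lia.
(* Induction on the weight: the last remainder below is [u k.+1 * w l.+1] times an element of
   smaller weight. *)
have [m] := ubnP n; elim: m n z => // m IHm n z; rewrite ltnS => nm hz.
have [z0 [z1 [-> /IHk h0 hz1]]] := hom_splitu hz.
have bk : inparts k (box k l.+1) by move=> b /box_parts.
have bk' : inparts k.+1 (box k.+1 l) by move=> b /box_parts.
have [y0 [y1 [-> hy0 hy1]]] := cspan_splitu bk h0.
rewrite -addrA -mulrDr; apply: cspanD.
  by apply: cspan_subset hy0 => b hb; rewrite boxS mem_cat hb.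
have h2 := hom_subD hy1 hz1; move: (y1 + z1) h2 => z2 {z0 z1 y0 y1 h0 hy0 hz1 hy1 hz}.
rewrite /hom_sub; case: ifP => [kn hz2 | _ ->]; last by rewrite mulr0; exact: cspan0.
rewrite -(subnKC kn); move: (n - k.+1)%N (leq_subr k.+1 n) hz2 => n2 hn2 hz2.
have [z0 [z1 [-> /IHl h0 hz1]]] := hom_splitw hz2.
have [y0 [y3 [-> hy0 hy1]]] := cspan_splitw bk' h0.
rewrite -addrA -mulrDr [u _ * (_ + _)]mulrDr; apply: cspanD.
  by apply: cspan_mulu hy0 => b hb; rewrite boxS mem_cat map_f ?orbT.
have h3 := hom_subD hy1 hz1; move: (y3 + z1) h3 => z3 {z0 z1 y0 y3 h0 hy0 hz1 hy1 hz2}.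
rewrite /hom_sub; case: ifP => [ln hz3 | _ ->]; last by rewrite !mulr0; exact: cspan0.
rewrite mulrA -cprod_top // -{1}(subnKC ln) addnA; apply: cspanE; first lia.
by apply: IHm => //; lia.
Qed.
End FactorizationSpan.

(** * Weighted homogeneous polynomials and normal forms *)

Section WeightedHomogeneous.
Variables (F : fieldType) (nv : nat) (wv : 'I_nv -> nat).
Local Notation S := {mpoly F[nv]}.
Implicit Types (z : S) (m : 'X_{1..nv}).

Definition mwt m : nat := \sum_i wv i * m i.

Lemma mwt0 : mwt 0%MM = 0%N.
Proof. by rewrite /mwt big1 // => i _; rewrite mnm0E muln0. Qed.
Lemma mwtD m m' : mwt (m + m')%MM = (mwt m + mwt m')%N.
Proof. by rewrite /mwt -big_split /=; apply: eq_bigr => i _; rewrite mnmDE mulnDr. Qed.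
Lemma mwtU i : mwt U_(i)%MM = wv i.
Proof.
rewrite /mwt (bigD1 i) //= mnm1E eqxx muln1 big1 ?addn0 // => j ji.
by rewrite mnm1E eq_sym (negbTE ji) muln0.
Qed.

Definition whom n z := forall m, z@_m != 0 -> mwt m = n.

Lemma whom0 n : whom n 0. Proof. by move=> m; rewrite mcoeff0 eqxx. Qed.
Lemma whomD n z z' : whom n z -> whom n z' -> whom n (z + z').
Proof.
move=> h h' m; rewrite mcoeffD; have [e|/h //] := eqVneq z@_m 0.
by rewrite e add0r => /h'.
Qed.
Lemma whomZ n a z : whom n z -> whom n (a *: z).
Proof. by move=> h m; rewrite mcoeffZ mulf_eq0 negb_or => /andP[_ /h]. Qed.
Lemma whom_sum n I (r : seq I) (P : pred I) (f : I -> S) :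
  (forall i, P i -> whom n (f i)) -> whom n (\sum_(i <- r | P i) f i).
Proof. by move=> h; apply: (big_ind (whom n)); [exact: whom0 | exact: whomD | exact: h]. Qed.
Lemma whomM n n' z z' : whom n z -> whom n' z' -> whom (n + n') (z * z').
Proof.
move=> h h' m; rewrite mcoeffM => nz.
have [k /andP[/eqP mE]] : exists k : 'X_{1..nv < (mdeg m).+1, (mdeg m).+1},
    (m == (k.1 + k.2)%MM) && (z@_k.1 * z'@_k.2 != 0).
  apply/existsP; apply: contraNT nz => /existsPn nz; apply/eqP/big1 => k mE.
  by apply/eqP; have := nz k; rewrite mE /= negbK.
by rewrite mulf_eq0 negb_or => /andP[/h <- /h' <-]; rewrite -mwtD; exact: (congr1 mwt mE).
Qed.
Lemma whom1 : whom 0 1.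
Proof. by move=> m; rewrite mcoeff1; have [->|_] := eqVneq m 0%MM; rewrite ?mwt0 ?eqxx. Qed.
Lemma whomX m : whom (mwt m) 'X_[m].
Proof. by move=> m'; rewrite mcoeffX; have [->|_] := eqVneq m m'; rewrite ?eqxx. Qed.
Lemma whomXU i : whom (wv i) 'X_i.
Proof. by rewrite -{1}mwtU; exact: whomX. Qed.
Lemma whomXn n z k : whom n z -> whom (n * k) (z ^+ k).
Proof.
move=> h; elim: k => [|k IHk]; first by rewrite muln0; exact: whom1.
by rewrite mulnS exprS; exact: whomM.
Qed.

Lemma whom_ind (P : nat -> S -> Prop) :
  (forall n, P n 0) -> P 0%N 1 ->
  (forall n z z', P n z -> P n z' -> P n (z + z')) ->
  (forall n a z, P n z -> P n (a *: z)) ->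
  (forall i n z, P n z -> P (wv i + n)%N ('X_i * z)) ->
  forall n z, whom n z -> P n z.
Proof.
move=> P0 P1 PD PZ PX n z hz.
have PXm m : P (mwt m) 'X_[m].
  have [k] := ubnP (mdeg m); elim: k m => // k IHk m.
  have [/eqP|m0] := posnP (mdeg m); first by rewrite mdeg_eq0 => /eqP -> _; rewrite mwt0 mpolyX0.
  have [i mi] : exists i, (0 < m i)%N.
    apply/existsP; apply: contraTT m0 => /existsPn h.
    by rewrite mdegE big1 // => i _; apply/eqP; have := h i; rewrite lt0n negbK.
  have mE : m = (U_(i) + (m - U_(i)))%MM.
    by rewrite addmC submK //; apply/mnm_lepP => j; rewrite mnm1E; case: eqP => // <-.
  rewrite mE mdegD mdeg1 mwtD mwtU mpolyXD add1n ltnS => h.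
  by apply/PX/IHk.
rewrite [z]mpolyE big_seq; apply: (big_ind (P n)) => // [*|m]; first exact: PD.
by rewrite mcoeff_msupp => /hz <-; exact: PZ.
Qed.

(** A finite type of monomials, convenient for indexing matrices. When all weights are positive it
    contains every monomial of weight at most [n]. *)
Definition mnmf N n (f : {ffun 'I_N -> 'I_n.+1}) : 'X_{1..N} := [multinom (f i : nat) | i < N].

Lemma mnmf_inj N n : injective (@mnmf N n).
Proof.
move=> f g /mnmP e; apply/ffunP => i; apply/val_inj.
by have := e i; rewrite !mnmE.
Qed.
End WeightedHomogeneous.

Lemma mwt_mnmf n N (w : 'I_N -> nat) (f : {ffun 'I_N -> 'I_n.+1}) : mwt w (mnmf f) = ewt w f.
Proof. by rewrite /mwt /ewt; apply: eq_bigr => i _; rewrite mnmE. Qed.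

Lemma mnmf_surj n N (w : 'I_N -> nat) m : (forall i, 0 < w i)%N -> (mwt w m <= n)%N ->
  exists f : {ffun 'I_N -> 'I_n.+1}, m = mnmf f.
Proof.
move=> w0 hm; have hi i : (m i < n.+1)%N.
  rewrite ltnS; apply: leq_trans hm; rewrite /mwt (bigD1 i) //=.
  by apply: leq_trans (leq_addr _ _); rewrite leq_pmull.
exists [ffun i => Ordinal (hi i)]; apply/mnmP => i.
by rewrite mnmE ffunE.
Qed.

Lemma mpoly_mnmfE (F : fieldType) n N (w : 'I_N -> nat) (p : {mpoly F[N]}) : (forall i, 0 < w i)%N ->
  (forall m, p@_m != 0 -> (mwt w m <= n)%N) ->
  p = \sum_(f : {ffun 'I_N -> 'I_n.+1}) p@_(mnmf f) *: 'X_[mnmf f].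
Proof.
move=> w0 hp; apply/mpolyP => m; rewrite raddf_sum /=.
under eq_bigr do rewrite mcoeffZ mcoeffX.
have [e|/hp hm] := eqVneq p@_m 0.
  rewrite e big1 // => f _; case: eqP => [->|]; rewrite ?mulr0 // e mul0r //.
have [f ->] := mnmf_surj w0 hm.
rewrite (bigD1 f) //= eqxx mulr1 big1 ?addr0 // => g gf.
by rewrite (inj_eq (@mnmf_inj _ _)) (negbTE gf) mulr0.
Qed.

Section NormalForms.
Variables (F : fieldType) (nv np r : nat) (wv : 'I_nv -> nat) (wp : 'I_np -> nat).
Local Notation S := {mpoly F[nv]}.
Variables (B : 'I_r -> S) (bw : 'I_r -> nat) (theta : 'I_np -> F).
Hypothesis wp0 : forall i, (0 < wp i)%N.
Hypothesis whomB : forall j, whom wv (bw j) (B j).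

(* [NF Phi n z c]: the element [z] is a combination of the products
   [Phi^a * B_j] of weight [n], and [c_j] is the value at [theta] of the
   coefficient, a polynomial in [Phi], of [B_j]. *)
Inductive NF (Phi : 'I_np -> S) : nat -> S -> 'rV[F]_r -> Prop :=
| NF0 n : NF Phi n 0 0
| NFD n z z' c c' : NF Phi n z c -> NF Phi n z' c' -> NF Phi n (z + z') (c + c')
| NFZ n a z c : NF Phi n z c -> NF Phi n (a *: z) (a *: c)
| NFb j : NF Phi (bw j) (B j) (delta_mx 0 j)
| NFP i n z c : NF Phi n z c -> NF Phi (wp i + n) (Phi i * z) (theta i *: c).

Section FixedPhi.
Variable Phi : 'I_np -> S.
Hypothesis whomP : forall i, whom wv (wp i) (Phi i).
Local Notation NFp := (NF Phi).

Lemma NF_whom n z c : NFp n z c -> whom wv n z.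
Proof.
elim=> {n z c} [n|n z z' c c' _ h _ h'|n a z c _ h|j|i n z c _ h].
- exact: whom0.
- exact: whomD.
- exact: whomZ.
- exact: whomB.
- exact: whomM.
Qed.

Lemma NF_sum n I (s : seq I) (P : pred I) f g : (forall i, P i -> NFp n (f i) (g i)) ->
  NFp n (\sum_(i <- s | P i) f i) (\sum_(i <- s | P i) g i).
Proof.
by move=> h; apply: (big_ind2 (NFp n)); [exact: NF0 | move=> *; exact: NFD | exact: h].
Qed.

Lemma NF_rep n z c : NFp n z c -> exists p : 'I_r -> {mpoly F[np]},
  [/\ z = \sum_j mmap (@mpolyC nv F) Phi (p j) * B j, c = \row_j (p j).@[theta] &
      forall j m, (p j)@_m != 0 -> (mwt wp m + bw j = n)%N].
Proof.
elim=> {n z c} [n|n z z' c c' _ [p [-> -> hp]] _ [p' [-> -> hp']]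
  |n a z c _ [p [-> -> hp]]|j|i n z c _ [p [-> -> hp]]].
- exists (fun=> 0); split.
  + by rewrite big1 // => j _; rewrite mmap0 mul0r.
  + by apply/rowP => j; rewrite !mxE meval0.
  + by move=> j m; rewrite mcoeff0 eqxx.
- exists (fun j => p j + p' j); split.
  + by rewrite -big_split; apply: eq_bigr => j _; rewrite mmapD mulrDl.
  + by apply/rowP => j; rewrite !mxE mevalD.
  + move=> j m; rewrite mcoeffD; have [e|/hp //] := eqVneq (p j)@_m 0.
    by rewrite e add0r => /hp'.
- exists (fun j => a *: p j); split.
  + rewrite scaler_sumr; apply: eq_bigr => j _.
    by rewrite mmapZ -mulrA mul_mpolyC.
  + by apply/rowP => j; rewrite !mxE mevalZ.
  + by move=> j m; rewrite mcoeffZ mulf_eq0 negb_or => /andP[_ /hp].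
- exists (fun k => (j == k)%:R%:MP); split.
  + rewrite (bigD1 j) //= mmapC eqxx mul1r big1 ?addr0 // => k kj.
    by rewrite mmapC eq_sym (negbTE kj) /= mpolyC0 mul0r.
  + by apply/rowP => k; rewrite !mxE mevalC eqxx eq_sym.
  + move=> k m; rewrite mcoeffC; have [<-|_] := eqVneq j k; rewrite ?mul0r ?eqxx //.
    by rewrite mul1r; have [->|_] := eqVneq m 0%MM; rewrite ?mwt0 ?eqxx.
- exists (fun j => 'X_i * p j); split.
  + rewrite mulr_sumr; apply: eq_bigr => j _.
    by rewrite rmorphM /= mmapX mmap1U mulrA.
  + by apply/rowP => j; rewrite !mxE mevalM mevalXU.
  + move=> j m hm.
    have h1 : whom wp (wp i) ('X_i : {mpoly F[np]}) by exact: whomXU.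
    have [lt|le] := ltnP n (bw j).
      have e : p j = 0.
        by apply/mpolyP => m'; rewrite mcoeff0; apply/eqP; apply: contraTT lt => /hp <-; rewrite -leqNgt leq_addl.
      by move: hm; rewrite e mulr0 mcoeff0 eqxx.
    have h2 : whom wp (n - bw j)%N (p j) by move=> m' /hp <-; rewrite addnK.
    by rewrite (whomM h1 h2 hm) -addnA subnK.
Qed.

Definition Xset n := [set x : {ffun 'I_np -> 'I_n.+1} * 'I_r | (ewt wp x.1 + bw x.2 == n)%N].
Definition Yset n := [set f : {ffun 'I_nv -> 'I_n.+1} | ewt wv f == n].

Lemma NF_repX n z c : NFp n z c -> exists t : {ffun 'I_np -> 'I_n.+1} * 'I_r -> F,
  z = \sum_(x in Xset n) t x *: (mmap1 Phi (mnmf x.1) * B x.2) /\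
  ((forall x, x \in Xset n -> t x = 0) -> c = 0).
Proof.
move=> /NF_rep [p [-> -> hp]].
have hp' j m : (p j)@_m != 0 -> (mwt wp m <= n)%N by move=> /hp <-; rewrite leq_addr.
exists (fun x => (p x.2)@_(mnmf x.1)); split.
  pose g f j : S := if (f, j) \in Xset n then (p j)@_(mnmf f) *: (mmap1 Phi (mnmf f) * B j) else 0.
  transitivity (\sum_f \sum_j g f j); last first.
    by rewrite pair_bigA [RHS]big_mkcond; apply: eq_bigr => -[].
  rewrite exchange_big /=; apply: eq_bigr => j _.
  rewrite {1}(mpoly_mnmfE wp0 (hp' j)) raddf_sum /= mulr_suml; apply: eq_bigr => f _.
  rewrite /g mmapZ mmapX inE /= -mwt_mnmf; case: ifP => [_|hf]; first by rewrite -mulrA mul_mpolyC.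
  have [->|/hp e] := eqVneq (p j)@_(mnmf f) 0; first by rewrite mpolyC0 !mul0r.
  by rewrite e eqxx in hf.
move=> h; apply/rowP => j; rewrite !mxE (mpoly_mnmfE wp0 (hp' j)) raddf_sum big1 //= => f _.
have [->|nz] := eqVneq (p j)@_(mnmf f) 0; first by rewrite scale0r meval0.
by have := h (f, j); rewrite inE /= -mwt_mnmf (hp _ _ nz) eqxx => ->; rewrite ?scale0r ?meval0.
Qed.

(** The products of weight [n] span, and they are as many as the monomials of that weight. Their
    coefficient matrix is then square of full rank, so they are linearly independent. *)
Lemma NF_unique0 n c : #|Xset n| = #|Yset n| ->
  (forall z, whom wv n z -> exists c, NFp n z c) -> NFp n 0 c -> c = 0.
Proof.
move=> card_eq ex /NF_repX [t [tE ->]] // x xX.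
pose T := \matrix_(i < #|Xset n|, j < #|Yset n|)
  (mmap1 Phi (mnmf (enum_val i).1) * B (enum_val i).2)@_(mnmf (enum_val j)).
have rowT s (z : S) : z = \sum_(x in Xset n) s x *: (mmap1 Phi (mnmf x.1) * B x.2) ->
    (\row_i s (enum_val i)) *m T = \row_j z@_(mnmf (enum_val j)).
  move=> zE; apply/rowP => j; rewrite !mxE zE raddf_sum [RHS]big_enum_val /=.
  by apply: eq_bigr => i _; rewrite !mxE mcoeffZ.
have Tfull : row_full T.
  rewrite -sub1mx; apply/row_subP => j.
  have hj : whom wv n ('X_[mnmf (enum_val j)] : S).
    move=> m /whomX ->; rewrite mwt_mnmf.
    by have := enum_valP j; rewrite inE => /eqP.
  have [c' /NF_repX [s [/rowT sE _]]] := ex _ hj.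
  have -> : row j 1%:M = \row_j0 ('X_[mnmf (enum_val j)] : S)@_(mnmf (enum_val j0)).
    apply/rowP => k; rewrite !mxE mcoeffX (inj_eq (@mnmf_inj _ _)) (inj_eq enum_val_inj).
    by [].
  by rewrite -sE submxMl.
have Tfree : row_free T by rewrite /row_free (eqP Tfull) card_eq.
have := rowT t 0 tE; have -> : \row_j (0 : S)@_(mnmf (enum_val j)) = 0 *m T.
  by rewrite mul0mx; apply/rowP => j; rewrite !mxE mcoeff0.
move=> /(row_free_inj Tfree) /rowP /(_ (enum_rank_in xX x)).
by rewrite !mxE enum_rankK_in.
Qed.

Lemma NF_unique n z c c' : #|Xset n| = #|Yset n| ->
  (forall z, whom wv n z -> exists c, NFp n z c) -> NFp n z c -> NFp n z c' -> c = c'.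
Proof.
move=> ce ex h /(NFZ (-1)) /(NFD h); rewrite !scaleN1r subrr => /(NF_unique0 ce ex) /eqP.
by rewrite subr_eq0 => /eqP.
Qed.

(** Only generators of weight divisible by [N] have a nonzero value at [theta], so specialization
    preserves weights modulo [N]. *)
Lemma NF_class N n z c j : (forall i, theta i != 0 -> (N %| wp i)%N) ->
  NFp n z c -> c 0 j != 0 -> bw j = n %[mod N].
Proof.
move=> hN; elim=> {n z c} [n|n z z' c c' _ h _ h'|n a z c _ h|k|i n z c _ h].
- by rewrite mxE eqxx.
- by rewrite mxE; have [->|/h //] := eqVneq (c 0 j) 0; rewrite add0r => /h'.
- by rewrite mxE mulf_eq0 negb_or => /andP[_ /h].
- by rewrite mxE eqxx /=; have [->|_] := eqVneq j k; rewrite ?eqxx.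
- rewrite mxE mulf_eq0 negb_or => /andP[/hN /eqP hi /h ->].
  by rewrite -modnDml hi.
Qed.

(** Multiplication by [s] commutes with the [Phi i], so its matrix on the basis governs its action
    on all coordinates. *)
Lemma NF_mulmx n s (M : 'M[F]_r) n' z c :
  (forall j, NFp (n + bw j) (s * B j) (row j M)) ->
  NFp n' z c -> NFp (n + n') (s * z) (c *m M).
Proof.
move=> hM; elim=> {n' z c} [n'|n' z z' c c' _ h _ h'|n' a z c _ h|k|i n' z c _ h].
- by rewrite mulr0 mul0mx; exact: NF0.
- by rewrite mulrDr mulmxDl; exact: NFD.
- by rewrite -scalerAr -scalemxAl; exact: NFZ.
- by rewrite -rowE; exact: hM.
- by rewrite addnCA mulrCA -scalemxAl; exact: NFP.
Qed.

Lemma NF_lincomb (M : 'I_r -> 'M[F]_r) n s c k :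
  (forall j, NFp (bw j + bw k) (B j * B k) (row k (M j))) ->
  NFp n s c -> NFp (n + bw k) (s * B k) (row k (\sum_j c 0 j *: M j)).
Proof.
move=> hM; rewrite raddf_sum /=; under eq_bigr do rewrite linearZ /=.
elim=> {n s c} [n|n z z' c c' _ h _ h'|n a z c _ h|j|i n z c _ h].
- rewrite mul0r big1 => [|j _]; [exact: NF0 | by rewrite mxE scale0r].
- by rewrite mulrDl; under eq_bigr do rewrite mxE scalerDl; rewrite big_split; exact: NFD.
- rewrite -scalerAl; under eq_bigr do rewrite mxE -scalerA; rewrite -scaler_sumr; exact: NFZ.
- rewrite (bigD1 j) //= big1 ?addr0 => [|j' j'j]; rewrite mxE ?eqxx ?(negbTE j'j) ?scale0r //.
  by rewrite scale1r.
- rewrite -addnA -mulrA; under eq_bigr do rewrite mxE -scalerA; rewrite -scaler_sumr; exact: NFP.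
Qed.

(** Finitely many reductions suffice: the matrices of multiplication by the variables then handle
    every monomial. *)
Lemma NF_exists : (exists c, NFp 0 1 c) ->
  (forall i j, exists c, NFp (wv i + bw j) ('X_i * B j) c) ->
  forall n z, whom wv n z -> exists c, NFp n z c.
Proof.
move=> ex1 exB; apply: whom_ind => //.
- by move=> n; exists 0; exact: NF0.
- by move=> n z z' [c h] [c' h']; exists (c + c'); exact: NFD.
- by move=> n a z [c h]; exists (a *: c); exact: NFZ.
move=> i n z [c h].
have [M hM] : exists M : 'I_r -> 'rV_r, forall j, NFp (wv i + bw j) ('X_i * B j) (M j).
  exact: fin_all_exists (exB i).
exists (c *m \matrix_j M j); apply: NF_mulmx h => j; rewrite rowK; exact: hM.
Qed.
End FixedPhi.
End NormalForms.

(** * Real characters *)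

Section RealCharacter.
Variables (R : rcfType) (nv np r N : nat) (wv : 'I_nv -> nat) (wp : 'I_np -> nat).
Local Notation S := {mpoly R[nv]}.
Variables (B : 'I_r -> S) (bw : 'I_r -> nat) (theta : 'I_np -> R) (Phi : 'I_np -> S).
Hypothesis whomB : forall j, whom wv (bw j) (B j).
Hypothesis whomP : forall i, whom wv (wp i) (Phi i).
Hypothesis thetaN : forall i, theta i != 0 -> (N %| wp i)%N.
Local Notation NFp := (NF wp B bw theta Phi).
Hypothesis NFex : forall n z, whom wv n z -> exists c, NFp n z c.
Hypothesis NFun : forall n z c c', NFp n z c -> NFp n z c' -> c = c'.
Hypothesis odd1 : odd #|[set j | bw j == 1 %[mod N]]|.

(** The coordinates of class 1 modulo [N] form a real space of odd dimension, on which the elements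
    of class 0 act by commuting matrices. A common eigenvector provides the functional [L], and its
    eigenvalues provide [chi]. *)
Lemma eigen_functional : exists (L chi : nat -> S -> R), [/\
  forall n a z z', whom wv n z -> whom wv n z' -> L n (a *: z + z') = a * L n z + L n z',
  forall i n z, whom wv n z -> L (wp i + n)%N (Phi i * z) = theta i * L n z,
  (forall n n' s z, (N %| n)%N -> whom wv n s -> whom wv n' z ->
     L (n + n')%N (s * z) = chi n s * L n' z) &
  exists2 j, bw j = 1 %[mod N] & L (bw j) (B j) != 0].
Proof.
(* A total normal form function; its value is arbitrary on elements that are not homogeneous of the
   given weight. *)
have [nf nfP] : exists nf : nat -> S -> 'rV[R]_r, forall n z, whom wv n z -> NFp n z (nf n z).
  have /choice [g gP] : forall x : nat * S, exists c, whom wv x.1 x.2 -> NFp x.1 x.2 c.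
    move=> x; have [/NFex [c hc]|hx] := pselect (whom wv x.1 x.2); first by exists c.
    by exists 0.
  by exists (fun n z => g (n, z)) => n z; exact: gP (n, z).
have nfE n z c : NFp n z c -> nf n z = c.
  by move=> h; apply: NFun (h); apply/nfP/(NF_whom whomB whomP h).
pose M s n : 'M[R]_r := \matrix_j nf (n + bw j)%N (s * B j).
have MP s n j : whom wv n s -> NFp (n + bw j) (s * B j) (row j (M s n)).
  by move=> hs; rewrite rowK; apply/nfP/whomM.
have nfM n n' s z : whom wv n s -> whom wv n' z -> nf (n + n')%N (s * z) = nf n' z *m M s n.
  move=> hs hz; apply: nfE; apply: NF_mulmx (nfP _ _ hz) => j; exact: MP.
have MM n n' s s' : whom wv n s -> whom wv n' s' -> M s n *m M s' n' = M (s' * s) (n' + n)%N.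
  move=> hs hs'; apply/row_matrixP => j; rewrite row_mul !rowK -addnA -mulrA.
  by rewrite -nfM //; exact: whomM.
have Mlin n s : whom wv n s -> M s n = \sum_j nf n s 0 j *: M (B j) (bw j).
  move=> hs; apply/row_matrixP => k; rewrite rowK; apply: nfE.
  by apply: NF_lincomb (nfP _ _ hs) => j; exact: MP.
pose I1 := [set j | bw j == 1 %[mod N]].
(* [Q] selects the coordinates of class 1, and [Pr] below is the projection onto them. Matrices of
   class 0 preserve classes, hence commute with [Pr]. *)
pose Q : 'M[R]_(#|I1|, r) := \matrix_(i, k) (enum_val i == k)%:R.
have QQ : Q *m Q^T = 1%:M.
  apply/matrixP => i k; rewrite !mxE (bigD1 (enum_val i)) //= !mxE eqxx mul1r.
  rewrite big1 ?addr0 => [|l li]; first by rewrite (inj_eq enum_val_inj) eq_sym.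
  by rewrite !mxE eq_sym (negbTE li) mul0r.
pose Pr := Q^T *m Q.
have PrE k l : Pr k l = ((k == l) && (k \in I1))%:R.
  rewrite !mxE; have [kI|kI] := boolP (k \in I1).
    rewrite (bigD1 (enum_rank_in kI k)) //= !mxE enum_rankK_in // eqxx mul1r.
    rewrite andbT big1 ?addr0 // => i ik; rewrite !mxE; case: eqP => [e|]; last by rewrite mul0r.
    by case/eqP: ik; apply: enum_val_inj; rewrite enum_rankK_in.
  rewrite andbF big1 // => i _; rewrite !mxE; case: eqP => [e|]; last by rewrite mul0r.
  by rewrite -e enum_valP in kI.
have PrM j : (N %| bw j)%N -> Pr *m M (B j) (bw j) = M (B j) (bw j) *m Pr.
  move=> /eqP hj; apply/matrixP => k l; rewrite !mxE.
  rewrite (bigD1 k) //= PrE eqxx /= big1 ?addr0 => [|i ik]; last first.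
    by rewrite PrE eq_sym (negbTE ik) mul0r.
  rewrite [RHS](bigD1 l) //= PrE eqxx /= [X in _ = _ + X]big1 ?addr0 => [|i il]; last first.
    by rewrite PrE (negbTE il) mulr0.
  have [->|nz] := eqVneq (M (B j) (bw j) k l) 0; first by rewrite mulr0 mul0r.
  rewrite mulrC; congr (_ * (nat_of_bool _)%:R).
  have := NF_class thetaN (MP _ _ k (@whomB j)); move=> /(_ l); rewrite mxE => /(_ nz) e.
  by rewrite !inE e -modnDml hj add0n.
pose A j := Q *m M (B j) (bw j) *m Q^T.
have AA j k : (N %| bw j)%N -> (N %| bw k)%N -> A j *m A k = A k *m A j.
  move=> hj hk.
  have H a b : (N %| bw a)%N -> A a *m A b = Q *m (M (B a) (bw a) *m M (B b) (bw b)) *m Q^T.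
    move=> ha; rewrite /A !mulmxA -(mulmxA _ Q^T Q) -/Pr -(mulmxA Q _ Pr) -PrM // /Pr !mulmxA QQ.
    by rewrite mul1mx.
  by rewrite !H // !MM // mulrC addnC.
have [v v0 hv] : exists2 v : 'rV[R]_#|I1|, v != 0 &
    forall j, (N %| bw j)%N -> exists a, (v <= eigenspace (A j)^T a)%MS.
  pose sf := 1%:M :: [seq (A j)^T | j <- enum 'I_r & (N %| bw j)%N].
  have sfP f : f \in sf -> f = 1%:M \/ exists2 j, (N %| bw j)%N & f = (A j)^T.
    rewrite inE => /orP[/eqP|/mapP[j]]; first by left.
    by rewrite mem_filter => /andP[hj _] ->; right; exists j.
  (* Commuting endomorphisms of an odd-dimensional space over a real closed field have a common
     eigenvector. *)
  have [|||v v0 hv] := @Lemma4 R _ #|I1| 1%:M _ sf erefl.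
  - by rewrite mxrank1 dvdn2 negbK.
  - by move=> f _; rewrite submx1.
  - move=> f g /sfP [->|[j hj ->]] /sfP [->|[k hk ->]]; rewrite ?mul1mx ?mulmx1 //.
    by rewrite -!trmx_mul AA.
  exists v => // j hj; apply: hv; rewrite in_cons; apply/orP; right.
  by apply/mapP; exists j => //; rewrite mem_filter; apply/andP; split; rewrite ?mem_enum.
have /fin_all_exists [a aP] : forall j, exists a, (N %| bw j)%N ->
     M (B j) (bw j) *m (Q^T *m v^T) = a *: (Q^T *m v^T).
  move=> j; have [hj|_] := boolP (N %| bw j)%N; last by exists 0.
  have [a /eigenspaceP e] := hv j hj; exists a => _.
  have -> : Q^T *m v^T = Pr *m (Q^T *m v^T) by rewrite /Pr !mulmxA -(mulmxA _ Q) QQ mulmx1.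
  rewrite mulmxA -PrM // /Pr -!mulmxA (mulmxA Q) (mulmxA (Q *m _)) -/(A j).
  by rewrite -[A j]trmxK -trmx_mul e linearZ /= -scalemxAr (mulmxA Q) QQ mul1mx.
pose lam := Q^T *m v^T.
exists (fun n z => (nf n z *m lam) 0 0), (fun n s => \sum_j nf n s 0 j * a j); split.
- move=> n b z z' hz hz'; rewrite (nfE _ _ _ (NFD (NFZ b (nfP _ _ hz)) (nfP _ _ hz'))).
  by rewrite mulmxDl -scalemxAl !mxE.
- move=> i n z hz; rewrite (nfE _ _ _ (NFP i (nfP _ _ hz))).
  by rewrite -scalemxAl !mxE.
- move=> n n' s z hn hs hz; rewrite nfM // -mulmxA Mlin // mulmx_suml.
  have -> : \sum_j (nf n s 0 j *: M (B j) (bw j)) *m lam = (\sum_j nf n s 0 j * a j) *: lam.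
    rewrite scaler_suml; apply: eq_bigr => j _; rewrite -scalemxAl.
    have [->|nz] := eqVneq (nf n s 0 j) 0; first by rewrite mul0r !scale0r.
    rewrite aP ?scalerA //.
    by have := NF_class thetaN (nfP _ _ hs) nz; rewrite /dvdn => ->.
  by rewrite -scalemxAr mxE.
- have [i vi] : exists i, v 0 i != 0 by apply/rV0Pn.
  exists (enum_val i); first by have := enum_valP i; rewrite inE => /eqP.
  rewrite (nfE _ _ _ (NFb _ _ _ _ _ _)) -rowE mxE mxE (bigD1 i) //= !mxE eqxx mul1r.
  rewrite big1 ?addr0 // => k ki; rewrite !mxE.
  by rewrite (inj_eq enum_val_inj) (negbTE ki) mul0r.
Qed.
End RealCharacter.

(** * The point attached to a character *)

Section CharacterPoint.
Variables (R : fieldType) (nv N : nat) (wv : 'I_nv -> nat).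
Local Notation S := {mpoly R[nv]}.
Implicit Types (s z : S).
Variables (L chi : nat -> S -> R) (n0 : nat) (z0 : S).
Hypothesis N0 : (0 < N)%N.
Hypothesis Llin : forall n a z z', whom wv n z -> whom wv n z' ->
  L n (a *: z + z') = a * L n z + L n z'.
Hypothesis Lmul : forall n n' s z, (N %| n)%N -> whom wv n s -> whom wv n' z ->
     L (n + n')%N (s * z) = chi n s * L n' z.
Hypotheses (hz0 : whom wv n0 z0) (L0 : L n0 z0 != 0).

Lemma chi_lin n a s s' : (N %| n)%N -> whom wv n s -> whom wv n s' ->
  chi n (a *: s + s') = a * chi n s + chi n s'.
Proof.
move=> hn hs hs'; apply: (mulIf L0); rewrite -Lmul //; last exact/whomD/hs'/whomZ.
by rewrite mulrDl -scalerAl Llin ?Lmul ?mulrDl ?mulrA //; exact: whomM.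
Qed.

Lemma chi1 : chi 0 1 = 1.
Proof. by apply: (mulIf L0); rewrite -Lmul ?dvdn0 // ?mul1r //; exact: whom1. Qed.

Lemma chiM n n' s s' : (N %| n)%N -> (N %| n')%N -> whom wv n s -> whom wv n' s' ->
  chi (n + n')%N (s * s') = chi n s * chi n' s'.
Proof.
move=> hn hn' hs hs'; apply: (mulIf L0); rewrite -Lmul ?dvdn_add //; last exact: whomM.
by rewrite -addnA -mulrA Lmul ?Lmul ?mulrA //; exact: whomM.
Qed.

Lemma chiX n s k : (N %| n)%N -> whom wv n s -> chi (n * k)%N (s ^+ k) = chi n s ^+ k.
Proof.
move=> hn hs; elim: k => [|k IHk]; first by rewrite muln0 chi1.
by rewrite mulnS !exprS chiM ?IHk ?dvdn_mulr //; exact: whomXn.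
Qed.

Variables (M : S) (a : nat).
Hypotheses (hM : whom wv a M) (ha : a = 1 %[mod N]).

(** As [M] has class 1, the power [M ^+ (N.-1 * w)] brings a coordinate of weight [w] to class 0,
    where [chi] is multiplicative. *)
Definition chi_point (i : 'I_nv) : R :=
  chi (wv i + a * (N.-1 * wv i))%N ('X_i * M ^+ (N.-1 * wv i)).

Lemma dvd_class q : (N %| q + a * (N.-1 * q))%N.
Proof.
rewrite /dvdn -modnDmr -modnMml ha modnMml modnDmr mul1n -mulSn prednK //.
by rewrite -/(dvdn N _) dvdn_mulr.
Qed.

(** All monomials of weight [q] receive the same power of [M], so the multiplicativity and linearity
    of [chi] carry over to evaluation at the point. *)
Lemma chi_pointE q Q : whom wv q Q ->
  Q.@[chi_point] = chi (q + a * (N.-1 * q))%N (Q * M ^+ (N.-1 * q)).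
Proof.
move=> hQ; have hMq k : whom wv (a * k) (M ^+ k) by exact: whomXn.
suff [] : whom wv q Q /\ Q.@[chi_point] = chi (q + a * (N.-1 * q))%N (Q * M ^+ (N.-1 * q)) by [].
have czero n : (N %| n)%N -> chi n 0 = 0.
  move=> hn; have := chi_lin (-1) hn (whom0 wv n) (whom0 wv n).
  by rewrite scaler0 addr0 mulN1r addNr.
elim/whom_ind: q Q / hQ.
- move=> n; split; first exact: whom0.
  by rewrite meval0 mul0r czero // dvd_class.
- by split; [exact: whom1 | rewrite !muln0 meval1 expr0 mulr1 chi1].
- move=> n z z' [h e] [h' e']; split; first exact: whomD.
  rewrite mevalD e e' mulrDl -[X in chi _ (X + _)]scale1r chi_lin ?mul1r ?dvd_class //; exact: whomM.
- move=> n b z [h e]; split; first exact: whomZ.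
  have E := chi_lin b (dvd_class n) (whomM h (hMq (N.-1 * n))%N) (@whom0 _ _ _ _).
  by rewrite addr0 czero ?dvd_class // addr0 in E; rewrite mevalZ e -scalerAl E.
move=> i n z [h e]; split; first by apply: whomM => //; exact: whomXU.
have hi : whom wv (wv i) ('X_i : S) by exact: whomXU.
rewrite mevalM mevalXU e /chi_point -chiM ?dvd_class //; [|exact: whomM|exact: whomM].
congr chi; first by rewrite !mulnDr addnACA.
by rewrite mulnDr exprD; ring.
Qed.

(** [chi] is multiplicative on class 0 only, where the single factors need not lie, but their [N]-th
    powers do. Nonvanishing thus passes from the product to [Q] and [M], and then to [Q] twisted by
    a power of [M]. *)
Lemma chi_point_neq0 q Q m T : whom wv q Q -> whom wv m T -> (N %| q + m + a)%N ->
  chi (q + m + a)%N (Q * T * M) != 0 -> Q.@[chi_point] != 0.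
Proof.
move=> hQ hT hn nz.
have hXN n s : whom wv n s -> whom wv (n * N) (s ^+ N) by exact: whomXn.
have : chi ((q + m + a) * N)%N ((Q * T * M) ^+ N) != 0.
  by rewrite chiX ?expf_neq0 //; apply: whomM => //; exact: whomM.
rewrite !exprMn !mulnDl !chiM ?dvdn_add ?dvdn_mull //; try exact: hXN; last first.
  by apply: whomM; exact: hXN.
rewrite !mulf_eq0 !negb_or => /andP[/andP[nQ _] nM].
suff : Q.@[chi_point] ^+ N != 0 by rewrite expf_eq0 N0.
rewrite (chi_pointE hQ) -chiX ?dvd_class //; last by apply: whomM => //; exact: whomXn.
set k := (N.-1 * q)%N.
have -> : ((q + a * k) * N = q * N + a * N * k)%N by rewrite mulnDl mulnAC.
have -> : (Q * M ^+ k) ^+ N = Q ^+ N * (M ^+ N) ^+ k by rewrite exprMn -!exprM mulnC.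
have dN n : (N %| n * N)%N by rewrite dvdn_mull.
have hMk : whom wv (a * N * k) ((M ^+ N) ^+ k) by apply/whomXn/hXN.
have E1 := chiM (dN q) (dvdn_mulr k (dN a)) (hXN _ _ hQ) hMk.
have E2 := chiX k (dN a) (hXN _ _ hM).
by rewrite E1 E2 mulf_neq0 // expf_neq0.
Qed.
End CharacterPoint.

(** * Genericity *)

Section PolynomialFamilies.
Variables (F : fieldType) (nc nv : nat) (c0 : 'I_nc -> F).
Local Notation S := {mpoly F[nv]}.
Local Notation par := ('I_nc -> F).

Definition polyfun (f : par -> F) := exists p : {mpoly F[nc]}, forall c, f c = p.@[c].
Definition polyfam (z : par -> S) := forall m, polyfun (fun c => (z c)@_m).

Lemma polyfun_cst a : polyfun (fun=> a).
Proof. by exists a%:MP => c; rewrite mevalC. Qed.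
Lemma polyfunD f g : polyfun f -> polyfun g -> polyfun (fun c => f c + g c).
Proof. by move=> [p hp] [q hq]; exists (p + q) => c; rewrite mevalD hp hq. Qed.
Lemma polyfunM f g : polyfun f -> polyfun g -> polyfun (fun c => f c * g c).
Proof. by move=> [p hp] [q hq]; exists (p * q) => c; rewrite mevalM hp hq. Qed.
Lemma polyfun_ext f g : f =1 g -> polyfun f -> polyfun g.
Proof. by move=> e [p hp]; exists p => c; rewrite -e. Qed.
Lemma polyfun_sum I (s : seq I) (P : pred I) (f : I -> par -> F) :
  (forall i, polyfun (f i)) -> polyfun (fun c => \sum_(i <- s | P i) f i c).
Proof.
move=> h; elim: s => [|i s IHs].
  by apply: polyfun_ext (polyfun_cst 0) => c; rewrite big_nil.
apply: (@polyfun_ext (fun c => (if P i then f i c else 0) + \sum_(i <- s | P i) f i c)).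
  by move=> c; rewrite big_cons; case: ifP => //; rewrite add0r.
by apply: polyfunD; last exact: IHs; case: (P i); [exact: h | exact: polyfun_cst].
Qed.
Lemma polyfun_prod I (s : seq I) (f : I -> par -> F) :
  (forall i, polyfun (f i)) -> polyfun (fun c => \prod_(i <- s) f i c).
Proof.
move=> h; elim: s => [|i s IHs].
  by apply: polyfun_ext (polyfun_cst 1) => c; rewrite big_nil.
apply: (@polyfun_ext (fun c => f i c * \prod_(i <- s) f i c)); last exact: polyfunM.
by move=> c; rewrite big_cons.
Qed.
Lemma polyfun_det k (W : par -> 'M[F]_k) :
  (forall i j, polyfun (fun c => W c i j)) -> polyfun (fun c => \det (W c)).
Proof.
move=> h; apply: polyfun_sum => s; apply: polyfunM; first exact: polyfun_cst.
by apply: polyfun_prod => i.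
Qed.

Lemma polyfam_cst z : polyfam (fun=> z).
Proof. by move=> m; exact: polyfun_cst. Qed.
Lemma polyfamD z z' : polyfam z -> polyfam z' -> polyfam (fun c => z c + z' c).
Proof.
by move=> h h' m; apply: polyfun_ext (polyfunD (h m) (h' m)) => c; rewrite mcoeffD.
Qed.
Lemma polyfamM z z' : polyfam z -> polyfam z' -> polyfam (fun c => z c * z' c).
Proof.
move=> h h' m.
apply: (@polyfun_ext (fun c => \sum_(k : 'X_{1..nv < (mdeg m).+1, (mdeg m).+1} | m == (k.1 + k.2)%MM)
      ((z c)@_k.1 * (z' c)@_k.2))); first by move=> c; rewrite mcoeffM.
by apply: polyfun_sum => k; apply: polyfunM.
Qed.
Lemma polyfamZ (f : par -> F) z : polyfun f -> polyfam z -> polyfam (fun c => f c *: z c).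
Proof.
move=> hf hz; have := polyfamM (z := fun c => (f c)%:MP) _ hz.
move=> h m; apply: (polyfun_ext _ (h _ m)) => [c|]; first by rewrite mul_mpolyC.
move=> m'; apply: (@polyfun_ext (fun c => f c * (m' == 0%MM)%:R)).
  by move=> c; rewrite mcoeffC.
by apply: polyfunM => //; exact: polyfun_cst.
Qed.
Lemma polyfam_sum I (s : seq I) (z : I -> par -> S) :
  (forall i, polyfam (z i)) -> polyfam (fun c => \sum_(i <- s) z i c).
Proof.
move=> h m; apply: (@polyfun_ext (fun c => \sum_(i <- s) (z i c)@_m)).
  by move=> c; rewrite raddf_sum.
by apply: polyfun_sum => i; exact: h.
Qed.

(** Validity on a basic Zariski open set containing [c0]: nonvanishing is tested at [c0] alone, and
    finite intersections stay nonempty. *)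
Definition generic (Q : par -> Prop) :=
  exists p : {mpoly F[nc]}, p.@[c0] != 0 /\ forall c, p.@[c] != 0 -> Q c.

Lemma genericI Q Q' : generic Q -> generic Q' -> generic (fun c => Q c /\ Q' c).
Proof.
move=> [p [p0 hp]] [q [q0 hq]]; exists (p * q); rewrite mevalM mulf_neq0 //; split=> // c.
by rewrite mevalM mulf_eq0 negb_or => /andP[/hp ? /hq ?].
Qed.
Lemma genericW (Q Q' : par -> Prop) : (forall c, Q c -> Q' c) -> generic Q -> generic Q'.
Proof. by move=> h [p [p0 hp]]; exists p; split=> // c /hp /h. Qed.
Lemma generic_forall_lt k (Q : nat -> par -> Prop) : (forall i, generic (Q i)) ->
  generic (fun c => forall i, (i < k)%N -> Q i c).
Proof.
move=> h; elim: k => [|k IHk].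
  by exists 1; rewrite meval1 oner_neq0; split.
apply: genericW (genericI (h k) IHk) => c [hk hi] i.
by rewrite ltnS leq_eqVlt => /orP[/eqP ->|/hi].
Qed.

Lemma generic_unitmx k (W : par -> 'M[F]_k) :
  (forall i j, polyfun (fun c => W c i j)) -> W c0 = 1%:M ->
  generic (fun c => W c \in unitmx).
Proof.
move=> /polyfun_det [p hp] W0; exists p; rewrite -hp W0 det1 oner_neq0; split=> // c.
by rewrite -hp unitmxE unitfE.
Qed.
End PolynomialFamilies.

Lemma mnmf_sum (F : fieldType) n N (w : 'I_N -> nat) (A : {set {ffun 'I_N -> 'I_n.+1}})
    (z : {mpoly F[N]}) : (forall i, 0 < w i)%N ->
  (forall m, z@_m != 0 -> (mwt w m <= n)%N) -> (forall f, z@_(mnmf f) != 0 -> f \in A) ->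
  z = \sum_(j < #|A|) z@_(mnmf (enum_val j)) *: 'X_[mnmf (enum_val j)].
Proof.
move=> w0 hz hA; rewrite {1}(mpoly_mnmfE w0 hz).
rewrite -(big_enum_val (fun f => z@_(mnmf f) *: 'X_[mnmf f])) [RHS]big_mkcond /=.
apply: eq_bigr => f _; case: ifP => // fA.
have [->|/hA] := eqVneq z@_(mnmf f) 0; first by rewrite scale0r.
by rewrite fA.
Qed.

Section GenericNormalForms.
Variables (F : fieldType) (nc nv np r N : nat) (c0 : 'I_nc -> F).
Variables (wv : 'I_nv -> nat) (wp : 'I_np -> nat).
Local Notation S := {mpoly F[nv]}.
Local Notation par := ('I_nc -> F).
Variables (B : 'I_r -> S) (bw : 'I_r -> nat) (theta : 'I_np -> F).
Variable (Phi : par -> 'I_np -> S).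
Hypothesis wv0 : forall i, (0 < wv i)%N.
Hypothesis whomB : forall j, whom wv (bw j) (B j).
Hypothesis whomP : forall c i, whom wv (wp i) (Phi c i).
Hypothesis polyP : forall i, polyfam (fun c => Phi c i).
Local Notation NFc c := (NF wp B bw theta (Phi c)).
Hypothesis NF0ex : forall n z, whom wv n z -> exists v, NFc c0 n z v.

(** The same expression is read with [Phi c] in place of [Phi c0]; its coordinates, being values at
    [theta], stay the same. *)
Lemma NF_family n z v : NFc c0 n z v -> exists zc : par -> S,
  [/\ polyfam zc, zc c0 = z & forall c, NFc c n (zc c) v].
Proof.
elim=> {n z v} [n|n z z' v v' _ [y [hy <- hc]] _ [y' [hy' <- hc']]
  |n a z v _ [y [hy <- hc]]|j|i n z v _ [y [hy <- hc]]].
- by exists (fun=> 0); split=> [||c]; [exact: polyfam_cst | by [] | exact: NF0].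
- exists (fun c => y c + y' c); split=> // [|c]; [exact: polyfamD | exact: NFD].
- exists (fun c => a *: y c); split=> // [|c]; last exact: NFZ.
  by apply: polyfamZ => //; exact: polyfun_cst.
- by exists (fun=> B j); split=> [||c]; [exact: polyfam_cst | by [] | exact: NFb].
- exists (fun c => Phi c i * y c); split=> // [|c]; [exact: polyfamM | exact: NFP].
Qed.

Lemma mono_whom n (f : {ffun 'I_nv -> 'I_n.+1}) : whom wv (ewt wv f) ('X_[mnmf f] : S).
Proof. by move=> m /whomX ->; rewrite mwt_mnmf. Qed.

(** The expressions of the monomials at [c0] deform with [c]. The matrix of the deformed elements in
    the monomial basis is the identity at [c0], so it is invertible for generic [c] and these
    elements still span. *)
Lemma generic_NFex_weight n :
  generic c0 (fun c => forall z, whom wv n z -> exists v, NFc c n z v).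
Proof.
have /fin_all_exists [v hv] : forall j : 'I_#|Yset wv n|, exists v,
    NFc c0 n 'X_[mnmf (enum_val j)] v.
  move=> j; apply: NF0ex => m /mono_whom ->.
  by have := enum_valP j; rewrite inE => /eqP.
have /fin_all_exists [y hy] := fun j => NF_family (hv j).
pose W c : 'M[F]_#|Yset wv n| := \matrix_(i, j) (y i c)@_(mnmf (enum_val j)).
have Wpoly i j : polyfun (fun c => W c i j).
  by have [h _ _] := hy i; apply: polyfun_ext (h (mnmf (enum_val j))) => c; rewrite mxE.
have W0 : W c0 = 1%:M.
  apply/matrixP => i j; rewrite !mxE; have [_ -> _] := hy i.
  by rewrite mcoeffX (inj_eq (@mnmf_inj _ _)) (inj_eq enum_val_inj).
apply: genericW (generic_unitmx Wpoly W0) => c Wu z hz.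
have supp (z' : S) : whom wv n z' ->
    z' = \sum_(j < #|Yset wv n|) z'@_(mnmf (enum_val j)) *: 'X_[mnmf (enum_val j)].
  move=> hz'; apply: (mnmf_sum wv0) => [m /hz' ->//|f /hz' e].
  by rewrite inE -mwt_mnmf e.
pose kap := (\row_j z@_(mnmf (enum_val j))) *m invmx (W c).
have -> : z = \sum_i kap 0 i *: y i c.
  rewrite {1}(supp z hz).
  have yE i : y i c = \sum_j W c i j *: 'X_[mnmf (enum_val j)].
    have [_ _ hc] := hy i; rewrite {1}(supp _ (NF_whom whomB (@whomP c) (hc c))).
    by apply: eq_bigr => j _; rewrite mxE.
  under [RHS]eq_bigr do rewrite yE scaler_sumr.
  rewrite exchange_big /=; apply: eq_bigr => j _.
  under eq_bigr do rewrite scalerA.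
  rewrite -scaler_suml; congr (_ *: _).
  have /rowP /(_ j) : kap *m W c = \row_j z@_(mnmf (enum_val j)) by rewrite mulmxKV.
  by rewrite [X in _ = X -> _]mxE mxE => <-.
exists (\sum_i kap 0 i *: v i); apply: NF_sum => i _; apply: NFZ.
by have [_ _ hc] := hy i; exact: hc.
Qed.

Hypothesis B1 : exists2 j, B j = 1 & bw j = 0%N.

(** By [NF_exists] it is enough to treat 1 and the products ['X_i * B j], whose weights are bounded;
    this leaves finitely many open conditions. *)
Lemma generic_NFex :
  generic c0 (fun c => forall n z, whom wv n z -> exists v, NFc c n z v).
Proof.
pose b := (\max_i wv i + \max_j bw j).+1.
apply: genericW (generic_forall_lt b generic_NFex_weight) => c h n z hz.
apply: NF_exists hz.
  have [j Bj bj] := B1; exists (delta_mx 0 j).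
  by have := NFb wp B bw theta (Phi c) j; rewrite Bj bj.
move=> i j; apply: h; last by apply: whomM => //; exact: whomXU.
by rewrite ltnS leq_add // (leq_bigmax_cond (F := wv), leq_bigmax_cond (F := bw)).
Qed.

Variables (K : nat) (V : 'I_K -> S) (vw : 'I_K -> nat) (vv : 'I_K -> 'rV[F]_r).
Hypothesis NFV : forall k, NFc c0 (vw k) (V k) (vv k).
Hypothesis vw1 : forall k, vw k = 1 %[mod N].
Hypothesis Vspan : forall n z v, n = 1 %[mod N] -> NFc c0 n z v ->
  exists kap : 'I_K -> F, v = \sum_k kap k *: vv k.

(** At [c0] the [V k] span the part of class 1. For other [c], each monomial of class 1 and bounded
    weight is deformed into an element killed by every such [L]; where these elements still span,
    [L] vanishes on the [B j] of class 1. *)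
Lemma generic_functional : generic c0 (fun c => forall L : nat -> S -> F,
  (forall n a z z', whom wv n z -> whom wv n z' -> L n (a *: z + z') = a * L n z + L n z') ->
  (forall i n z, whom wv n z -> L (wp i + n)%N (Phi c i * z) = theta i * L n z) ->
  (forall k, L (vw k) (V k) = 0) ->
  forall j, bw j = 1 %[mod N] -> L (bw j) (B j) = 0).
Proof.
pose n := (\max_k vw k + \max_j bw j)%N.
pose Y := [set f : {ffun 'I_nv -> 'I_n.+1} | (ewt wv f == 1 %[mod N]) && (ewt wv f <= n)%N].
have suppY c q z v : NFc c q z v -> q = 1 %[mod N] -> (q <= n)%N ->
    z = \sum_(j < #|Y|) z@_(mnmf (enum_val j)) *: 'X_[mnmf (enum_val j)].
  move=> /(NF_whom whomB (@whomP c)) hz q1 qn.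
  apply: (mnmf_sum wv0) => [m /hz ->//|f /hz e].
  by rewrite inE -mwt_mnmf e q1 eqxx.
have /fin_all_exists [v hv] : forall j : 'I_#|Y|, exists v,
    NFc c0 (ewt wv (enum_val j)) 'X_[mnmf (enum_val j)] v.
  by move=> j; apply: NF0ex; exact: mono_whom.
have Y1 (j : 'I_#|Y|) : ewt wv (enum_val j) = 1 %[mod N].
  by have := enum_valP j; rewrite inE => /andP[/eqP].
have Yn (j : 'I_#|Y|) : (ewt wv (enum_val j) <= n)%N.
  by have := enum_valP j; rewrite inE => /andP[].
have vwn k : (vw k <= n)%N by rewrite (leq_trans _ (leq_addr _ _)) // leq_bigmax_cond.
have bwn k : (bw k <= n)%N by rewrite (leq_trans _ (leq_addl _ _)) // leq_bigmax_cond.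
have /fin_all_exists [kap hkap] := fun j => Vspan (Y1 j) (hv j).
have /fin_all_exists [y hy] := fun j => NF_family (hv j).
have /fin_all_exists [x hx] := fun k => NF_family (NFV k).
(* At [c0] this is the [i]-th monomial. For any [c], [y i c] and the combination of the [x k c] have
   the same coordinates, so under [L] only the values at the [V k] remain. *)
pose z (i : 'I_#|Y|) c : S := y i c + \sum_k kap i k *: (V k - x k c).
pose W c : 'M[F]_#|Y| := \matrix_(i, j) (z i c)@_(mnmf (enum_val j)).
have Wpoly i j : polyfun (fun c => W c i j).
  suff h : polyfam (z i) by apply: polyfun_ext (h (mnmf (enum_val j))) => c; rewrite mxE.
  apply: polyfamD; first by have [] := hy i.
  apply: polyfam_sum => k; apply: polyfamZ; first exact: polyfun_cst.
  apply: polyfamD; first exact: polyfam_cst.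
  move=> m; have [h _ _] := hx k; have := polyfamZ (polyfun_cst _ (-1)) h.
  by move=> /(_ m); apply: polyfun_ext => c; rewrite scaleN1r.
have W0 : W c0 = 1%:M.
  apply/matrixP => i j; rewrite !mxE /z; have [_ -> _] := hy i.
  rewrite big1 ?addr0 => [|k _]; last by have [_ -> _] := hx k; rewrite subrr scaler0.
  by rewrite mcoeffX (inj_eq (@mnmf_inj _ _)) (inj_eq enum_val_inj).
apply: genericW (generic_unitmx Wpoly W0) => c Wu L Llin LPhi LV j bj.
have L0 q : L q 0 = 0.
  have := Llin q (-1) 0 0 (@whom0 _ _ _ _) (@whom0 _ _ _ _).
  by rewrite scaler0 addr0 mulN1r addNr.
have LD q a b : whom wv q a -> whom wv q b -> L q (a + b) = L q a + L q b.
  by move=> ha hb; have := Llin q 1 a b ha hb; rewrite scale1r mul1r.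
have LZ q a b : whom wv q b -> L q (a *: b) = a * L q b.
  by move=> hb; have := Llin q a b 0 hb (@whom0 _ _ _ _); rewrite !addr0 L0 addr0.
have LNF q a u : NFc c q a u -> L q a = \sum_k u 0 k * L (bw k) (B k).
  elim=> {q a u} [q|q a a' u u' ha e ha' e'|q t a u ha e|k|i q a u ha e].
  - by rewrite L0 big1 // => k _; rewrite mxE mul0r.
  - rewrite LD ?e ?e' -?big_split; try exact: (NF_whom whomB (@whomP c) ha); try exact: (NF_whom whomB (@whomP c) ha').
    by apply: eq_bigr => k _; rewrite mxE mulrDl.
  - rewrite LZ ?e ?mulr_sumr; last exact: (NF_whom whomB (@whomP c) ha).
    by apply: eq_bigr => k _; rewrite mxE mulrA.
  - rewrite (bigD1 k) //= mxE !eqxx mul1r big1 ?addr0 // => l lk.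
    by rewrite mxE (negbTE lk) andbF mul0r.
  - rewrite LPhi ?e ?mulr_sumr; last exact: (NF_whom whomB (@whomP c) ha).
    by apply: eq_bigr => k _; rewrite mxE mulrA.
(* Since [z i c] mixes several weights of class 1, the functionals [L q] are glued into a single
   one, [Lt]. *)
pose lam : 'cV[F]_#|Y| := \col_j L (ewt wv (enum_val j)) 'X_[mnmf (enum_val j)].
pose Lt (a : S) := \sum_(j < #|Y|) a@_(mnmf (enum_val j)) * lam j 0.
have LtD a b : Lt (a + b) = Lt a + Lt b.
  by rewrite /Lt -big_split; apply: eq_bigr => i _; rewrite mcoeffD mulrDl.
have LtZ t a : Lt (t *: a) = t * Lt a.
  by rewrite /Lt mulr_sumr; apply: eq_bigr => i _; rewrite mcoeffZ mulrA.
have LtNF c' q a u : NFc c' q a u -> q = 1 %[mod N] -> (q <= n)%N -> Lt a = L q a.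
  move=> ha q1 qn; have hz := NF_whom whomB (@whomP c') ha.
  rewrite [in RHS](suppY _ _ _ _ ha q1 qn) /Lt.
  suff H (s : seq 'I_#|Y|) : whom wv q (\sum_(j <- s) a@_(mnmf (enum_val j)) *: 'X_[mnmf (enum_val j)])
     /\ \sum_(j <- s) a@_(mnmf (enum_val j)) * lam j 0 =
        L q (\sum_(j <- s) a@_(mnmf (enum_val j)) *: 'X_[mnmf (enum_val j)]) by case: (H (index_enum _)).
  elim: s => [|i s [IH1 IH2]]; first by rewrite !big_nil L0; split=> //; exact: whom0.
  rewrite !big_cons.
  have [->|nz] := eqVneq a@_(mnmf (enum_val i)) 0; first by rewrite !mul0r !scale0r !add0r.
  have hi : whom wv q ('X_[mnmf (enum_val i)] : S) by rewrite -(hz _ nz); exact: whomX.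
  split; first by apply: whomD => //; exact: whomZ.
  rewrite Llin // IH2 mxE; congr (_ * L _ _ + _).
  by rewrite -(hz _ nz) mwt_mnmf.
have LtB a q u : NFc c q a u -> q = 1 %[mod N] -> (q <= n)%N ->
    Lt a = \sum_k u 0 k * L (bw k) (B k).
  by move=> ha q1 qn; rewrite (LtNF _ _ _ _ ha q1 qn); exact: LNF ha.
have Wlam : W c *m lam = 0.
  apply/colP => i; rewrite !mxE.
  transitivity (Lt (z i c)); first by apply: eq_bigr => k _; rewrite [W c i k]mxE.
  rewrite /z LtD.
  have -> : Lt (\sum_k kap i k *: (V k - x k c)) = \sum_k kap i k * (Lt (V k) - Lt (x k c)).
    have Lt0 : Lt 0 = 0 by have := LtZ 0 0; rewrite scale0r mul0r.
    rewrite (big_morph Lt LtD Lt0); apply: eq_bigr => k _.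
    by rewrite LtZ -scaleN1r LtD LtZ mulN1r.
  have [_ _ hyc] := hy i; rewrite (LtB _ _ _ (hyc c) (Y1 i) (Yn i)) hkap.
  rewrite [X in _ + X](eq_bigr (fun k => - (kap i k * \sum_l vv k 0 l * L (bw l) (B l)))) => [|k _]; last first.
    have [_ _ hxc] := hx k.
    by rewrite (LtB _ _ _ (hxc c) (vw1 k) (vwn k)) (LtNF _ _ _ _ (NFV k) (vw1 k) (vwn k)) LV sub0r mulrN.
  rewrite sumrN; apply/eqP; rewrite subr_eq0; apply/eqP.
  under eq_bigr do rewrite summxE mulr_suml.
  rewrite exchange_big /=; apply: eq_bigr => k _; rewrite mulr_sumr.
  by apply: eq_bigr => l _; rewrite mxE mulrA.
have lam0 : lam = 0 by rewrite -[lam](mulKmx Wu) Wlam mulmx0.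
rewrite -(LtNF c _ _ _ (NFb _ _ _ _ _ j) bj (bwn j)) /Lt lam0.
by apply: big1 => i _; rewrite mxE mulr0.
Qed.
End GenericNormalForms.

(** * Difference quotients and generic injectivity *)

Section DifferenceQuotient.
Variable A : comNzRingType.
Implicit Types (x : {poly A}) (t s : A).

(** The quotient [(x(t) - x(s)) / (t - s)] as a polynomial in [s], written so that it makes sense on
    the diagonal and over any ring. *)
Definition dquot d x t : {poly A} :=
  \sum_(i < d.+1) x`_i *: \poly_(j < i) t ^+ (i.-1 - j).

Lemma dquotE d x t s : (size x <= d.+1)%N ->
  x.[t] - x.[s] = (t - s) * (dquot d x t).[s].
Proof.
move=> sx; rewrite !(horner_coef_wide _ sx) -sumrB /dquot horner_sum mulr_sumr.
apply: eq_bigr => i _; rewrite hornerZ horner_poly mulrCA -subrXX.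
by rewrite mulrBr.
Qed.

Lemma dquot_diag d x t : (size x <= d.+1)%N -> (dquot d x t).[t] = x^`().[t].
Proof.
move=> sx; have sx' : (size x^`() <= d)%N.
  apply/leq_sizeP => j dj; rewrite coef_deriv nth_default ?mul0rn //.
  exact: leq_trans sx _.
rewrite (horner_coef_wide _ sx') /dquot horner_sum big_ord_recl.
rewrite hornerZ horner_poly big_ord0 mulr0 add0r; apply: eq_bigr => i _.
rewrite hornerZ horner_poly coef_deriv /= /bump add1n.
rewrite (eq_bigr (fun=> t ^+ i)) => [|[j hj] _ /=]; last by rewrite -exprD subnK.
by rewrite sumr_const card_ord mulrnAr mulrnAl.
Qed.

Lemma size_dquot_le d x t : (size (dquot d x t) <= d)%N.
Proof.
apply: leq_trans (size_sum _ _ _) _; apply/bigmax_leqP => i _.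
apply: leq_trans (size_scale_leq _ _) _; apply: leq_trans (size_poly _ _) _.
by rewrite -ltnS.
Qed.

Lemma coef_dquot_last d x t : (0 < d)%N -> (dquot d x t)`_d.-1 = x`_d.
Proof.
case: d => // d _; rewrite /dquot coef_sum big_ord_recr big1 => [|[i hi] _] /=.
  by rewrite add0r coefZ coef_poly ltnSn subnn expr0 mulr1.
by rewrite coefZ coef_poly ltnNge -ltnS hi mulr0.
Qed.

Lemma lead_coef_dquot d x t : (0 < d)%N -> x`_d != 0 -> lead_coef (dquot d x t) = x`_d.
Proof.
move=> d0 xd; rewrite -(coef_dquot_last x t d0) lead_coefE; congr (_`_ _.-1).
apply/eqP; rewrite eqn_leq size_dquot_le /=.
rewrite leqNgt; apply/negP => h; move: xd; rewrite -(coef_dquot_last x t d0).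
by rewrite nth_default ?eqxx // -ltnS prednK.
Qed.
End DifferenceQuotient.

Lemma map_dquot (A A' : comNzRingType) (f : {rmorphism A -> A'}) d x t :
  map_poly f (dquot d x t) = dquot d (map_poly f x) (f t).
Proof.
rewrite /dquot rmorph_sum /=; apply: eq_bigr => i _.
rewrite map_polyZ coef_map; congr (_ *: _); apply/polyP => j.
by rewrite coef_map !coef_poly; case: ifP => _; rewrite /= ?rmorphXn ?rmorph0.
Qed.

(** The Sylvester matrix keeps its size as long as neither leading coefficient is killed. *)
Lemma rmorph_resultant (aR rR : comNzRingType) (f : {rmorphism aR -> rR}) p q :
    f (lead_coef p) != 0 -> f (lead_coef q) != 0 ->
  f (resultant p q)= resultant (map_poly f p) (map_poly f q).
Proof.
move=> nz_fp nz_fq; rewrite /resultant /Sylvester_mx !size_map_poly_id0 //.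
rewrite -det_map_mx /= map_col_mx; congr (\det (col_mx _ _));
  by apply: map_lin1_mx => v; rewrite map_poly_rV rmorphM /= map_rVpoly.
Qed.

(* Vanishes when another parameter has the same image as [t], or [t] is critical. *)
Definition curve_res (A : comNzRingType) d (x y : {poly A}) (t : A) : A :=
  resultant (dquot d x t) (dquot d y t).

Lemma rmorph_curve_res (A A' : comNzRingType) (f : {rmorphism A -> A'}) d (x y : {poly A}) t :
  (0 < d)%N -> f x`_d != 0 -> f y`_d != 0 ->
  f (curve_res d x y t) = curve_res d (map_poly f x) (map_poly f y) (f t).
Proof.
move=> d0 xd yd; have nz z : f z != 0 -> z != 0 by apply: contraNneq => ->; rewrite rmorph0.
by rewrite /curve_res rmorph_resultant ?lead_coef_dquot ?nz // !map_dquot.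
Qed.

Lemma curve_res_neq0P (C : closedFieldType) d (x y : {poly C}) t :
  (0 < d)%N -> x`_d != 0 ->
  curve_res d x y t != 0 <->
  forall s, ~ ((dquot d x t).[s] = 0 /\ (dquot d y t).[s] = 0).
Proof.
move=> d0 xd; rewrite /curve_res resultant_eq0 -leqNgt; split=> [g1 s [xs ys]|h].
  have rg : root (gcdp (dquot d x t) (dquot d y t)) s.
    by rewrite root_gcd /root xs ys eqxx.
  have [g0|g0] := eqVneq (gcdp (dquot d x t) (dquot d y t)) 0.
    move: g0 => /eqP; rewrite gcdp_eq0 => /andP[/eqP x0 _].
    by move: xd; rewrite -(coef_dquot_last x t d0) x0 coef0 eqxx.
  by have := root_size_gt1 g0 rg; rewrite ltnNge g1.
rewrite leqNgt; apply/negP => g1.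
have /closed_rootP [s] : size (gcdp (dquot d x t) (dquot d y t)) != 1 by rewrite gtn_eqF.
by rewrite root_gcd => /andP[/rootP xs /rootP ys]; apply: (h s).
Qed.

(** With an indeterminate as parameter the resultant becomes a polynomial [P], nonzero because of
    [t0]; its roots are the exceptional set. *)
Lemma curve_res_inj (C : closedFieldType) d (x y : {poly C}) t0 : (0 < d)%N ->
  size x = d.+1 -> size y = d.+1 -> curve_res d x y t0 != 0 ->
  exists s : seq C, forall t u, t \notin s -> x.[t] = x.[u] -> y.[t] = y.[u] -> t = u.
Proof.
move=> d0 sx sy nz.
have top (z : {poly C}) : size z = d.+1 -> z`_d != 0 :> C.
  by move=> sz; have := lead_coef_eq0 z; rewrite lead_coefE sz /= -size_poly_eq0 sz => ->.
pose P := curve_res d (map_poly polyC x) (map_poly polyC y) 'X.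
have PE t : P.[t] = curve_res d x y t.
  have h (z : {poly C}) : size z = d.+1 -> horner_eval t (map_poly polyC z)`_d != 0.
    by move=> sz; rewrite coef_map /horner_eval hornerC top.
  rewrite -[P.[t]]/(horner_eval t P) rmorph_curve_res ?h //.
  rewrite -!map_poly_comp /= /horner_eval hornerX; congr curve_res;
    by rewrite map_poly_id // => a _; rewrite /= hornerC.
have P0 : P != 0 by apply: contra_neq nz => P0; rewrite -PE P0 horner0.
have [rs PrE] := closed_field_poly_normal P.
exists rs => t u trs xtu ytu; apply/eqP; apply: contraNT trs => tu.
suff : root P t.
  by rewrite PrE rootZ ?lead_coef_eq0 // root_prod_XsubC.
rewrite /root PE; apply: contraT => /(curve_res_neq0P _ _ d0 (top _ sx)) /(_ u) []; split.
  have := dquotE t u (eq_leq sx); rewrite xtu subrr => /esym/eqP.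
  by rewrite mulf_eq0 subr_eq0 (negbTE tu) => /eqP.
have := dquotE t u (eq_leq sy); rewrite ytu subrr => /esym/eqP.
by rewrite mulf_eq0 subr_eq0 (negbTE tu) => /eqP.
Qed.

(** * The generic curve *)

Section CoefficientSums.
Variables (R : realType) (d : nat).

Definition cmon (i : 'I_(ncoef d)) : 'X_{1..2} := val (val (enum_val i)).

(** Replaces the support of [f] by the fixed index set of the coefficient space. Terms of degree
    above [2 * d] lie outside that set and are discarded by the hypothesis on [g]. *)
Lemma sum_coefvec (V : lmodType R) (f : {mpoly R[2]}) (g : 'X_{1..2} -> V) :
  f@_0 = 0 -> (forall m, (2 * d < mdeg m)%N -> g m = 0) ->
  \sum_(m <- msupp f) f@_m *: g m = \sum_j coefvec f j *: g (cmon j).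
Proof.
move=> f0 hg; pose P (m : 'X_{1..2}) := (0 < mdeg m < (2 * d).+1)%N.
rewrite (bigID P) /= [X in _ + X]big1 ?addr0 => [|m]; last first.
  rewrite /P negb_and -eqn0Ngt mdeg_eq0 -leqNgt => /orP[/eqP ->|/hg ->]; last by rewrite scaler0.
  by rewrite f0 scale0r.
rewrite (big_mksub_cond 'X_{1..2 < (2 * d).+1}); first last.
- by move=> m _ /andP[].
- exact: msupp_uniq.
transitivity (\sum_(x : 'X_{1..2 < (2 * d).+1} | (0 < mdeg x)%N) f@_x *: g x).
  rewrite big_mkcond [RHS]big_mkcond; apply: eq_bigr => x _ /=.
  rewrite /P bmdeg andbT; case: ifP => [/andP[-> //]|]; case: ifP => //= _.
  by rewrite mcoeff_msupp => /negbFE/eqP ->; rewrite scale0r.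
rewrite (reindex_omap (val : coef_index d -> _) insub) /=; last first.
  by move=> x hx; rewrite insubT.
rewrite (eq_bigl xpredT) => [|x]; last by rewrite valK eqxx andbT; exact: (valP x).
rewrite (reindex (fun i : 'I_(ncoef d) => enum_val i)) //=.
by apply: onW_bij; exact: enum_val_bij.
Qed.
End CoefficientSums.

Definition pmon (A : comNzRingType) (x y : {poly A}) (m : 'X_{1..2}) : {poly A} :=
  x ^+ m ord0 * y ^+ m (lift ord0 ord0).

Lemma comp_curveE (R : realType) (f : {mpoly R[2]}) x y :
  comp_curve f x y = \sum_(m <- msupp f) f@_m *: pmon x y m.
Proof.
rewrite /comp_curve /map_mpoly {1}/mmap raddf_sum /=; apply: eq_bigr => m _.
rewrite mmap1_id mevalM mevalC mevalX mul_polyC; congr (_ *: _).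
by rewrite big_ord_recl big_ord_recl big_ord0 mulr1.
Qed.

(** Both polynomials are divisible by [X]. Hence the coefficients of [f] of degree at most [2 * d]
    determine all the [Phi_i]. *)
Lemma coef_pmon_lt (A : comNzRingType) (x y : {poly A}) m i : x`_0 = 0 -> y`_0 = 0 ->
  (i < mdeg m)%N -> (pmon x y m)`_i = 0.
Proof.
move=> x0 y0 hi.
have fact (z : {poly A}) : z`_0 = 0 -> exists z', z = z' * 'X.
  by move=> z0; exists (\poly_(i < size z) z`_i.+1); apply/polyP => -[|j];
    rewrite coefMX //= coef_poly; case: ltnP => // h; rewrite nth_default // ltnW.
have [x' ->] := fact x x0; have [y' ->] := fact y y0.
rewrite /pmon !exprMn mulrACA -exprD coefMXn.
suff -> : (m ord0 + m (lift ord0 ord0) = mdeg m)%N by rewrite hi.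
by rewrite mdegE big_ord_recl big_ord_recl big_ord0 addn0.
Qed.

Lemma map_pmon (A A' : comNzRingType) (f : {rmorphism A -> A'}) x y m :
  map_poly f (pmon x y m) = pmon (map_poly f x) (map_poly f y) m.
Proof. by rewrite /pmon rmorphM !rmorphXn. Qed.

Section GenericCurve.
Variables (R : realType) (d : nat).
Local Notation S := {mpoly R[d + d]}.

Definition wgt (i : 'I_(d + d)) : nat := match split i with inl j => j.+1 | inr j => j.+1 end.
Lemma wgt_gt0 i : (0 < wgt i)%N. Proof. by rewrite /wgt; case: split. Qed.
Lemma wgt_l i : wgt (lshift d i) = i.+1. Proof. by rewrite /wgt (unsplitK (inl _ i)). Qed.
Lemma wgt_r i : wgt (rshift d i) = i.+1. Proof. by rewrite /wgt (unsplitK (inr _ i)). Qed.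

(** Indices start at 1, and those above [d] give 0; [uS 0] is a junk value, which [xS] replaces by
    0. *)
Definition uS (i : nat) : S :=
  if insub i.-1 is Some j then 'X_(lshift d j) else 0.
Definition wS (i : nat) : S :=
  if insub i.-1 is Some j then 'X_(rshift d j) else 0.

Lemma uSE (j : 'I_d) : uS j.+1 = 'X_(lshift d j). Proof. by rewrite /uS /= valK. Qed.
Lemma wSE (j : 'I_d) : wS j.+1 = 'X_(rshift d j). Proof. by rewrite /wS /= valK. Qed.

Lemma whom_uS i : (0 < i)%N -> whom wgt i (uS i).
Proof.
case: i => // i _; rewrite /uS /=; case: insubP => [j _ <-|_]; last exact: whom0.
by rewrite -wgt_l; exact: whomXU.
Qed.
Lemma whom_wS i : (0 < i)%N -> whom wgt i (wS i).
Proof.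
case: i => // i _; rewrite /wS /=; case: insubP => [j _ <-|_]; last exact: whom0.
by rewrite -wgt_r; exact: whomXU.
Qed.

Definition xS : {poly S} := \poly_(i < d.+1) (if i == 0%N then 0 else uS i).
Definition yS : {poly S} := \poly_(i < d.+1) (if i == 0%N then 0 else wS i).

Definition gpoly (p : {poly S}) := forall i, whom wgt i p`_i.

Lemma gpoly_xS : gpoly xS.
Proof.
move=> i; rewrite coef_poly; case: ifP => _; last exact: whom0.
by case: eqP => [_|/eqP i0]; [exact: whom0 | apply: whom_uS; rewrite lt0n].
Qed.
Lemma gpoly_yS : gpoly yS.
Proof.
move=> i; rewrite coef_poly; case: ifP => _; last exact: whom0.
by case: eqP => [_|/eqP i0]; [exact: whom0 | apply: whom_wS; rewrite lt0n].
Qed.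
Lemma gpolyM p q : gpoly p -> gpoly q -> gpoly (p * q).
Proof.
move=> hp hq i; rewrite coefM; apply: whom_sum => j _.
by rewrite -[X in whom _ X](subnKC (ltn_ord j : (j <= i)%N)); exact: whomM.
Qed.
Lemma gpolyX p k : gpoly p -> gpoly (p ^+ k).
Proof.
move=> hp; elim: k => [|k IHk]; last by rewrite exprS; exact: gpolyM.
by move=> i; rewrite expr0 coef1; case: eqP => [->|_]; [exact: whom1 | exact: whom0].
Qed.

Definition PhiS (c : 'I_(ncoef d) -> R) (i : 'I_(d + d)) : S :=
  \sum_j c j *: (pmon xS yS (cmon j))`_(i.+1).

Lemma whom_PhiS c (i : 'I_(d + d)) : whom wgt i.+1 (PhiS c i).
Proof.
apply: whom_sum => j _; apply: whomZ.
by apply: gpolyM; apply: gpolyX; [exact: gpoly_xS | exact: gpoly_yS].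
Qed.

Lemma polyfam_PhiS i : polyfam (fun c => PhiS c i).
Proof.
apply: polyfam_sum => j; apply: polyfamZ; last exact: polyfam_cst.
by exists 'X_j => c; rewrite mevalXU.
Qed.

Lemma xS0 : xS`_0 = 0. Proof. by rewrite coef_poly. Qed.
Lemma yS0 : yS`_0 = 0. Proof. by rewrite coef_poly. Qed.

Lemma coef_comp_curve (f : {mpoly R[2]}) (v : 'I_(d + d) -> R) (i : 'I_(d + d)) : f@_0 = 0 ->
  (comp_curve f (map_poly (meval v) xS) (map_poly (meval v) yS))`_(i.+1)
  = (PhiS (@coefvec R d f) i).@[v].
Proof.
move=> f0; rewrite comp_curveE coef_sum /PhiS raddf_sum /=.
have := @sum_coefvec R d R^o f (fun m => (pmon (map_poly (meval v) xS) (map_poly (meval v) yS) m)`_(i.+1)) f0.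
move=> H; transitivity (\sum_(m <- msupp f) f@_m *: ((pmon (map_poly (meval v) xS) (map_poly (meval v) yS) m)`_(i.+1) : R^o)).
  by apply: eq_bigr => m _; rewrite coefZ.
rewrite H => [|m hm].
  by apply: eq_bigr => j _; rewrite mevalZ -map_pmon coef_map.
apply: coef_pmon_lt; [by rewrite coef_map /= xS0 meval0 | by rewrite coef_map /= yS0 meval0 |].
by apply: leq_trans hm; case: (i) => j /= hj; lia.
Qed.

(** The hyperbola [(1 + x)(1 + y) - 1], whose coefficient vector is the base point for
    genericity. *)
Definition fbase : {mpoly R[2]} := 'X_ord0 + 'X_(lift ord0 ord0) + 'X_ord0 * 'X_(lift ord0 ord0).
Definition cbase := @coefvec R d fbase.

Lemma fbase0 : fbase@_0 = 0.
Proof.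
rewrite /fbase !mcoeffD -mpolyXD !mcoeffX.
have h (m : 'X_{1..2}) : (0 < mdeg m)%N -> (m == 0%MM) = false by rewrite -mdeg_eq0; lia.
by rewrite !h ?mdegD ?mdeg1 // !addr0.
Qed.

Lemma PhiS_base_coef (i : 'I_(d + d)) : PhiS cbase i = ((1 + xS) * (1 + yS))`_(i.+1).
Proof.
have H := @sum_coefvec R d S fbase (fun m => (pmon xS yS m)`_(i.+1)) fbase0.
rewrite /PhiS /cbase -H => [|m hm]; last first.
  apply: coef_pmon_lt; [exact: xS0 | exact: yS0 |].
  by apply: leq_trans hm; case: (i) => j /= hj; lia.
pose ev : {mpoly R[2]} -> S := fun f => \sum_(m <- msupp f) f@_m *: (pmon xS yS m)`_(i.+1).
pose M f := mmap (polyC \o @mpolyC (d + d) R) (fun j : 'I_2 => if val j == 0%N then xS else yS) f.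
have evE f : ev f = (M f)`_(i.+1).
  rewrite /ev /M /mmap coef_sum; apply: eq_bigr => m _ /=.
  rewrite coefCM -mul_mpolyC; congr (_ * _`_ _).
  by rewrite /mmap1 big_ord_recl big_ord_recl big_ord0 mulr1.
rewrite -/(ev fbase) evE /M /fbase !rmorphD rmorphM /= !mmapX !mmap1U /=.
have -> : (1 + xS) * (1 + yS) = 1 + (xS + yS + xS * yS) by ring.
by rewrite [RHS]coefD coef1 add0r.
Qed.

Lemma PhiS_base (i : 'I_(d + d)) : PhiS cbase i = cprod uS wS d d i.+1.
Proof.
have xE k : trunc uS d k = (1 + xS)`_k.
  by rewrite /trunc coefD coef1 coef_poly; case: eqP => [->|_] /=; rewrite ?addr0 ?add0r ?ltnS.
have yE k : trunc wS d k = (1 + yS)`_k.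
  by rewrite /trunc coefD coef1 coef_poly; case: eqP => [->|_] /=; rewrite ?addr0 ?add0r ?ltnS.
rewrite PhiS_base_coef coefM /cprod.
by apply: eq_bigr => j _; rewrite xE yE.
Qed.

Definition nB := size (box d d).
Definition BS (j : 'I_nB) : S := bmon uS (nth [::] (box d d) j).
Definition bwt (j : 'I_nB) : nat := sumn (nth [::] (box d d) j).
Definition wPhi (i : 'I_(d + d)) : nat := i.+1.
(* The coefficients of [1 - t^(2d)]. *)
Definition thS (i : 'I_(d + d)) : R := if i.+1 == (2 * d)%N then -1 else 0.

Lemma whom_BS j : whom wgt (bwt j) (BS j).
Proof.
rewrite /BS /bwt /bmon; have := box_parts (mem_nth [::] (ltn_ord j)).
elim: (nth _ _ _) => [|i b IHb] /=; first by rewrite big_nil => _; exact: whom1.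
move=> /andP[/andP[i0 _] hb]; rewrite big_cons; apply: whomM; first exact: whom_uS.
exact: IHb.
Qed.

Lemma whom_hom n z : whom wgt n z -> hom uS wS d d n z.
Proof.
apply: whom_ind => [?||???|???|i ? ?]; [exact: hom0 | exact: hom1 | exact: homD | exact: homZ |].
case: (splitP i) => [j ij|j ij].
  have -> : i = lshift d j by apply/val_inj.
  by rewrite wgt_l -uSE; apply: homu; rewrite /= ltn_ord.
have -> : i = rshift d j by apply/val_inj.
by rewrite wgt_r -wSE; apply: homw; rewrite /= ltn_ord.
Qed.

Lemma NF_base n z : whom wgt n z -> exists v, NF wPhi BS bwt thS (PhiS cbase) n z v.
Proof.
move=> /whom_hom /hom_span_box; elim=> {n z} [n|n z z' _ [v h] _ [v' h']|n a z _ [v h]|b bB|m n z hm _ [v h]].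
- by exists 0; exact: NF0.
- by exists (v + v'); exact: NFD.
- by exists (a *: v); exact: NFZ.
- have hj : (index b (box d d) < nB)%N by rewrite index_mem.
  exists (delta_mx 0 (Ordinal hj)).
  have := NFb wPhi BS bwt thS (PhiS cbase) (Ordinal hj).
  by rewrite /BS /bwt /= nth_index.
- have hi : (m.-1 < d + d)%N by lia.
  exists (thS (Ordinal hi) *: v).
  have := NFP (Ordinal hi) h; rewrite PhiS_base /wPhi /= prednK //; lia.
Qed.
End GenericCurve.

(** * Rescaling of the parameter and weighted components *)

Section Scaling.
Variables (F : fieldType) (A : comNzRingType) (phi : {rmorphism F -> A}).
Variables (nv : nat) (wv : 'I_nv -> nat).
Local Notation S := {mpoly F[nv]}.

(** On the coefficients of [x(t)] and [y(t)] this is the substitution of [c t] for [t]. *)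
Definition scalev (c : A) (v : 'I_nv -> A) i := c ^+ wv i * v i.

Lemma mmap_scalev c v n (z : S) : whom wv n z ->
  mmap phi (scalev c v) z = c ^+ n * mmap phi v z.
Proof.
move: n z; apply: whom_ind.
- by move=> n; rewrite !raddf0 mulr0.
- by rewrite !rmorph1 mulr1.
- by move=> n z z' e e'; rewrite !raddfD /= e e' mulrDr.
- by move=> n a z e; rewrite !mmapZ e mulrCA.
by move=> i n z e; rewrite !rmorphM /= e !mmapX !mmap1U /scalev exprD mulrACA.
Qed.

Definition wcomp q (z : S) : S := \sum_(m <- msupp z | mwt wv m == q) z@_m *: 'X_[m].

Lemma whom_wcomp q z : whom wv q (wcomp q z).
Proof. by apply: whom_sum => m /eqP <-; apply: whomZ; exact: whomX. Qed.

Lemma wcomp_sum (z : S) : exists Q, z = \sum_(q < Q) wcomp q z.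
Proof.
pose Q := (\max_(m <- msupp z) mwt wv m).+1.
exists Q; rewrite {1}[z]mpolyE /wcomp.
under [RHS]eq_bigr do rewrite big_mkcond.
rewrite exchange_big /=; apply: eq_big_seq => m mz.
have hm : (mwt wv m < Q)%N by rewrite ltnS leq_bigmax_seq.
rewrite (bigD1 (Ordinal hm)) //= eqxx big1 ?addr0 // => q.
by rewrite -val_eqE eq_sym /= => /negbTE ->.
Qed.
End Scaling.

Lemma exists_nonroot (A : numDomainType) (p : {poly A}) : p != 0 ->
  exists n : nat, (0 < n)%N && (p.[n%:R] != 0).
Proof.
move=> p0; pose rs := [seq (i.+1)%:R : A | i <- iota 0 (size p)].
have urs : uniq rs.
  by rewrite map_inj_uniq ?iota_uniq // => i j /eqP; rewrite eqr_nat => /eqP [].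
have : ~~ all (root p) rs.
  by apply/negP => h; have := max_poly_roots p0 h urs; rewrite size_map size_iota ltnn.
by move=> /allPn [_ /mapP[i _ ->] h]; exists i.+1.
Qed.

Lemma exists_prim_root (C : closedFieldType) n : (0 < n)%N -> n%:R != 0 :> C ->
  exists z : C, n.-primitive_root z.
Proof.
move=> n0 nC; have [rs] := closed_field_poly_normal ('X^n - 1 : {poly C}).
have lc : lead_coef ('X^n - 1 : {poly C}) = 1 by apply/eqP; exact: monicXnsubC.
rewrite lc scale1r => rsE.
have urs : uniq rs by rewrite -separable_prod_XsubC -rsE separable_Xn_sub_1.
have srs : size rs = n.
  by have := congr1 (size \o polyseq) rsE; rewrite /= size_prod_XsubC size_XnsubC // => -[].
have rrs : all n.-unity_root rs.
  by apply/allP => z zrs; rewrite /root_of_unity rsE root_prod_XsubC.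
by have /hasP [z _ hz] := has_prim_root n0 rrs urs (eq_leq (esym srs)); exists z.
Qed.

(** * Factorizations of 1 - t^2d over the complex numbers *)

Section RootSubsets.
Variables (C : fieldType) (N : nat) (om : C).
Hypothesis om_prim : N.-primitive_root om.
Implicit Types s t : {set 'I_N}.

Definition Upol s : {poly C} := \prod_(i in s) (1 - om ^+ i *: 'X).
Definition rotset s : {set 'I_N} := @ordS N @: s.

Lemma card_rot s : #|rotset s| = #|s|.
Proof. by rewrite card_imset //; exact: ordS_inj. Qed.

Lemma om_unit i : om ^+ i != 0.
Proof.
apply/expf_neq0/eqP => om0; have := prim_expr_order om_prim.
by rewrite om0 expr0n gtn_eqF ?(prim_order_gt0 om_prim) // => /eqP; rewrite eq_sym oner_eq0.
Qed.

Lemma coef_comp_scaleX (p : {poly C}) c k : (p \Po (c *: 'X))`_k = c ^+ k * p`_k.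
Proof.
rewrite comp_polyE coef_sum.
under eq_bigr do rewrite exprZn !coefZ coefXn.
have [kp|pk] := ltnP k (size p); last first.
  rewrite nth_default // mulr0 big1 // => i _; rewrite gtn_eqF ?mulr0 //.
  exact: leq_trans (ltn_ord i) pk.
rewrite (bigD1 (Ordinal kp)) //= eqxx mulr1 big1 ?addr0 1?mulrC // => i.
by rewrite -val_eqE /= eq_sym => /negbTE ->; rewrite !mulr0.
Qed.

Lemma Upol_rot s : Upol (rotset s) = Upol s \Po (om *: 'X).
Proof.
rewrite /Upol /rotset big_imset /=; last by move=> i j _ _; exact: ordS_inj.
rewrite rmorph_prod /=; apply: eq_bigr => i _.
by rewrite comp_polyB comp_polyZ comp_polyX (comp_polyC 1) scalerA (prim_expr_mod om_prim) exprSr.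
Qed.

Lemma coef_Upol_rot s k : (Upol (rotset s))`_k = om ^+ k * (Upol s)`_k.
Proof. by rewrite Upol_rot coef_comp_scaleX. Qed.

Lemma Upol_setC s : Upol s * Upol (~: s) = 1 - 'X^N.
Proof.
rewrite /Upol [X in _ * X](eq_bigl (fun i => i \notin s)); last by move=> i; rewrite inE.
rewrite -(bigID (fun i => i \in s) xpredT) /=.
have N0 := prim_order_gt0 om_prim.
have oV : N.-primitive_root om^-1.
  have -> : om^-1 = om ^+ N.-1.
    apply: (mulfI (om_unit 1)); rewrite expr1 divff; last by have := om_unit 1.
    by rewrite -exprS prednK // (prim_expr_order om_prim).
  by rewrite prim_root_exp_coprime ?coprimePn.
transitivity (\prod_(i < N) ((- om ^+ i)%:P * ('X - (om^-1 ^+ i)%:P))).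
  apply: eq_bigr => i _; rewrite mulrBr -polyCM exprVn mulNr divff ?om_unit // !polyCN.
  by rewrite opprK polyC1 mulNr mul_polyC addrC.
rewrite big_split /= -rmorph_prod -(big_mkord xpredT (fun i => 'X - (om^-1 ^+ i)%:P)) (factor_Xn_sub_1 oV).
have := factor_Xn_sub_1 om_prim; rewrite big_mkord => /(congr1 (horner^~ 0)).
rewrite horner_prod !hornerE expr0n gtn_eqF //= sub0r => E.
rewrite (eq_bigr (fun i : 'I_N => ('X - (om ^+ i)%:P).[0])) => [|i _]; last by rewrite !hornerE ?sub0r.
by rewrite E polyCN polyC1 mulN1r opprB.
Qed.

Lemma Upol0 s : (Upol s)`_0 = 1.
Proof.
rewrite -horner_coef0 /Upol horner_prod big1 // => i _.
by rewrite !hornerE ?mulr0 ?subr0.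
Qed.

Lemma size_Upol s : size (Upol s) = #|s|.+1.
Proof.
rewrite /Upol size_prod => [|i _]; last first.
  rewrite -size_poly_eq0 -scaleN1r scalerA addrC.
  by rewrite size_addl ?size_poly1 ?size_scale ?size_polyX // mulf_eq0 oppr_eq0 oner_eq0 om_unit.
rewrite (eq_bigr (fun=> 2)) => [|i _]; last first.
  rewrite -scaleN1r scalerA addrC.
  by rewrite size_addl ?size_poly1 ?size_scale ?size_polyX // mulf_eq0 oppr_eq0 oner_eq0 om_unit.
by rewrite sum_nat_const muln2 -addnn -addSn addnK.
Qed.

Lemma Upol_inj : injective Upol.
Proof.
have mem s (i : 'I_N) : (i \in s) = ((Upol s).[om^-1 ^+ i] == 0).
  rewrite /Upol horner_prod; apply/idP/idP => [is_|/prodf_eq0 [j js]].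
    by apply/prodf_eq0; exists i => //; rewrite !hornerE exprVn divff ?om_unit // subrr.
  rewrite !hornerE subr_eq0 exprVn eq_sym => /eqP e.
  have : om ^+ i = om ^+ j by rewrite -[om ^+ i]mul1r -e divfK ?om_unit.
  move/eqP; rewrite (eq_prim_root_expr om_prim) !modn_small // => /eqP ij.
  by rewrite (val_inj ij).
by move=> s t e; apply/setP => i; rewrite !mem e.
Qed.

Lemma iter_rot_order s : iter N rotset s = s.
Proof.
apply: Upol_inj; apply/polyP => k.
suff H n : (Upol (iter n rotset s))`_k = om ^+ (k * n) * (Upol s)`_k.
  by rewrite H mulnC exprM (prim_expr_order om_prim) expr1n mul1r.
elim: n => [|n IHn]; first by rewrite muln0 mul1r.
by rewrite iterS coef_Upol_rot IHn mulrA -exprD mulnS.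
Qed.

Lemma rot_inj : injective rotset.
Proof. exact: imset_inj (@ordS_inj _). Qed.
End RootSubsets.

(** * Complex points of the hyperbola system *)

Section Points.
Variables (R : realType) (d : nat) (om : R[i]).
Local Notation N := (2 * d)%N.
Hypothesis om_prim : N.-primitive_root om.
Local Notation C := R[i].
Local Notation S := {mpoly R[d + d]}.
Local Notation toC := (@real_complex R).
Local Notation U := (Upol om).
Implicit Types s t : {set 'I_N}.

(** The solution attached to [s]: the coefficients of two complementary factors of [1 - t^N]. *)
Definition ptv s (i : 'I_(d + d)) : C :=
  match split i with inl j => (U s)`_j.+1 | inr j => (U (~: s))`_j.+1 end.
Definition ev s : S -> C := mmap toC (ptv s).

Definition PT : {set {set 'I_N}} := [set s : {set 'I_N} | #|s| == d].

Lemma card_setC s : s \in PT -> #|~: s| = d.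
Proof. by rewrite inE => /eqP sd; rewrite cardsCs setCK card_ord sd mul2n -addnn addnK. Qed.

Lemma map_xS (v : 'I_(d + d) -> C) k :
  (map_poly (mmap toC v) (xS R d))`_k =
  if k is k'.+1 then (if insub k' is Some j then v (lshift d j) else 0) else 0.
Proof.
rewrite coef_map coef_poly /=; case: k => [|k] /=; first by rewrite raddf0.
rewrite ltnS; case: ltnP => kd; last by rewrite insubF ?raddf0 // ltnNge kd.
by rewrite /uS /= insubT /= mmapX mmap1U.
Qed.

Lemma map_yS (v : 'I_(d + d) -> C) k :
  (map_poly (mmap toC v) (yS R d))`_k =
  if k is k'.+1 then (if insub k' is Some j then v (rshift d j) else 0) else 0.
Proof.
rewrite coef_map coef_poly /=; case: k => [|k] /=; first by rewrite raddf0.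
rewrite ltnS; case: ltnP => kd; last by rewrite insubF ?raddf0 // ltnNge kd.
by rewrite /wS /= insubT /= mmapX mmap1U.
Qed.

Lemma ev_xS c s : s \in PT ->
  map_poly (mmap toC (scalev (@wgt d) c (ptv s))) (xS R d) = (U s \Po (c *: 'X)) - 1.
Proof.
rewrite inE => /eqP sd; apply/polyP => k; rewrite map_xS coefB coef1 coef_comp_scaleX.
case: k => [|k]; first by rewrite Upol0 mulr1 expr0 subrr.
rewrite subr0; case: insubP => [j _ <-|kd].
  by rewrite /scalev wgt_l /ptv (unsplitK (inl _ j)).
by rewrite nth_default ?mulr0 // size_Upol // sd ltnS leqNgt.
Qed.

Lemma ev_yS c s : s \in PT ->
  map_poly (mmap toC (scalev (@wgt d) c (ptv s))) (yS R d) = (U (~: s) \Po (c *: 'X)) - 1.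
Proof.
move=> /card_setC sd; apply/polyP => k; rewrite map_yS coefB coef1 coef_comp_scaleX.
case: k => [|k]; first by rewrite Upol0 mulr1 expr0 subrr.
rewrite subr0; case: insubP => [j _ <-|kd].
  by rewrite /scalev wgt_r /ptv (unsplitK (inr _ j)).
by rewrite nth_default ?mulr0 // size_Upol // sd ltnS leqNgt.
Qed.

Lemma scalev1 v : scalev (@wgt d) (1 : C) v =1 v.
Proof. by move=> i; rewrite /scalev expr1n mul1r. Qed.

Lemma mmap_eq (v v' : 'I_(d + d) -> C) (z : S) : v =1 v' -> mmap toC v z = mmap toC v' z.
Proof. by move=> e; apply: eq_bigr => m _; rewrite (mmap1_eq _ e). Qed.

(** Rotating the set amounts to substituting [om t] for the parameter. *)
Lemma ev_rot s n z : s \in PT -> whom (@wgt d) n z -> ev (rotset s) z = om ^+ n * ev s z.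
Proof.
move=> sP hz; rewrite /ev -(mmap_scalev _ _ _ hz); apply: mmap_eq => i.
rewrite /scalev /ptv /wgt.
have -> : ~: rotset s = rotset (~: s).
  by apply/setP => i0; rewrite -[i0]ord_predK !inE !(mem_imset _ _ (@ordS_inj _)) inE.
by case: split => j; rewrite coef_Upol_rot.
Qed.

Lemma rot_PT s : (rotset s \in PT) = (s \in PT).
Proof. by rewrite !inE card_rot. Qed.

Lemma ev_PhiS s i : s \in PT -> ev s (PhiS (@cbase R d) i) = toC (thS R i).
Proof.
move=> sP; rewrite PhiS_base_coef.
have -> : ev s ((1 + xS R d) * (1 + yS R d))`_i.+1 = (U s * U (~: s))`_i.+1.
  have e (z : S) : ev s z = mmap toC (scalev (@wgt d) 1 (ptv s)) z.
    by apply: mmap_eq => j; rewrite scalev1.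
  rewrite e -coef_map rmorphM !rmorphD rmorph1 /= ev_xS // ev_yS //.
  by rewrite scale1r !comp_polyXr ![1 + (_ - 1)]addrC !subrK.
rewrite Upol_setC // coefB coef1 coefXn sub0r /thS.
by case: eqP; rewrite ?rmorphN ?rmorph1 ?rmorph0 ?oppr0.
Qed.

Lemma ev_NF s n z v : s \in PT -> NF (@wPhi d) (@BS R d) (@bwt d) (@thS R d) (PhiS (@cbase R d)) n z v ->
  ev s z = \sum_j toC (v 0 j) * ev s (BS R j).
Proof.
move=> sP; elim=> {n z v} [n|n z z' v v' _ e _ e'|n a z v _ e|j|i n z v _ e].
- by rewrite /ev raddf0 big1 // => j _; rewrite mxE rmorph0 mul0r.
- rewrite /ev raddfD /= -!/(ev _ _) e e' -big_split; apply: eq_bigr => j _.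
  by rewrite mxE rmorphD mulrDl.
- rewrite /ev mmapZ -/(ev _ _) e mulr_sumr; apply: eq_bigr => j _.
  by rewrite mxE rmorphM mulrA.
- rewrite (bigD1 j) //= mxE !eqxx rmorph1 mul1r big1 ?addr0 // => k kj.
  by rewrite mxE (negbTE kj) rmorph0 mul0r.
- rewrite /ev rmorphM /= -!/(ev _ _) ev_PhiS // e mulr_sumr; apply: eq_bigr => j _.
  by rewrite mxE rmorphM mulrA.
Qed.
End Points.

(** * Rotation orbits and functions on the points *)

Section Orbits.
Variables (R : realType) (d : nat) (om : R[i]).
Hypothesis d0 : (0 < d)%N.
Local Notation N := (2 * d)%N.
Hypothesis om_prim : N.-primitive_root om.
Local Notation C := R[i].
Local Notation S := {mpoly R[d + d]}.
Local Notation toC := (@real_complex R).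
Local Notation ev := (@ev R d om).
Local Notation PT := (PT d).
Local Notation whomS := (whom (@wgt d)).
Implicit Types s t : {set 'I_N}.

Lemma ptv_inj s t : s \in PT -> t \in PT -> ptv om s =1 ptv om t -> s = t.
Proof.
move=> sP tP e; apply: (Upol_inj om_prim); apply/polyP => -[|k]; first by rewrite !Upol0.
have [kd|dk] := ltnP k d.
  by have := e (lshift d (Ordinal kd)); rewrite /ptv (unsplitK (inl _ _)).
move: sP tP; rewrite !inE => /eqP sd /eqP td.
by rewrite !nth_default // size_Upol // (sd, td).
Qed.

Definition Ev : 'M[C]_(nB d, #|PT|) := \matrix_(j, p) ev (enum_val p) (BS R j).

(** By interpolation every function on the points is a polynomial, and normal forms rewrite every
    monomial at these points as a combination of the [B_j]. *)
Lemma Ev_full : row_full Ev.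
Proof.
have evP (q : {mpoly C[d + d]}) : (\row_p q.@[ptv om (enum_val p)] <= Ev)%MS.
  have -> : \row_p q.@[ptv om (enum_val p)] =
      \sum_(m <- msupp q) q@_m *: \row_p ev (enum_val p) ('X_[m] : S) :> 'rV[C]_#|PT|.
    apply/rowP => p; rewrite !mxE summxE mevalE; apply: eq_bigr => m _.
    by rewrite !mxE /ev mmapX.
  apply: summx_sub => m _; apply: scalemx_sub.
  have [v hv] := NF_base (@whomX R _ (@wgt d) m).
  apply/submxP; exists (map_mx toC v); apply/rowP => p; rewrite !mxE.
  rewrite (ev_NF om_prim (enum_valP p) hv); apply: eq_bigr => j _.
  by rewrite !mxE.
rewrite -sub1mx; apply/row_subP => p.
pose sep (p' : 'I_#|PT|) : {mpoly C[d + d]} :=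
  if [pick i | ptv om (enum_val p) i != ptv om (enum_val p') i] is Some i then
    (ptv om (enum_val p) i - ptv om (enum_val p') i)^-1 *: ('X_i - (ptv om (enum_val p') i)%:MP)
  else 0.
have sepP p' : p' != p -> (sep p').@[ptv om (enum_val p)] = 1 /\ (sep p').@[ptv om (enum_val p')] = 0.
  move=> pp'; rewrite /sep; case: pickP => [i ne|e].
    by rewrite !mevalZ !mevalB !mevalXU !mevalC mulVf ?subr_eq0 // subrr mulr0.
  case/eqP: pp'; apply: enum_val_inj; apply: ptv_inj; rewrite ?enum_valP // => i.
  by have := e i => /negbFE/eqP.
suff -> : row p 1%:M = \row_p' (\prod_(p'' | p'' != p) sep p'').@[ptv om (enum_val p')] by exact: evP.
apply/rowP => p'; rewrite !mxE rmorph_prod /=; have [e|pp'] := eqVneq p p'.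
  by rewrite -e big1 // => i ip; have [-> _] := sepP i ip.
have p'p : p' != p by rewrite eq_sym.
by rewrite (bigD1 p') //=; have [_ ->] := sepP p' p'p; rewrite mul0r.
Qed.

Lemma card_PT : #|PT| = nB d.
Proof. by rewrite /PT card_draws card_ord /nB size_box addnn mul2n. Qed.

(** There are as many points as basis elements, so surjective evaluation is bijective. *)
Lemma Ev_free : row_free Ev.
Proof. by rewrite /row_free (eqP Ev_full) card_PT. Qed.

Lemma iter_rot_PT k s : (iter k (@rotset N) s \in PT) = (s \in PT).
Proof. by elim: k => //= k IHk; rewrite rot_PT. Qed.

Lemma ev_iter k s n z : s \in PT -> whomS n z ->
  ev (iter k (@rotset N) s) z = om ^+ (n * k) * ev s z.
Proof.
move=> sP hz; elim: k => [|k IHk]; first by rewrite muln0 mul1r.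
by rewrite iterS (ev_rot om_prim _ hz) ?iter_rot_PT // IHk mulrA -exprD mulnS.
Qed.

Lemma om_mod a b : a = b %[mod N] -> om ^+ a = om ^+ b.
Proof. by move=> e; rewrite -(prim_expr_mod om_prim a) e (prim_expr_mod om_prim). Qed.

Lemma sum_om a : \sum_(k < N) om ^+ (a * k) = if (N %| a)%N then N%:R else 0.
Proof.
under eq_bigr do rewrite exprM.
case: ifP => [|ne].
  rewrite (prim_order_dvd om_prim) => /eqP ->.
  by under eq_bigr do rewrite expr1n; rewrite sumr_const card_ord.
have h : om ^+ a - 1 != 0 by rewrite subr_eq0 -(prim_order_dvd om_prim) ne.
by apply: (mulfI h); rewrite -subrX1 -exprM mulnC exprM (prim_expr_order om_prim) expr1n subrr mulr0.
Qed.

Lemma N_neq0 : N%:R != 0 :> C.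
Proof. by rewrite pnatr_eq0 muln_eq0 /= -lt0n. Qed.

(** Averaging an expression of [h] over the rotations, with the character [om^(-m)], removes the
    basis elements whose weight is not [m] modulo [N]. *)
Lemma class_fun (h : {set 'I_N} -> C) m :
  (forall s, s \in PT -> h (rotset s) = om ^+ m * h s) ->
  exists c : 'I_(nB d) -> C, (forall j, c j != 0 -> bwt j = m %[mod N]) /\
    forall s, s \in PT -> h s = \sum_j c j * ev s (BS R j).
Proof.
move=> hh; have /submxP [c cE] := submx_full (\row_(p < #|PT|) h (enum_val p)) Ev_full.
have hE s : s \in PT -> h s = \sum_j c 0 j * ev s (BS R j).
  move=> sP; have /rowP /(_ (enum_rank_in sP s)) := cE.
  rewrite !mxE enum_rankK_in // => ->; apply: eq_bigr => j _.
  by rewrite !mxE enum_rankK_in.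
exists (fun j => if bwt j == m %[mod N] then c 0 j else 0); split.
  by move=> j; case: ifP => [/eqP //|_]; rewrite eqxx.
move=> s sP; apply: (mulfI N_neq0).
pose m' := ((N - m %% N))%N.
have mm' : (N %| m + m')%N.
  rewrite /dvdn -modnDml /m' subnKC ?modnn //.
  by rewrite ltnW // ltn_mod muln_gt0.
have -> : N%:R * h s = \sum_(k < N) om ^+ (m' * k) * h (iter k (@rotset N) s).
  have hk k : h (iter k (@rotset N) s) = om ^+ (m * k) * h s.
    elim: k => [|k IHk]; first by rewrite muln0 mul1r.
    by rewrite iterS hh ?iter_rot_PT // IHk mulrA -exprD mulnS.
  under eq_bigr do rewrite hk mulrA -exprD -mulnDl.
  by rewrite -mulr_suml sum_om addnC mm'.
under eq_bigr => k _ do rewrite hE ?iter_rot_PT // mulr_sumr.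
rewrite exchange_big mulr_sumr; apply: eq_bigr => j _.
rewrite (eq_bigr (fun k : 'I_N => c 0 j * ev s (BS R j) * om ^+ ((m' + bwt j) * k))) => [|k _]; last first.
  rewrite (ev_iter _ sP (@whom_BS R d j)) mulnDl exprD.
  move: (om ^+ _) (om ^+ _) (c 0 j) (ev s _) => x y z w; ring.
rewrite -mulr_sumr sum_om.
have -> : (N %| m' + bwt j)%N = (bwt j == m %[mod N]).
  by rewrite -(eqn_modDl m') [X in _ = (_ == X)](_ : _ = 0%N) //; apply/eqP; rewrite addnC.
by case: ifP => _; rewrite ?mulr0 ?mul0r ?mulr0 // mulrC mulrA.
Qed.

(** For [s0] with trivial stabilizer: the function supported on the orbit of [s0], with value
    [om^(m k)] at its [k]-th rotation. *)
Definition orbf s0 m s : C := \sum_(k < N) om ^+ (m * k) * (s == iter k (@rotset N) s0)%:R.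

Definition free_pt s := forall k, (0 < k < N)%N -> iter k (@rotset N) s != s.

Lemma iter_rot_mod k s : iter (k %% N) (@rotset N) s = iter k (@rotset N) s.
Proof.
rewrite {2}(divn_eq k N) addnC iterD; congr iter.
by elim: (k %/ N)%N => //= q IHq; rewrite [(q.+1 * _)%N]mulSn iterD -IHq (iter_rot_order om_prim).
Qed.

Lemma orbf_rot s0 m s : orbf s0 m (rotset s) = om ^+ m * orbf s0 m s.
Proof.
rewrite /orbf mulr_sumr (reindex_inj (@ordS_inj _)) /=; apply: eq_bigr => k _.
rewrite iter_rot_mod iterS (inj_eq (@rot_inj _)) mulrA -exprD -mulnS; congr (_ * _).
by apply: om_mod; rewrite modnMmr.
Qed.

Lemma iter_rot_inj k : injective (iter k (@rotset N)).
Proof. by elim: k => [//|k IHk] s t /= /(@rot_inj _) /IHk. Qed.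

Lemma orbf_in s0 m (k : 'I_N) : free_pt s0 -> orbf s0 m (iter k (@rotset N) s0) = om ^+ (m * k).
Proof.
move=> fr; rewrite /orbf (bigD1 k) //= eqxx mulr1 big1 ?addr0 // => l lk.
suff /negbTE -> : iter k (@rotset N) s0 != iter l (@rotset N) s0 by rewrite mulr0.
wlog lt : k l lk / (k < l)%N.
  move=> H; have := lk; rewrite neq_lt => /orP[h|h]; last exact: H.
  by rewrite eq_sym; apply: H; rewrite // eq_sym.
rewrite -(subnKC (ltnW lt)) iterD (inj_eq (@iter_rot_inj _)) eq_sym.
by apply: fr; rewrite subn_gt0 lt (leq_ltn_trans (leq_subr _ _) (ltn_ord l)).
Qed.

Lemma orbf_out s0 m s : (forall k : 'I_N, s != iter k (@rotset N) s0) -> orbf s0 m s = 0.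
Proof. by move=> h; rewrite /orbf big1 // => k _; rewrite (negbTE (h k)) mulr0. Qed.

Lemma orbf_case s0 s : (exists k : 'I_N, s = iter k (@rotset N) s0) \/
  (forall k : 'I_N, s != iter k (@rotset N) s0).
Proof.
have [/existsP [k /eqP e]|/existsPn h] := boolP [exists k : 'I_N, s == iter k (@rotset N) s0].
  by left; exists k.
by right.
Qed.

Lemma orbfM s0 m m' s : free_pt s0 -> orbf s0 m s * orbf s0 m' s = orbf s0 (m + m') s.
Proof.
move=> fr; have [[k ->]|h] := orbf_case s0 s; last by rewrite !orbf_out ?mul0r.
by rewrite !orbf_in // -exprD mulnDl.
Qed.

Lemma ev_orbf s0 m s q z : s0 \in PT -> free_pt s0 -> whomS q z ->
  ev s z * orbf s0 m s = ev s0 z * orbf s0 (q + m) s.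
Proof.
move=> sP fr hz; have [[k ->]|h] := orbf_case s0 s; last by rewrite !orbf_out ?mulr0.
by rewrite !orbf_in // (ev_iter _ sP hz) mulnDl exprD; ring.
Qed.

Lemma orbf_mod s0 m m' s : m = m' %[mod N] -> orbf s0 m s = orbf s0 m' s.
Proof.
move=> e; apply: eq_bigr => k _; congr (_ * _); apply: om_mod.
by rewrite -modnMml e modnMml.
Qed.

(** Up to the factor [N], an element of class 1 is, on the points, the sum of the [orbf s0 1]
    weighted by its values at [s0]. A point with nontrivial stabilizer contributes nothing: its
    value is unchanged when multiplied by some [om^k] other than 1, hence is 0. *)
Lemma sum_orbf (kap : {set 'I_N} -> C) n z : whomS n z -> n = 1 %[mod N] ->
  (forall s0, s0 \in PT -> free_pt s0 -> \sum_(s in PT) kap s * orbf s0 1 s = 0) ->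
  \sum_(s in PT) kap s * ev s z = 0.
Proof.
move=> hz n1 H; apply: (mulfI N_neq0); rewrite mulr0.
have om1 k : om ^+ (n * k) = om ^+ (1 * k) by apply: om_mod; rewrite -modnMml n1 modnMml.
transitivity (\sum_(s0 in PT) ev s0 z * \sum_(s in PT) kap s * orbf s0 1 s).
  under [RHS]eq_bigr do rewrite mulr_sumr.
  rewrite exchange_big mulr_sumr; apply: eq_bigr => s sP /=.
  have -> : \sum_(s0 in PT) ev s0 z * (kap s * orbf s0 1 s) =
      \sum_(k < N) \sum_(s0 in PT) kap s * (ev s0 z * (om ^+ (1 * k) * (s == iter k (@rotset N) s0)%:R)).
    rewrite exchange_big /=; apply: eq_bigr => s0 _.
    by rewrite /orbf !mulr_sumr; apply: eq_bigr => k _; rewrite mulrCA.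
  rewrite (eq_bigr (fun=> kap s * ev s z)) => [|k _]; first by rewrite sumr_const card_ord mulr_natl.
  have sE : s = iter k (@rotset N) (iter (N - k) (@rotset N) s).
    by rewrite -iterD subnKC ?(ltnW (ltn_ord k)) // (iter_rot_order om_prim).
  have s0P : iter (N - k) (@rotset N) s \in PT by rewrite iter_rot_PT.
  have evs : ev s z = om ^+ (1 * k) * ev (iter (N - k) (@rotset N) s) z.
    by rewrite {1}sE (ev_iter _ s0P hz) om1.
  rewrite (bigD1 _ s0P) /= -sE eqxx mulr1 big1 ?addr0 => [|s1 /andP[_ ne]].
    by rewrite evs [_ * om ^+ _]mulrC.
  have -> : (s == iter k (@rotset N) s1) = false.
    by rewrite {1}sE (inj_eq (@iter_rot_inj _)) eq_sym (negbTE ne).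
  by rewrite !mulr0.
apply: big1 => s0 sP.
have [fr|] := boolP [forall k : 'I_N, (0 < k)%N ==> (iter k (@rotset N) s0 != s0)].
  rewrite H ?mulr0 // => k /andP[k0 kN].
  by have /forallP /(_ (Ordinal kN)) /implyP := fr; apply.
move=> /forallPn [k]; rewrite negb_imply negbK => /andP[k0 /eqP e].
suff -> : ev s0 z = 0 by rewrite mul0r.
have := ev_iter k sP hz; rewrite e om1 mul1n => /eqP; rewrite -subr_eq0 -{1}[ev s0 z]mul1r -mulrBl.
rewrite mulf_eq0 subr_eq0 eq_sym -(prim_order_dvd om_prim) gtnNdvd //= => /eqP //.
Qed.
End Orbits.

Lemma mulr_sum3 (A : comNzRingType) n (k e : A) (f g h : 'I_n -> A) :
  k * (e * (\sum_a f a) * (\sum_b g b) * (\sum_c h c)) =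
  \sum_a \sum_b \sum_c k * (e * f a * g b * h c).
Proof.
rewrite [e * _]mulr_sumr 2!mulr_suml mulr_sumr; apply: eq_bigr => a _.
rewrite [e * f a * _]mulr_sumr mulr_suml mulr_sumr; apply: eq_bigr => b _.
by rewrite !mulr_sumr.
Qed.

(** * Generic injectivity and the span of the test elements *)

Section FreeResultant.
Variables (R : realType) (d : nat).
Hypothesis d0 : (0 < d)%N.
Local Notation N := (2 * d)%N.
Local Notation C := R[i].
Local Notation S := {mpoly R[d + d]}.
Local Notation toC := (@real_complex R).
Local Notation whomS := (whom (@wgt d)).
Local Notation NFS := (NF (@wPhi d) (@BS R d) (@bwt d) (@thS R d) (PhiS (@cbase R d))).

(** The resultant is tested at the parameter 1; rescaling moves any nonzero parameter there. *)
Definition rho : S := curve_res d (xS R d) (yS R d) 1.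

Lemma dlast_lt : (d.-1 < d)%N. Proof. by rewrite prednK. Qed.
Definition dlast : 'I_d := Ordinal dlast_lt.
Definition topx : S := 'X_(lshift d dlast).
Definition topy : S := 'X_(rshift d dlast).

Lemma whom_topx : whomS d topx.
Proof. by move=> m /whomXU ->; rewrite wgt_l /= prednK. Qed.
Lemma whom_topy : whomS d topy.
Proof. by move=> m /whomXU ->; rewrite wgt_r /= prednK. Qed.
Lemma xS_top : (xS R d)`_d = topx.
Proof.
by rewrite coef_poly ltnSn gtn_eqF // /uS insubT ?dlast_lt.
Qed.
Lemma yS_top : (yS R d)`_d = topy.
Proof.
by rewrite coef_poly ltnSn gtn_eqF // /wS insubT ?dlast_lt.
Qed.

Variable om : C.
Hypothesis om_prim : N.-primitive_root om.
Local Notation ev := (@ev R d om).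
Local Notation PT := (PT d).
Local Notation U := (Upol om).
Implicit Types s t : {set 'I_N}.

Lemma Upol_iter s k : U (iter k (@rotset N) s) = U s \Po (om ^+ k *: 'X).
Proof.
apply/polyP => j; rewrite coef_comp_scaleX.
elim: k => [|k IHk]; first by rewrite expr0 expr1n mul1r.
by rewrite iterS (coef_Upol_rot om_prim) IHk mulrA exprS exprMn.
Qed.

Lemma Upol_top s : s \in PT -> (U s)`_d != 0.
Proof.
rewrite inE => /eqP sd; have := lead_coef_eq0 (U s).
by rewrite lead_coefE (size_Upol om_prim) sd /= -size_poly_eq0 (size_Upol om_prim) => ->.
Qed.

Lemma setC_PT s : s \in PT -> ~: s \in PT.
Proof. by move=> /card_setC e; rewrite inE e. Qed.

Lemma ev_topx s : s \in PT -> ev s topx != 0.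
Proof.
move=> sP; rewrite /ev mmapX mmap1U /ptv (unsplitK (inl _ _)) /= prednK //.
exact: Upol_top.
Qed.
Lemma ev_topy s : s \in PT -> ev s topy != 0.
Proof.
move=> sP; rewrite /ev mmapX mmap1U /ptv (unsplitK (inr _ _)) /= prednK //.
exact/Upol_top/setC_PT.
Qed.

(** If all components vanished at [s], [rho] would vanish at every rescaling of the point. Two
    parameters with the same image have, by multiplying the two factors, the same [N]-th power, so
    they differ by some [om^k]; for trivial stabilizer a suitable rescaling excludes this. *)
Lemma free_rho Q s : rho = \sum_(q < Q) wcomp (@wgt d) q rho -> s \in PT -> free_pt s ->
  exists q : 'I_Q, ev s (wcomp (@wgt d) q rho) != 0.
Proof.
move=> rhoE sP fr.
(* The roots of [D] are the critical points of [U s] and the values where it agrees with one of its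
   nontrivial rotations. The scale [c] is taken off these roots. *)
pose D := (U s)^`() * \prod_(k < N | k != 0 :> nat) (U (iter k (@rotset N) s) - U s).
have D0 : D != 0.
  rewrite mulf_neq0 //.
    apply/eqP => /polyP /(_ d.-1); rewrite coef_deriv prednK // coef0 => /eqP.
    by rewrite mulrn_eq0 (negbTE (Upol_top sP)) orbF gtn_eqF.
  apply/prodf_neq0 => k k0; rewrite subr_eq0 (inj_eq (Upol_inj om_prim)).
  by apply: fr; rewrite lt0n k0 ltn_ord.
have [c [c0 Dn]] : exists c : C, c != 0 /\ D.[c] != 0.
  have [n /andP[n0 Dn]] := exists_nonroot D0.
  by exists n%:R; rewrite pnatr_eq0 -lt0n.
have [q hq|h] := pickP (fun q : 'I_Q => ev s (wcomp (@wgt d) q rho) != 0); first by exists q.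
have : mmap toC (scalev (@wgt d) c (ptv om s)) rho = 0.
  rewrite rhoE raddf_sum big1 //= => q _.
  rewrite (mmap_scalev _ _ _ (@whom_wcomp _ _ _ _ _)).
  by have := h q => /negbFE/eqP; rewrite /ev => ->; rewrite mulr0.
pose x := U s \Po (c *: 'X) - 1; pose y := U (~: s) \Po (c *: 'X) - 1.
have top t : t \in PT -> (U t \Po (c *: 'X) - 1)`_d != 0.
  move=> tP; rewrite coefB coef1 gtn_eqF // subr0 coef_comp_scaleX mulf_neq0 ?Upol_top //.
  by rewrite expf_neq0.
have sz t : t \in PT -> (size (U t \Po (c *: 'X) - 1)%R <= d.+1)%N.
  move=> tP; apply/leq_sizeP => j dj; rewrite coefB coef1 gtn_eqF; last exact: leq_ltn_trans dj.
  rewrite subr0 coef_comp_scaleX nth_default ?mulr0 // (size_Upol om_prim).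
  by move: tP; rewrite inE => /eqP ->.
have evx t z : (U t \Po (c *: 'X) - 1).[z] = (U t).[c * z] - 1.
  by rewrite !hornerE horner_comp !hornerE.
have mx := ev_xS om_prim c sP; have my := ev_yS om_prim c sP.
rewrite rmorph_curve_res //=; first last.
- by have := top _ (setC_PT sP); rewrite -my coef_map.
- by have := top _ sP; rewrite -mx coef_map.
rewrite mx my rmorph1 => /eqP E; exfalso; move: E; apply/negP.
apply/(curve_res_neq0P _ _ d0 (top _ sP)) => z [zx zy].
have ex := dquotE 1 z (sz _ sP); have ey := dquotE 1 z (sz _ (setC_PT sP)).
rewrite zx mulr0 !evx mulr1 in ex; rewrite zy mulr0 !evx mulr1 in ey.
have {}ex : (U s).[c] = (U s).[c * z].
  by move/eqP: ex; rewrite opprB addrA subrK subr_eq0 => /eqP.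
have {}ey : (U (~: s)).[c] = (U (~: s)).[c * z].
  by move/eqP: ey; rewrite opprB addrA subrK subr_eq0 => /eqP.
have UU w : (U s).[w] * (U (~: s)).[w] = 1 - w ^+ N.
  by rewrite -hornerM (Upol_setC om_prim) !hornerE ?hornerXn.
have : 1 - c ^+ N = 1 - (c * z) ^+ N by rewrite -!UU ex ey.
move/addrI/oppr_inj; rewrite exprMn -{1}[c ^+ N]mulr1.
move/(mulfI (expf_neq0 _ c0))/esym => /(prim_rootP om_prim) [k zk].
move: Dn; rewrite /D hornerM horner_prod mulf_eq0 negb_or => /andP[Dd /prodf_neq0 Dk].
have [k0|k0] := eqVneq (k : nat) 0%N.
  move: zx; rewrite zk k0 expr0 dquot_diag ?sz // derivB derivC subr0 deriv_comp derivZ derivX.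
  rewrite hornerM horner_comp !hornerZ hornerX (hornerC 1) !mulr1 => /eqP.
  by rewrite mulf_eq0 (negbTE c0) orbF (negbTE Dd).
have := Dk k k0; rewrite Upol_iter !hornerE horner_comp !hornerE [om ^+ k * c]mulrC -zk -ex.
by rewrite subrr eqxx.
Qed.

Variable Q : nat.
Hypothesis rhoE : rho = \sum_(q < Q) wcomp (@wgt d) q rho.

Local Notation idx := (('I_Q * 'I_(nB d)) * ('I_(nB d) * 'I_(nB d)))%type.
(* The first three factors test the properties wanted of the solution; the factor
   [BS R x.2.1] of [vpart x] becomes the element [M] defining it. *)
Definition gpart (x : idx) : S := topx * topy * wcomp (@wgt d) x.1.1 rho * BS R x.1.2.
Definition gwt (x : idx) : nat := (d + d + x.1.1 + bwt x.1.2)%N.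
Definition vpart (x : idx) : S := gpart x * BS R x.2.1 * BS R x.2.2.
Definition vwt (x : idx) : nat := (gwt x + bwt x.2.1 + bwt x.2.2)%N.
Definition Kset : {set idx} := [set x : idx | [&& bwt x.2.1 == 1 %[mod N],
  bwt x.2.2 == 1 %[mod N] & (N %| gwt x + bwt x.2.1)%N]].

Lemma whom_gpart x : whomS (gwt x) (gpart x).
Proof.
apply: whomM; last exact: whom_BS.
by apply: whomM; [apply: whomM; [exact: whom_topx | exact: whom_topy] | exact: whom_wcomp].
Qed.
Lemma whom_vpart x : whomS (vwt x) (vpart x).
Proof. by apply: whomM; [apply: whomM; [exact: whom_gpart | exact: whom_BS] | exact: whom_BS]. Qed.

Lemma Kset_vwt x : x \in Kset -> vwt x = 1 %[mod N].
Proof.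
rewrite inE => /and3P[_ /eqP h3 /eqP h]; rewrite /vwt -modnDml h add0n.
exact: h3.
Qed.

Lemma ev_vpart s x : ev s (vpart x) = ev s (topx * topy * wcomp (@wgt d) x.1.1 rho) *
  ev s (BS R x.1.2) * ev s (BS R x.2.1) * ev s (BS R x.2.2).
Proof. by rewrite /vpart /gpart /ev !rmorphM. Qed.

(** On the orbit of [s0] the product of the three test factors is a nonzero constant times an
    [orbf]. Multiplying it by three more [orbf] of suitable classes gives a multiple of [orbf s0 1],
    and expanding these three in the basis produces only elements [vpart x] with [x] in [Kset]. *)
Lemma vanish_orbf (kap : {set 'I_N} -> C) s0 : s0 \in PT -> free_pt s0 ->
  (forall x, x \in Kset -> \sum_(s in PT) kap s * ev s (vpart x) = 0) ->
  \sum_(s in PT) kap s * orbf om s0 1 s = 0.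
Proof.
move=> sP fr H; have [q nzq] := free_rho rhoE sP fr.
pose Q0 := topx * topy * wcomp (@wgt d) q rho.
have hQ0 : whomS (d + d + q) Q0.
  by apply: whomM; [apply: whomM; [exact: whom_topx | exact: whom_topy] | exact: whom_wcomp].
have nz : ev s0 Q0 != 0.
  by rewrite /Q0 /ev !rmorphM -!/(ev _ _) !mulf_neq0 ?ev_topx ?ev_topy.
(* The class for which the test factors, this factor and one factor of class 1 together have class
   0. *)
pose m2 := (N - (d + d + q + 1) %% N)%N.
have hm2 : (N %| d + d + q + 1 + m2)%N.
  rewrite /dvdn -modnDml /m2 subnKC ?modnn //.
  by rewrite ltnW // ltn_mod muln_gt0.
have [c1 [c1P c1E]] := class_fun d0 om_prim (fun s _ => orbf_rot om_prim s0 1 s).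
have [c2 [c2P c2E]] := class_fun d0 om_prim (fun s _ => orbf_rot om_prim s0 m2 s).
apply: (mulfI nz); rewrite mulr0.
transitivity (\sum_(s in PT) kap s * (ev s Q0 * orbf om s0 m2 s * orbf om s0 1 s * orbf om s0 1 s)).
  rewrite mulr_sumr; apply: eq_bigr => s _; rewrite (ev_orbf om_prim _ _ sP fr hQ0).
  rewrite -!(mulrA (ev s0 Q0)) !orbfM // mulrCA; congr (_ * (_ * _)).
  apply: (orbf_mod om_prim); apply/eqP.
  have -> : (d + d + q + m2 + 1 + 1 = (d + d + q + 1 + m2) + 1)%N by lia.
  by rewrite -modnDml (eqP hm2) add0n.
transitivity (\sum_(b2 < nB d) \sum_(b1 < nB d) \sum_(b3 < nB d)
    c2 b2 * c1 b1 * c1 b3 * \sum_(s in PT) kap s * ev s (vpart ((q, b2), (b1, b3)))).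
  transitivity (\sum_(s in PT) \sum_(b2 < nB d) \sum_(b1 < nB d) \sum_(b3 < nB d)
      c2 b2 * c1 b1 * c1 b3 * (kap s * ev s (vpart ((q, b2), (b1, b3))))).
    apply: eq_bigr => s sP'; rewrite c1E // c2E // mulr_sum3.
    apply: eq_bigr => b2 _; apply: eq_bigr => b1 _; apply: eq_bigr => b3 _.
    by rewrite ev_vpart /= -/Q0; ring.
  rewrite exchange_big; apply: eq_bigr => b2 _; rewrite exchange_big; apply: eq_bigr => b1 _.
  by rewrite exchange_big; apply: eq_bigr => b3 _; rewrite mulr_sumr.
apply: big1 => b2 _; apply: big1 => b1 _; apply: big1 => b3 _.
have [->|n2] := eqVneq (c2 b2) 0; first by rewrite !mul0r.
have [->|n1] := eqVneq (c1 b1) 0; first by rewrite mulr0 !mul0r.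
have [->|n3] := eqVneq (c1 b3) 0; first by rewrite mulr0 !mul0r.
rewrite H ?mulr0 // inE /= (c1P _ n1) (c1P _ n3) !eqxx /gwt /=.
have e1 := c1P _ n1; have e2 := c2P _ n2.
have E : (d + d + q + bwt b2 + bwt b1 = d + d + q + 1 + m2 %[mod N])%N.
  by rewrite -addnA [(bwt b2 + _)%N]addnC -[in RHS]addnA -modnDmr -(modnDm (bwt b1)) e1 e2 modnDm modnDmr.
by rewrite /dvdn E.
Qed.

(** By duality: a linear form killing the [vv x] for [x] in [Kset] is a combination [kap] of
    evaluations at the points, since [Ev] is invertible. It kills the [orbf s0 1] by [vanish_orbf],
    hence everything of class 1 by [sum_orbf]. *)
Lemma vpart_span (vv : idx -> 'rV[R]_(nB d)) n z v :
  (forall x, NFS (vwt x) (vpart x) (vv x)) -> n = 1 %[mod N] -> NFS n z v ->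
  exists kap : 'I_#|Kset| -> R, v = \sum_k kap k *: vv (enum_val k).
Proof.
move=> hvv n1 hz; pose VV := \matrix_(k < #|Kset|) vv (enum_val k).
suff /submxP [c ->] : (v <= VV)%MS.
  exists (c 0); rewrite mulmx_sum_row; apply: eq_bigr => k _; by rewrite rowK.
rewrite submxE; apply/eqP/rowP => l; rewrite [RHS]mxE.
pose lam := col l (cokermx VV).
have -> : (v *m cokermx VV) 0 l = (v *m lam) 0 0.
  by rewrite !mxE; apply: eq_bigr => j _; rewrite !mxE.
have VVl : VV *m lam = 0 by rewrite /lam colE mulmxA mulmx_coker mul0mx.
have /row_freeP [Ei hEi] := Ev_free om_prim.
pose kap0 := Ei *m map_mx toC lam.
have kap0E : Ev d om *m kap0 = map_mx toC lam by rewrite mulmxA hEi mul1mx.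
pose kap s : C := \sum_(p < #|PT|) kap0 p 0 * (s == enum_val p)%:R.
have key m y w : NFS m y w -> toC ((w *m lam) 0 0) =
    \sum_(s in PT) kap s * ev s y.
  move=> hy; transitivity (\sum_(p < #|PT|) kap0 p 0 * ev (enum_val p) y); last first.
    rewrite /kap; under [RHS]eq_bigr do rewrite mulr_suml.
    rewrite [RHS]exchange_big; apply: eq_bigr => p _ /=.
    rewrite (bigD1 _ (enum_valP p)) /= eqxx mulr1 big1 ?addr0 // => s /andP[_ /negbTE ->].
    by rewrite mulr0 mul0r.
  under [RHS]eq_bigr => p _ do rewrite (ev_NF om_prim (enum_valP p) hy) mulr_sumr.
  rewrite exchange_big mxE rmorph_sum; apply: eq_bigr => j _ /=.
  have /matrixP /(_ j 0) := kap0E; rewrite [X in _ = X -> _]mxE rmorphM /= => <-.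
  rewrite mxE mulr_sumr; apply: eq_bigr => p _; rewrite mxE; ring.
apply: (@complexI R); rewrite (key _ _ _ hz).
have hw := NF_whom (@whom_BS R d) (@whom_PhiS R d _) hz.
rewrite (sum_orbf d0 om_prim hw n1) // => s0 sP fr; apply: vanish_orbf => // x xK.
rewrite -(key _ _ _ (hvv x)).
have -> : vv x = row (enum_rank_in xK x) VV by rewrite rowK enum_rankK_in.
by rewrite -row_mul VVl !mxE.
Qed.
End FreeResultant.

(** * Conclusion *)

Lemma odd_card_box d : (0 < d)%N -> squarefree_nat d ->
  odd #|[set j : 'I_(nB d) | bwt j == 1 %[mod 2 * d]]|.
Proof.
move=> d0 sq; have := odd_count_box d0 sq.
by rewrite -sum1_count (big_nth [::]) big_mkord sum1dep_card.
Qed.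

Lemma dvdp_Xn_coef (F : fieldType) n (p : {poly F}) :
  (forall i, (i < n)%N -> p`_i = 0) -> 'X^n %| p.
Proof.
move=> h; rewrite -(poly_take_drop n p) (_ : take_poly n p = 0) ?add0r ?dvdp_mulIr //.
by apply/polyP => i; rewrite coef_take_poly coef0; case: ifP => // /h.
Qed.

Section RealSolution.
Variables (R : realType) (d : nat).
Hypothesis d0 : (0 < d)%N.
Local Notation N := (2 * d)%N.
Local Notation S := {mpoly R[d + d]}.
Local Notation whomS := (whom (@wgt d)).

Lemma interpolant_of_solution (f : {mpoly R[2]}) (al : 'I_(d + d) -> R) :
  f@_0 = 0 ->
  (topx R d0).@[al] != 0 -> (topy R d0).@[al] != 0 -> (rho R d).@[al] != 0 ->
  (forall i : 'I_(d + d), (i.+1 < N)%N -> (PhiS (@coefvec R d f) i).@[al] = 0) ->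
  has_real_dd_interpolant d f.
Proof.
move=> ff0 tx ty nrho sol.
pose x := map_poly (meval al) (xS R d); pose y := map_poly (meval al) (yS R d).
have xd : x`_d != 0 by rewrite coef_map /= (xS_top R d0).
have yd : y`_d != 0 by rewrite coef_map /= (yS_top R d0).
have size_eq (p : {poly R}) : (size p <= d.+1)%N -> p`_d != 0 -> size p = d.+1.
  move=> le pd; apply/eqP; rewrite eqn_leq le ltnNge; apply: contra pd => h.
  by rewrite nth_default.
have sx : size x = d.+1.
  by apply: size_eq => //; apply: leq_trans (size_poly _ _) _; exact: size_poly.
have sy : size y = d.+1.
  by apply: size_eq => //; apply: leq_trans (size_poly _ _) _; exact: size_poly.
exists x, y; split=> //.
- by rewrite horner_coef0 coef_map /= xS0 meval0.
- by rewrite horner_coef0 coef_map /= yS0 meval0.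
split.
  have toCx (p : {poly R}) : cpoly p = map_poly (@real_complex R) p by [].
  have szC (p : {poly R}) : size (cpoly p) = size p by rewrite toCx size_map_poly.
  have nz : curve_res d (cpoly x) (cpoly y) 1 != 0.
    have nzC (z : R) : z != 0 -> (real_complex R) z != 0 by rewrite fmorph_eq0.
    rewrite !toCx -(rmorph1 (@real_complex R)) -rmorph_curve_res ?nzC //.
    by rewrite -(rmorph1 (meval al)) -rmorph_curve_res ?(xS_top R d0) ?(yS_top R d0).
  have [s hs] := curve_res_inj d0 (etrans (szC x) sx) (etrans (szC y) sy) nz.
  by exists s => t u ts _; exact: hs.
(* The coefficient of [t^0] is treated apart: it vanishes because [f] has no constant term. *)
apply: dvdp_Xn_coef => -[_|i hi].
  rewrite comp_curveE coef_sum big1 // => m _; rewrite coefZ.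
  have [/eqP|m0] := posnP (mdeg m); first by rewrite mdeg_eq0 => /eqP ->; rewrite ff0 mul0r.
  by rewrite coef_pmon_lt ?mulr0 // coef_map /= ?xS0 ?yS0 meval0.
have hi' : (i < d + d)%N by lia.
by rewrite (coef_comp_curve al (Ordinal hi') ff0) sol.
Qed.
End RealSolution.

Theorem theorem4p3 (R : realType) (d : nat) :
  (0 < d)%N -> squarefree_nat d ->
  generic_origin d (fun f : {mpoly R[2]} => has_real_dd_interpolant d f).
Proof.
move=> d0 sq; pose N := (2 * d)%N; have N0 : (0 < N)%N by rewrite muln_gt0.
have [om om_prim] : exists om : R[i], N.-primitive_root om.
  by apply: exists_prim_root => //; rewrite pnatr_eq0 -lt0n.
have [Q rhoE] := wcomp_sum (@wgt d) (rho R d).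
have /fin_all_exists [vv hvv] := fun x => NF_base (@whom_vpart R d d0 Q x).
have whomPhi (c : 'I_(ncoef d) -> R) i : whom (@wgt d) (wPhi i) (PhiS c i) by exact: whom_PhiS.
have thN (i : 'I_(d + d)) : thS R i != 0 -> (N %| wPhi i)%N.
  by rewrite /thS /wPhi; case: ifP => [/eqP ->|_]; rewrite ?dvdnn ?eqxx.
have B1 : exists2 j, BS R j = 1 & bwt (d := d) j = 0%N.
  have h : (index [::] (box d d) < nB d)%N by rewrite index_mem nil_in_box.
  by exists (Ordinal h); rewrite /BS /bwt /= nth_index ?nil_in_box // /bmon big_nil.
have G1 := generic_NFex (@wgt_gt0 d) (@whom_BS R d) whomPhi (@polyfam_PhiS R d) (@NF_base R d) B1.
have G2 := generic_functional (N := N) (@wgt_gt0 d) (@whom_BS R d) whomPhi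
   (@polyfam_PhiS R d) (@NF_base R d) (fun k : 'I_#|Kset d Q| => hvv (enum_val k))
   (fun k => Kset_vwt (enum_valP k)) (fun n z v => @vpart_span R d d0 om om_prim Q rhoE vv n z v hvv).
have [p [p0 hp]] := genericI G1 G2.
(* The closed set is the zero set of the single polynomial [p], and the hyperbola lies outside
   it. *)
exists (fun q => q = p); split; first by exists (@cbase R d), p.
move=> f ff0 nz; have {nz} : p.@[@coefvec R d f] != 0.
  by apply/eqP => e; apply: nz => _ ->.
move=> /hp [ex G]; set c := @coefvec R d f in ex G.
(* Uniqueness follows from existence and the count of monomials. *)
have un n z v v' : NF (@wPhi d) (@BS R d) (@bwt d) (@thS R d) (PhiS c) n z v ->
    NF (@wPhi d) (@BS R d) (@bwt d) (@thS R d) (PhiS c) n z v' -> v = v'.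
  have card_eq : #|Xset (@wPhi d) (@bwt d) n| = #|Yset (@wgt d) n| by exact: card_exponents.
  by apply: NF_unique card_eq (ex n).
have [L [chi [Llin LPhi Lmul [j0 bj0 Lj0]]]] := eigen_functional (@whom_BS R d)
  (@whomPhi c) thN ex un (odd_card_box d0 sq).
(* If [L] vanished on all these elements, [G] would make it vanish on [BS R j0], against [Lj0]. *)
have [k Lk] : exists k : 'I_#|Kset d Q|, L (vwt (enum_val k)) (vpart R d0 (enum_val k)) != 0.
  apply/existsP; apply: contraNT Lj0 => /existsPn h; apply/eqP/(G L) => // k.
  by apply/eqP; have := h k; rewrite negbK.
move: (enum_val k) (enum_valP k) Lk => x xK Lx {k}.
have [/eqP h1 _ hN] : [/\ bwt x.2.1 == 1 %[mod N], bwt x.2.2 == 1 %[mod N] & (N %| gwt x + bwt x.2.1)%N].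
  by move: xK; rewrite inE => /and3P.
(* Splitting off the last factor of [vpart] by [Lmul] leaves [chi] of a part of class 0. *)
have chi0 : chi (gwt x + bwt x.2.1)%N (gpart R d0 x * BS R x.2.1) != 0.
  apply: contraNneq Lx => e; rewrite /vwt /vpart Lmul ?e ?mul0r //; last exact: whom_BS.
  by apply: whomM; [exact: whom_gpart | exact: whom_BS].
pose M := BS R x.2.1; have hM : whom (@wgt d) (bwt x.2.1) M by exact: whom_BS.
pose al := chi_point N (@wgt d) chi M (bwt x.2.1).
have nz0 := chi_point_neq0 N0 Llin Lmul (@whom_BS R d j0) Lj0 hM h1.
have hx : whom (@wgt d) d (topx R d0) by exact: whom_topx.
have hy : whom (@wgt d) d (topy R d0) by exact: whom_topy.
have hr : whom (@wgt d) x.1.1 (wcomp (@wgt d) x.1.1 (rho R d)) by exact: whom_wcomp.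
have hB := @whom_BS R d x.1.2.
have alx : (topx R d0).@[al] != 0.
  have := nz0 _ _ _ _ hx (whomM (whomM hy hr) hB).
  have -> : (d + (d + x.1.1 + bwt x.1.2) = gwt x)%N by rewrite /gwt !addnA.
  by apply=> //; rewrite !mulrA.
have aly : (topy R d0).@[al] != 0.
  have := nz0 _ _ _ _ hy (whomM (whomM hx hr) hB).
  have -> : (d + (d + x.1.1 + bwt x.1.2) = gwt x)%N by rewrite /gwt !addnA.
  by apply=> //; rewrite !mulrA [topy R d0 * _]mulrC.
have alr : (wcomp (@wgt d) x.1.1 (rho R d)).@[al] != 0.
  have := nz0 _ _ _ _ hr (whomM (whomM hx hy) hB).
  have -> : (x.1.1 + (d + d + bwt x.1.2) = gwt x)%N by rewrite /gwt addnCA addnA.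
  by apply=> //; rewrite !mulrA [wcomp _ _ _ * _]mulrC -!mulrA [wcomp _ _ _ * _]mulrCA !mulrA.
(* Here [thS R i] is 0, so [L] kills the multiples of [PhiS c i], and therefore [chi] kills those of
   class 0. *)
have sol (i : 'I_(d + d)) : (i.+1 < N)%N -> (PhiS c i).@[al] = 0.
  move=> iN; have hk : whom (@wgt d) (bwt x.2.1 * (N.-1 * i.+1)) (M ^+ (N.-1 * i.+1)) by exact: whomXn.
  rewrite (chi_pointE N0 Llin Lmul (@whom_BS R d j0) Lj0 hM h1 (@whom_PhiS R d c i)).
  apply: (mulIf Lj0); rewrite mul0r -Lmul ?dvd_class //; last 2 first.
  - by apply: whomM => //; exact: whom_PhiS.
  - exact: whom_BS.
  rewrite -addnA -mulrA LPhi; last by apply: whomM => //; exact: whom_BS.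
  by rewrite /thS ltn_eqF // mul0r.
(* Only one component of [rho] is known to be nonzero at [al]. Rescaling the parameter by [n] gives
   [rho] the value [P.[n]], with [P] nonzero; the other conditions are homogeneous and survive. *)
pose P : {poly R} := \poly_(q < Q) (wcomp (@wgt d) q (rho R d)).@[al].
have P0 : P != 0.
  apply: contra_neq alr => e; have := coef0 R x.1.1; rewrite -e coef_poly ltn_ord.
  by [].
have [n /andP[n0 Pn]] := exists_nonroot P0.
pose be := scalev (@wgt d) (n%:R : R) al.
have nR : n%:R != 0 :> R by rewrite pnatr_eq0 -lt0n.
have beE m z : whom (@wgt d) m z -> z.@[be] = n%:R ^+ m * z.@[al].
  exact: (@mmap_scalev R R idfun _ (@wgt d) n%:R al m z).
apply: (interpolant_of_solution (d0 := d0) (al := be)) => //.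
- by rewrite (beE _ _ hx) mulf_neq0 ?expf_neq0.
- by rewrite (beE _ _ hy) mulf_neq0 ?expf_neq0.
- rewrite rhoE raddf_sum /=; apply: contraNneq Pn => e; rewrite horner_poly -[X in _ == X]e; apply/eqP.
  by apply: eq_bigr => q _; rewrite (beE _ _ (@whom_wcomp _ _ _ _ _)) mulrC.
- by move=> i iN; rewrite (beE _ _ (@whom_PhiS R d c i)) sol ?mulr0.
Qed.
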